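(* Let $\widetilde b_0(u,z)=1+\sum_{k\ge0}\sum_{N\ge1}|\widetilde\Omega_{k,0}^N|u^kz^N$, $\widetilde b_1(u,z)=\sum_{k\ge0}\sum_{N\ge1}|\widetilde\Omega_{k,1}^N|u^kz^N$, $\widetilde c_1(z)=\sum_{N\ge1}|\widetilde{\mathcal I}_1^N|z^N$ and $\widetilde s(z)=\sum_{N\ge1}|\widetilde\Psi^N|z^N$ be the divergence-free analogues of the generating functions $b_0,b_1,c_1,s$. Then, as formal power series, $$\widetilde b_0(u,z)=\frac{z\,b_0(u,z)}{t(z)},$$ $$\widetilde b_1(u,z)=z\,b_0(u,z)\frac{t(z)+u-u\,t(z)}{(1-t(z))^2},$$ $$\widetilde c_1(z)=z\,c_1(z),$$ $$\widetilde s(z)=z+\frac{z\,s(z)}{t(z)}=z+\frac{z\,(a(z)t(z)-\mathring a(z))}{t(z)}.$$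
   Context: Aromatic forests. Let $V$ be a finite nonempty set of nodes and $E\subset V\times V$ a set of edges; an edge $(v,w)$ goes from $v$ to $w$ and then $v$ is a predecessor of $w$; $\Pi(v)$ is the set of predecessors of $v$. Each node is the source of at most one edge; nodes with no outgoing edge are called roots. $V$ is split into vertices $V^\bullet$ and covertices $V^\circ$. The covertices are numbered $1,\dots,p$, the roots are numbered $1,\dots,n$, the vertices are not numbered. Such graphs, up to isomorphism preserving the vertex/covertex type and the numberings, are called aromatic forests; $\mathcal F_{n,p}^N$ is the set of aromatic forests with $n$ roots, $p$ covertices and exactly $N$ nodes. Aromatic forms. $S_n^\bullet$ and $S_p^\circ$ act on $\mathcal F_{n,p}^N$ by permuting the numbers of the roots, respectively covertices. $\wedge^\bullet\gamma=\frac1{n!}\sum_{\sigma\in S_n^\bullet}\varepsilon(\sigma)\sigma\gamma$, $\wedge^\circ\gamma=\frac1{p!}\sum_{\sigma\in S_p^\circ}\varepsilon(\sigma)\sigma\gamma$, $\wedge=\wedge^\bullet\wedge^\circ$, extended linearly. $\Omega_{n,p}^N=\wedge\operatorname{Span}_{\mathbb R}(\mathcal F_{n,p}^N)$. $|X|$ denotes the dimension of a vector space $X$. For $\gamma\in\mathcal F_{1,0}^N$ with root $r$, $d_H\gamma$ is the sum over all nodes $u$ (including $u=r$) of $\gamma$ with the edge $(r,u)$ added; linearly $d_H:\Omega_{1,0}^N\to\Omega_{0,0}^N$. $\Psi^N=\operatorname{Ker}(d_H|_{\Omega_{1,0}^N})$. For $\gamma\in\mathcal F_{0,1}^N$ with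 covertex $c$, let $I\gamma=(-1)^{|\Pi(c)|}\sum\gamma'$, the sum over all ways of redirecting simultaneously the outgoing edges of all predecessors of $c$ (including $c$ itself if $(c,c)$ is an edge) to nodes different from $c$, independently (one term per map $\Pi(c)\to V\setminus\{c\}$). Extended linearly, $\mathcal I_1^N=I(\Omega_{0,1}^N)$. Divergence-free version. A 1-loop is an edge $(v,v)$ ($v$ any node). $\mathcal A$ is the span of forests containing at least one 1-loop, $\mathcal A_{n,p}^N=\mathcal A\cap\Omega_{n,p}^N$, $\widetilde\Omega_{n,p}^N=\Omega_{n,p}^N/\mathcal A_{n,p}^N$, which is identified with the span of the wedges of forests without 1-loops. $d_H$ descends to $\widetilde\Omega_{1,0}^N\to\widetilde\Omega_{0,0}^N$ and $\widetilde\Psi^N=\operatorname{Ker}(d_H|_{\widetilde\Omega_{1,0}^N})$. $\widetilde{\mathcal I}_1^N=I(\widetilde\Omega_{0,1}^N)\subset\widetilde\Omega_{0,1}^N$, where $I$ is applied to combinations of forests without 1-loops and forests with 1-loops in the result are set to $0$. Generating functions. $t(z)=\sum_{N\ge1}T_Nz^N$, where $T_N$ is the number of (unlabelled) rooted trees with $N$ nodes. $a(z)=1+\sum_{N\ge1}|\Omega_{0,0}^N|z^N$. $\mathring a(z)=\sum_{N\ge1}|\mathring\Omega_0^N|z^N$, where $\mathring\Omega_0^N\subset\Omega_{0,0}^N$ is the span of forests in $\mathcal F_{0,0}^N$ with at least one 1-loop. $b_0(u,z)=1+\sum_{k\ge0}\sum_{N\ge1}|\Omega_{k,0}^N|u^kz^N$,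 $c_1(z)=\sum_{N\ge1}|\mathcal I_1^N|z^N$, $s(z)=\sum_{N\ge1}|\Psi^N|z^N$. *)

(* Defs.v *)
From HB Require Import structures.
From mathcomp Require Import all_boot all_order all_algebra all_fingroup.
From mathcomp Require Import generic_quotient fraction.
From mathcomp Require Import zify boolp reals.
Set Implicit Arguments. Unset Strict Implicit. Unset Printing Implicit Defensive.
Import GRing.Theory.
Local Open Scope ring_scope.

Record fps (A : Type) := Fps { fcoef : nat -> A }.

HB.instance Definition _ (A : Type) := gen_eqMixin (fps A).
HB.instance Definition _ (A : Type) := gen_choiceMixin (fps A).

Lemma fpsP (A : Type) (f g : fps A) : (forall n, fcoef f n = fcoef g n) -> f = g.
Proof. by case: f => f; case: g => g /= fg; congr Fps; apply: funext. Qed.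

Section FpsRing.
Variable A : comNzRingType.
Implicit Types f g h : fps A.

Definition fzero : fps A := Fps (fun=> 0).
Definition fone : fps A := Fps (fun n => (n == 0)%:R).
Definition fopp f : fps A := Fps (fun n => - fcoef f n).
Definition fadd f g : fps A := Fps (fun n => fcoef f n + fcoef g n).
Definition fmul f g : fps A :=
  Fps (fun n => \sum_(i < n.+1) fcoef f i * fcoef g (n - i)).

Fact faddA : associative fadd.
Proof. by move=> f g h; apply: fpsP => n /=; rewrite addrA. Qed.
Fact faddC : commutative fadd.
Proof. by move=> f g; apply: fpsP => n /=; rewrite addrC. Qed.
Fact fadd0 : left_id fzero fadd.
Proof. by move=> f; apply: fpsP => n /=; rewrite add0r. Qed.
Fact faddN : left_inverse fzero fopp fadd.
Proof. by move=> f; apply: fpsP => n /=; rewrite addNr. Qed.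

HB.instance Definition _ :=
  GRing.isZmodule.Build (fps A) faddA faddC fadd0 faddN.

Let trunc m f : {poly A} := \poly_(i < m) fcoef f i.

Let fcoefM_trunc m f g n : (n < m)%N ->
  fcoef (fmul f g) n = (trunc m f * trunc m g)`_n.
Proof.
move=> nm; rewrite coefM; apply: eq_bigr => i _.
have in_ : (i < m)%N by rewrite (leq_ltn_trans _ nm) // -ltnS.
by rewrite !coef_poly in_ (leq_ltn_trans (leq_subr i n) nm).
Qed.

Let truncM m f g n : (n < m)%N ->
  (trunc m (fmul f g))`_n = (trunc m f * trunc m g)`_n.
Proof. by move=> nm; rewrite coef_poly nm (fcoefM_trunc _ _ nm). Qed.

Fact fmulC : commutative fmul.
Proof.
by move=> f g; apply: fpsP => n; rewrite !(@fcoefM_trunc n.+1) // mulrC.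
Qed.
Fact fmulA : associative fmul.
Proof.
move=> f g h; apply: fpsP => n; rewrite !(@fcoefM_trunc n.+1) //.
transitivity (trunc n.+1 f * trunc n.+1 g * trunc n.+1 h)`_n.
  rewrite -mulrA !coefM; apply: eq_bigr => i _; congr (_ * _).
  by rewrite truncM // ltnS leq_subr.
by rewrite !coefM; apply: eq_bigr => i _; rewrite truncM.
Qed.
Fact fmul1 : left_id fone fmul.
Proof.
move=> f; apply: fpsP => n /=.
rewrite big_ord_recl /= mul1r subn0 big1 ?addr0 // => i _; exact: mul0r.
Qed.
Fact fmulDl : left_distributive fmul fadd.
Proof.
move=> f g h; apply: fpsP => n /=; rewrite -big_split /=.
by apply: eq_bigr => i _; rewrite mulrDl.
Qed.
Fact fone_neq0 : fone != 0.
Proof. by apply/eqP => /(congr1 (@fcoef A ^~ 0))/eqP; rewrite /= oner_eq0. Qed.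

HB.instance Definition _ := GRing.Zmodule_isComNzRing.Build (fps A)
  fmulA fmulC fmul1 fmulDl fone_neq0.

Definition funit : {pred fps A} := [pred f | `[< exists g, g * f = 1 >]].
Definition finv f : fps A :=
  if asboolP (exists g, g * f = 1) is ReflectT fU then projT1 (cid fU) else f.

Fact fmulV : {in funit, left_inverse 1 finv *%R}.
Proof.
move=> f /asboolP fU; rewrite /finv; case: asboolP => // fU'.
exact: projT2 (cid fU').
Qed.
Fact funitP f g : g * f = 1 -> f \in funit.
Proof. by move=> gf1; apply/asboolP; exists g. Qed.
Fact finv_out : {in [predC funit], finv =1 id}.
Proof. by move=> f /asboolP nfU; rewrite /finv; case: asboolP. Qed.

HB.instance Definition _ := GRing.ComNzRing_hasMulInverse.Build (fps A)
  fmulV funitP finv_out.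

End FpsRing.

Fact fmul_eq0 (A : idomainType) (f g : fps A) :
  f * g = 0 -> (f == 0) || (g == 0).
Proof.
move=> fg0; case: eqVneq => //= f0; case: eqVneq => //= g0.
have val_ex (h : fps A) : h != 0 -> exists n, fcoef h n != 0.
  move=> h0; apply: contrapT => nh; move/eqP: h0; apply; apply: fpsP => n.
  by apply/eqP; apply/negPn/negP => hn; apply: nh; exists n.
case: (ex_minnP (val_ex f f0)) => i fi mini.
case: (ex_minnP (val_ex g g0)) => j gj minj.
have /(congr1 (@fcoef A ^~ (i + j)%N)) /= := fg0.
have ij : (i < (i + j).+1)%N by rewrite ltnS leq_addr.
rewrite (bigD1 (Ordinal ij)) //= addKn big1 ?addr0.
  by move/eqP; rewrite mulf_eq0 (negPf fi) (negPf gj).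
move=> k kNi; case: (ltngtP k i) => [ki|ik|ki].
- have [->|/mini] := eqVneq (fcoef f k) 0; first by rewrite mul0r.
  by rewrite leqNgt ki.
- have [->|/minj] := eqVneq (fcoef g (i + j - k)) 0; first by rewrite mulr0.
  by move=> ?; have := ltn_ord k; lia.
- by case/eqP: kNi; apply: val_inj.
Qed.

HB.instance Definition _ (A : idomainType) :=
  GRing.ComUnitRing_isIntegral.Build (fps A) (@fmul_eq0 A).

Local Open Scope quotient_scope.

(* A labelled forest on the nodes 'I_N: [out v] is the target of the unique
   edge leaving v, if any, [rt i] is the root number i, and [cov j] is the
   covertex number j; the nodes outside the range of [cov] are the vertices.
   Covertices may be roots. *)
Definition lforest_axiom (n p N : nat) (e : {ffun 'I_N -> option 'I_N})
    (r : {ffun 'I_n -> 'I_N}) (c : {ffun 'I_p -> 'I_N}) : bool :=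
  [&& injectiveb r, [forall v, (v \in codom r) == (e v == None)]
    & injectiveb c].

Record lforest (n p N : nat) := LForest {
  lforest_val :
    {ffun 'I_N -> option 'I_N} * {ffun 'I_n -> 'I_N} * {ffun 'I_p -> 'I_N};
  _ : lforest_axiom lforest_val.1.1 lforest_val.1.2 lforest_val.2 }.

HB.instance Definition _ n p N := [isSub for @lforest_val n p N].
HB.instance Definition _ n p N := [Finite of lforest n p N by <:].

Section LabelledForest.
Variables n p N : nat.
Implicit Types x y z : lforest n p N.

Definition out x := (lforest_val x).1.1.
Definition rt x := (lforest_val x).1.2.
Definition cov x := (lforest_val x).2.

Lemma rt_inj x : injective (rt x).
Proof. by case/and3P: (valP x) => /injectiveP. Qed.
Lemma mem_rt x v : (v \in codom (rt x)) = (out x v == None).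
Proof. by case/and3P: (valP x) => _ /forallP/(_ v)/eqP. Qed.
Lemma cov_inj x : injective (cov x).
Proof. by case/and3P: (valP x) => _ _ /injectiveP. Qed.

Lemma lforestP x y :
  out x =1 out y -> rt x =1 rt y -> cov x =1 cov y -> x = y.
Proof.
move=> exy rxy cxy; apply: val_inj.
move: exy rxy cxy; rewrite /out /rt /cov /=.
case: (lforest_val x) (lforest_val y) => [[ex rx] cx] [[ey ry] cy] /=.
by move=> /ffunP -> /ffunP -> /ffunP ->.
Qed.

Definition iso_by (s : 'S_N) x y : bool :=
  [&& [forall v, out y (s v) == omap s (out x v)],
      [forall i, rt y i == s (rt x i)]
    & [forall j, cov y j == s (cov x j)]].

Lemma iso_byP (s : 'S_N) x y :
  reflect [/\ forall v, out y (s v) = omap s (out x v),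
              forall i, rt y i = s (rt x i) & forall j, cov y j = s (cov x j)]
          (iso_by s x y).
Proof.
apply: (iffP and3P) => [[/forallP A /forallP B /forallP C]|[A B C]].
  by split=> ?; apply/eqP.
by split; apply/forallP => ?; apply/eqP.
Qed.

Definition iso x y : bool := [exists s, iso_by s x y].

Fact iso_refl : reflexive iso.
Proof.
move=> x; apply/existsP; exists 1%g; apply/iso_byP.
split=> k; rewrite ?perm1 //; case: (out x k) => //= w; by rewrite perm1.
Qed.

Fact iso_sym : symmetric iso.
Proof.
suff h x y : iso x y -> iso y x by move=> x y; apply/idP/idP; apply: h.
move=> /existsP[s /iso_byP[A B C]]; apply/existsP; exists s^-1%g.
apply/iso_byP; split=> k; rewrite ?B ?C ?permK //.
rewrite -{2}(permKV s k) A; case: (out x _) => //= w; by rewrite permK.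
Qed.

Fact iso_trans : transitive iso.
Proof.
move=> y x z /existsP[s /iso_byP[A B C]] /existsP[t /iso_byP[A' B' C']].
apply/existsP; exists (s * t)%g; apply/iso_byP; split=> k.
- by rewrite permM A' A; case: (out x k) => //= w; rewrite permM.
- by rewrite B' B permM.
- by rewrite C' C permM.
Qed.

Canonical iso_equiv := EquivRel iso iso_refl iso_sym iso_trans.

End LabelledForest.

(* Isomorphism classes. Operations on them are defined through [repr]; they
   are compatible with [iso], so the choice of representative is irrelevant. *)
Definition aforest (n p N : nat) := {eq_quot (@iso_equiv n p N)}.

HB.instance Definition _ n p N := EqQuotient.on (aforest n p N).
HB.instance Definition _ n p N := Finite.copy (aforest n p N)
  (can_type (EquivQuot.ereprK : cancel _ (_ : _ -> aforest n p N))).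

Lemma pi_iso n p N (x y : lforest n p N) :
  (\pi_(aforest n p N) x = \pi_(aforest n p N) y) <-> iso x y.
Proof. by split=> [/eqmodP|xy]//; apply/eqmodP. Qed.

Section Forest.
Variables n p N : nat.
Implicit Types (x y : lforest n p N) (g : aforest n p N).

Definition has_loop x : bool := [exists v, out x v == Some v].

Definition ahas_loop g : bool := has_loop (repr g).

(* Edges point towards the root, so a forest with one root is a tree iff every
   node leads to the root. *)
Definition is_tree (x : lforest 1 0 N) : bool :=
  [forall v, connect (fun v w => out x v == Some w) v (rt x ord0)].

(* Root number [i] of x is root number [s i] of [perm_rt s x]. *)
Fact perm_rt_subproof (s : 'S_n) x :
  lforest_axiom (out x) [ffun i => rt x ((s^-1)%g i)] (cov x).
Proof.
apply/and3P; split.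
- by apply/injectiveP => i j; rewrite !ffunE => /rt_inj/perm_inj.
- apply/forallP => v; rewrite -mem_rt; apply/eqP.
  apply/codomP/codomP => -[i ->]; rewrite ?ffunE; first by eexists.
  by exists (s i); rewrite ffunE permK.
- exact/injectiveP/cov_inj.
Qed.
Definition perm_rt s x : lforest n p N :=
  @LForest n p N (out x, _, cov x) (perm_rt_subproof s x).

Fact perm_cov_subproof (s : 'S_p) x :
  lforest_axiom (out x) (rt x) [ffun j => cov x ((s^-1)%g j)].
Proof.
apply/and3P; split; first exact/injectiveP/rt_inj.
  by apply/forallP => v; rewrite mem_rt.
by apply/injectiveP => i j; rewrite !ffunE => /cov_inj/perm_inj.
Qed.
Definition perm_cov s x : lforest n p N :=
  @LForest n p N (out x, rt x, _) (perm_cov_subproof s x).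

Lemma has_loop_iso x y : iso x y -> has_loop x = has_loop y.
Proof.
suff h a b : iso a b -> has_loop a -> has_loop b.
  by move=> xy; apply/idP/idP; apply: h; rewrite // iso_sym.
case/existsP=> s /iso_byP[A _ _] /existsP[v /eqP av].
by apply/existsP; exists (s v); rewrite A av.
Qed.

Lemma ahas_loop_pi x : ahas_loop (\pi_(aforest n p N) x) = has_loop x.
Proof. by apply/has_loop_iso/pi_iso; rewrite reprK. Qed.

Lemma perm_rt_iso s x y : iso x y -> iso (perm_rt s x) (perm_rt s y).
Proof.
case/existsP=> t /iso_byP[A B C]; apply/existsP; exists t; apply/iso_byP.
by split=> [v|i|j]; [exact: A|rewrite !ffunE B|exact: C].
Qed.

Lemma perm_cov_iso s x y : iso x y -> iso (perm_cov s x) (perm_cov s y).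
Proof.
case/existsP=> t /iso_byP[A B C]; apply/existsP; exists t; apply/iso_byP.
by split=> [v|i|j]; [exact: A|exact: B|rewrite !ffunE C].
Qed.

End Forest.

Section Operations.
Variable N : nat.

Definition add_edge_out (x : lforest 1 0 N) (u : 'I_N) :=
  [ffun v => if v == rt x ord0 then Some u else out x v].

Fact add_edge_subproof x u :
  lforest_axiom (add_edge_out x u) (ffun0 (card_ord 0) : {ffun 'I_0 -> 'I_N})
    (cov x).
Proof.
apply/and3P; split; last exact/injectiveP/cov_inj.
  by apply/injectiveP => -[].
apply/forallP => v; rewrite ffunE.
have -> : (v \in codom (ffun0 (card_ord 0) : {ffun 'I_0 -> 'I_N})) = false.
  by apply/codomP => -[[]].
case: (v =P rt x ord0) => // vr; rewrite -mem_rt.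
apply/eqP/esym/negbTE/codomP => -[i].
by rewrite (ord1 i).
Qed.
Definition add_edge x u : lforest 0 0 N :=
  @LForest 0 0 N (_, _, _) (add_edge_subproof x u).

Definition preds n p (x : lforest n p N) (v : 'I_N) : {set 'I_N} :=
  [set w | out x w == Some v].

Section Redirect.
Variable x : lforest 0 1 N.
Let c := cov x ord0.
Variable h : {ffun {v | v \in preds x c} -> {w | w != c}}.

Definition redirect_out :=
  [ffun v => if insub v is Some v' then Some (val (h v')) else out x v].

Fact redirect_subproof : lforest_axiom redirect_out (rt x) (cov x).
Proof.
apply/and3P; split; [exact/injectiveP/rt_inj| |exact/injectiveP/cov_inj].
apply/forallP => v; rewrite mem_rt ffunE; case: insubP => // v' _ <-.
by have := valP v'; rewrite inE => /eqP ->.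
Qed.
Definition redirect : lforest 0 1 N :=
  @LForest 0 1 N (_, _, _) redirect_subproof.
End Redirect.

End Operations.

Section LinearExtension.
Variables (K : fieldType) (T : finType) (V : vectType K).

Definition fvec (t : T) : {ffun T -> K^o} := [ffun t' => (t' == t)%:R].

Definition lin_ext (f : T -> V) : 'Hom({ffun T -> K^o}, V) :=
  linfun (fun a : {ffun T -> K^o} => \sum_t (a t : K) *: f t).

Lemma lin_extE f (a : {ffun T -> K^o}) :
  lin_ext f a = \sum_t (a t : K) *: f t.
Proof.
pose F (a : {ffun T -> K^o}) := \sum_t (a t : K) *: f t.
have linF : linear F.
  move=> k x y; rewrite /F scaler_sumr -big_split /=.
  by apply: eq_bigr => t _; rewrite !ffunE scalerDl scalerA.
pose L := GRing.isLinear.Build _ _ _ _ _ linF.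
pose G : {linear {ffun T -> K^o} -> V} := HB.pack F L.
exact: (lfunE G).
Qed.

Lemma lin_ext_fvec f t : lin_ext f (fvec t) = f t.
Proof.
rewrite lin_extE (bigD1 t) //= ffunE eqxx scale1r big1 ?addr0 // => u ut.
by rewrite ffunE (negPf ut) scale0r.
Qed.

Lemma fvec_sum (a : {ffun T -> K^o}) : a = \sum_t (a t : K) *: fvec t.
Proof.
apply/ffunP => u; rewrite sum_ffunE (bigD1 u) //= !ffunE eqxx big1 ?addr0.
  by rewrite /GRing.scale /= mulr1.
by move=> t tu; rewrite !ffunE eq_sym (negPf tu) /GRing.scale /= mulr0.
Qed.

End LinearExtension.

Notation fspan R n p N := {ffun aforest n p N -> R^o}.

Section Forms.
Variable R : realType.
Local Notation fvec := (fvec R).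
Local Notation cls x := (\pi_(aforest _ _ _) x).

Section Wedge.
Variables n p N : nat.
Local Notation Span := (fspan R n p N).

Definition wedge_rt : 'End(Span) := lin_ext (fun g : aforest n p N =>
  (n`!%:R^-1 : R) *:
    \sum_(s : 'S_n) ((-1) ^+ s : R) *: fvec (cls (perm_rt s (repr g)))).

Definition wedge_cov : 'End(Span) := lin_ext (fun g : aforest n p N =>
  (p`!%:R^-1 : R) *:
    \sum_(s : 'S_p) ((-1) ^+ s : R) *: fvec (cls (perm_cov s (repr g)))).

Definition wedge : 'End(Span) := (wedge_rt \o wedge_cov)%VF.

Definition Omega : {vspace Span} := limg wedge.

Definition loop_span : {vspace Span} :=
  <<[seq fvec g | g in @ahas_loop n p N]>>%VS.

(* The quotient of Omega by loop_span :&: Omega, identified with a complement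
   of this subspace in Omega: see Omega_df_add and Omega_df_cap. *)
Definition Omega_df : {vspace Span} :=
  <<[seq wedge (fvec g) | g in [predC @ahas_loop n p N]]>>%VS.

Definition kill_loops : 'End(Span) := lin_ext (fun g : aforest n p N =>
  if ahas_loop g then 0 else fvec g).

End Wedge.

Section Operators.
Variable N : nat.

Definition dH : 'Hom(fspan R 1 0 N, fspan R 0 0 N) :=
  lin_ext (fun g : aforest 1 0 N =>
    \sum_(u : 'I_N) fvec (cls (add_edge (repr g) u))).

Definition Psi : {vspace fspan R 1 0 N} := (lker dH :&: Omega 1 0 N)%VS.

Definition Iop : 'End(fspan R 0 1 N) := lin_ext (fun g : aforest 0 1 N =>
  let x := repr g in let c := cov x ord0 in
  ((-1) ^+ #|preds x c| : R) *:
    \sum_(h : {ffun {v | v \in preds x c} -> {w | w != c}})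
       fvec (cls (redirect h))).

Definition calI1 : {vspace fspan R 0 1 N} := (Iop @: Omega 0 1 N)%VS.

(* By dH_loop_span, dH induces a map between the quotients; in terms of the
   representatives in Omega_df, it is kill_loops \o dH. *)
Definition Psi_df : {vspace fspan R 1 0 N} :=
  (lker (@kill_loops 0 0 N \o dH)%VF :&: Omega_df 1 0 N)%VS.

Definition calI1_df : {vspace fspan R 0 1 N} :=
  ((@kill_loops 0 1 N \o Iop)%VF @: Omega_df 0 1 N)%VS.

End Operators.

Section DivergenceFree.
Variables n p N : nat.
Local Notation Span := (fspan R n p N).
Local Notation kill := (kill_loops n p N).
Local Notation w := (wedge n p N).

Lemma wedge_fvec (g : aforest n p N) : w (fvec g) =
  (p`!%:R^-1 * n`!%:R^-1 : R) *:
    \sum_(t : 'S_p) \sum_(s : 'S_n) ((-1) ^+ t * (-1) ^+ s : R) *: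
      fvec (cls (perm_rt s (perm_cov t (repr g)))).
Proof.
rewrite /wedge comp_lfunE lin_ext_fvec linearZ /= linear_sum -scalerA /=.
congr (_ *: _); rewrite scaler_sumr; apply: eq_bigr => t _.
rewrite linearZ /= lin_ext_fvec !scalerA mulrC -scalerA; congr (_ *: _).
rewrite scaler_sumr; apply: eq_bigr => s _; rewrite scalerA.
by congr (_ *: fvec _); apply/pi_iso/perm_rt_iso/pi_iso; rewrite reprK.
Qed.

Lemma wedge_kill a : w (kill a) = kill (w a).
Proof.
rewrite [a]fvec_sum !linear_sum /=; apply: eq_bigr => g _.
rewrite !linearZ /= lin_ext_fvec; congr (_ *: _).
have kE s t : kill (fvec (cls (perm_rt s (perm_cov t (repr g))))) =
    if ahas_loop g then 0 else fvec (cls (perm_rt s (perm_cov t (repr g)))).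
  by rewrite lin_ext_fvec ahas_loop_pi.
rewrite wedge_fvec linearZ /= linear_sum /=.
under [in RHS]eq_bigr => t _ do
  (rewrite linear_sum /=; under eq_bigr => s _ do rewrite linearZ /= kE).
case: (ahas_loop g); last exact: wedge_fvec.
rewrite linear0 big1 ?scaler0 // => t _.
by rewrite big1 // => s _; rewrite scaler0.
Qed.

Lemma lker_kill : lker kill = loop_span n p N.
Proof.
apply/vspaceP => a; apply/idP/idP.
  move=> /[!memv_ker] /eqP ka0; rewrite [a]fvec_sum; apply: rpred_sum => g _.
  have [gl|gl] := boolP (ahas_loop g).
    apply/rpredZ/memv_span/imageP; exists g => //.
  suff ag0 : (a g : R) = 0 by rewrite ag0 scale0r mem0v.
  move/ffunP/(_ g): ka0; rewrite lin_extE sum_ffunE (bigD1 g) //=.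
  rewrite (negPf gl) !ffunE eqxx big1.
    by rewrite addr0 /GRing.scale /= mulr1.
  move=> h hg; case: ifP => _; first by rewrite scaler0 ffunE.
  by rewrite !ffunE eq_sym (negPf hg) scaler0.
apply/subvP; apply/span_subvP => _ /imageP[g gl ->].
by rewrite memv_ker lin_ext_fvec (gl : ahas_loop g) eqxx.
Qed.

Lemma Omega_dfE : Omega_df n p N = (kill @: Omega n p N)%VS.
Proof.
apply/eqP; rewrite eqEsubv; apply/andP; split.
  apply/span_subvP => _ /imageP[g gl ->].
  have -> : fvec g = kill (fvec g).
    by rewrite lin_ext_fvec (negPf (gl : ~~ ahas_loop g)).
  by rewrite wedge_kill; apply/memv_img/memv_img/memvf.
apply/subvP => _ /memv_imgP[_ /memv_imgP[a _ ->] ->].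
rewrite -wedge_kill lin_extE linear_sum /=; apply: rpred_sum => g _.
rewrite linearZ; apply: rpredZ; case: ifP => gl; first by rewrite linear0 mem0v.
by apply/memv_span/imageP; exists g; rewrite // [_ \in _]negbT.
Qed.

Lemma killK a : kill (kill a) = kill a.
Proof.
rewrite [a]fvec_sum !linear_sum /=; apply: eq_bigr => g _.
rewrite !linearZ /= lin_ext_fvec; congr (_ *: _).
by case: ifP => gl; rewrite ?linear0 // lin_ext_fvec gl.
Qed.

Lemma Omega_df_sub : (Omega_df n p N <= Omega n p N)%VS.
Proof. by apply/span_subvP => _ /imageP[g _ ->]; apply/memv_img/memvf. Qed.

Lemma Omega_df_add :
  (Omega_df n p N + (loop_span n p N :&: Omega n p N))%VS = Omega n p N.
Proof.
apply/eqP; rewrite eqEsubv subv_add Omega_df_sub capvSr /=.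
apply/subvP => a aO.
have kaO : kill a \in Omega_df n p N by rewrite Omega_dfE memv_img.
rewrite -[a](subrKC (kill a)); apply: memv_add => //.
rewrite memv_cap; apply/andP; split.
  by rewrite -lker_kill memv_ker linearB /= killK subrr.
exact: rpredB aO (subvP Omega_df_sub _ kaO).
Qed.

Lemma Omega_df_cap : (Omega_df n p N :&: loop_span n p N)%VS = 0%VS.
Proof.
apply/eqP; rewrite -subv0; apply/subvP => a /memv_capP[].
rewrite Omega_dfE -lker_kill => /memv_imgP[b _ ->].
by rewrite memv_ker killK memv0.
Qed.

End DivergenceFree.

Lemma dH_loop_span N : (dH N @: loop_span 1 0 N <= loop_span 0 0 N)%VS.
Proof.
rewrite limg_span; apply/span_subvP => _ /mapP[_ /imageP[g gl ->] ->].
rewrite lin_ext_fvec; apply: rpred_sum => u _; apply/memv_span/imageP.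
eexists; last reflexivity; rewrite [_ \in _]ahas_loop_pi.
case/existsP: (gl : ahas_loop g) => v /eqP gv; apply/existsP; exists v.
rewrite ffunE; case: (v =P rt (repr g) ord0) => [vr|_]; last exact/eqP.
have := mem_rt (repr g) v; rewrite gv => /negbT/codomP[].
by exists ord0.
Qed.

End Forms.

(* Series in u and z are elements of int[[u]][[z]]: the coefficient of
   u^k z^N in f is fcoef (fcoef f N) k. Quotients of series are taken in the
   fraction field of this integral domain, t(z) not being invertible in it.
   Node sets are nonempty, so that sums start at N = 1. *)
Notation uz_series := (fps (fps int)).
Notation "x %:F" := (tofrac x) : ring_scope.

Section GeneratingFunctions.
Variable R : realType.

Definition num_trees (N : nat) : nat :=
  #|[set g : aforest 1 0 N | is_tree (repr g)]|.

Definition uX : uz_series :=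
  Fps (fun N => if N is 0 then Fps (fun k => (k == 1)%:R) else 0).
Definition zX : uz_series := Fps (fun N => (N == 1)%:R).

Definition gf_z (c : nat -> nat) : uz_series :=
  Fps (fun N => if N is 0 then 0 else (c N)%:R).
Definition gf_uz (c : nat -> nat -> nat) : uz_series :=
  Fps (fun N => if N is 0 then 0 else Fps (fun k => (c k N)%:R)).

Definition t_gf := gf_z num_trees.
Definition a_gf := 1 + gf_z (fun N => \dim (Omega R 0 0 N)).
Definition aring_gf := gf_z (fun N => \dim (loop_span R 0 0 N)).
Definition b0_gf := 1 + gf_uz (fun k N => \dim (Omega R k 0 N)).
Definition c1_gf := gf_z (fun N => \dim (calI1 R N)).
Definition s_gf := gf_z (fun N => \dim (Psi R N)).

Definition b0_df_gf := 1 + gf_uz (fun k N => \dim (Omega_df R k 0 N)).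
Definition b1_df_gf := gf_uz (fun k N => \dim (Omega_df R k 1 N)).
Definition c1_df_gf := gf_z (fun N => \dim (calI1_df R N)).
Definition s_df_gf := gf_z (fun N => \dim (Psi_df R N)).

End GeneratingFunctions.

(* Main.v *)
(** Dimensions of spaces of antisymmetrized forests are ranks of idempotents,
    hence traces, and become signed counts of pairs (labelled forest,
    automorphism). These counts multiply when one splits off the component of a
    marked loop, a rooted tree. Writing T' for the series of trees with a marked
    node, (1 - t) T' = t, this yields:
    - redirecting all loops to a marked isolated one turns forests into loop-free
      forests with one marked loop, so z b0 = t b0~;
    - cutting the edge that leaves the covertex c, according to whether its
      target leads to c, gives (1 - t) b1~ = z b0 (u + T');
    - I retracts onto the forests whose covertex has no predecessor, so c1 and
      c1~ are z times the series of forests with a covertex;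
    - the image of d_H is a complement of the span of the loop-free forests, so
      its rank is the number of forests with a loop, and s = a t - aring.
    For s~ it remains to compute the rank of d_H followed by erasing loops. On
    labelled forests let J add only the edges that leave the root outside the
    components with a loop. Then im(J^T) + <K> has the same image under d_H as
    the whole space, injectively, where K consists of the forests whose root is
    isolated and whose other nodes all lead to loops; there are T_N of them up
    to isomorphism. This compares dimensions: the image of J has the reduced
    maps as a complementary basis, and these are counted by a polynomial identity
    evaluated where a sign-reversing involution applies. The rank of J itself is
    the convolution of the wanted ranks with the numbers of forests all of whose
    nodes lead to loops, because J only acts on the components without loops. *)
Require Import Defs.
From mathcomp Require Import all_boot all_order all_algebra all_fingroup.
From mathcomp Require Import generic_quotient fraction.
From mathcomp Require Import zify ring boolp reals.
Set Implicit Arguments. Unset Strict Implicit. Unset Printing Implicit Defensive.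
Import Order.TTheory GRing.Theory Num.Theory.
Local Open Scope ring_scope.

(** Labelled nodes offer two tools. Choosing the node set of a component costs a binomial
    coefficient, which exponential series absorb. And single forests are orthonormal for a real
    inner product in which cutting an edge is the transpose of adding one, so that J J^T b = 0
    forces J^T b = 0. Making each root a loop turns a forest with one root into a total map with a
    marked fixed point. The map J enters because d_H is triangular for the number of nodes that lead
    to a loop, and J is its diagonal part: an added edge either keeps the root away from loops, or
    makes that number grow. J does not reach the top level, where all nodes lead to loops; K is
    mapped into exactly that level. The dimensions match thanks to one exceptional case. If B is the
    set of nodes that do not lead to a loop, a reduced map has |B| - 2 choices at each node of B,
    except that for |B| = 1 there are 0 choices instead of (-1)^1. This discrepancy counts K. It is
    also the origin of the summand z in s~: K contributes the series t to the rank of d_H, and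
    passing to loop-free forms multiplies by z / t. *)

Lemma sum_bij (A : nmodType) (X Y : finType) (P : pred X) (Q : pred Y)
    (F : X -> Y) (G : Y -> X) (f : X -> A) (g : Y -> A) :
    (forall x, P x -> [/\ Q (F x), G (F x) = x & f x = g (F x)]) ->
    (forall y, Q y -> P (G y) /\ F (G y) = y) ->
  \sum_(x | P x) f x = \sum_(y | Q y) g y.
Proof.
move=> FP GP; rewrite (reindex_onto G F) => [|x /FP[]//].
apply: eq_big => [y|y /andP[/FP[_ _ ->] /eqP -> //]].
apply/andP/idP => [[/FP[+ _ _] /eqP]|/GP[-> ->]//]; by move=> /[swap] ->.
Qed.

(** * Weighted counts of partial maps *)

Section Reach.
Variable V : finType.
Implicit Types (e : {ffun V -> option V}) (v w u : V).

Definition rch e v w := exists n, iter n (obind e) (Some v) = Some w.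

Lemma iter_obind_None e n : iter n (obind e) None = None.
Proof. by elim: n => //= n ->. Qed.

Lemma rch_refl e v : rch e v v. Proof. by exists 0%N. Qed.
Lemma rch_trans e u v w : rch e u v -> rch e v w -> rch e u w.
Proof. by move=> [m mE] [n nE]; exists (n + m)%N; rewrite iterD mE. Qed.
Lemma rch_step e v u : e v = Some u -> rch e v u. Proof. by exists 1%N. Qed.
Lemma rch_inv e v w : rch e v w -> v = w \/ exists2 u, e v = Some u & rch e u w.
Proof.
move=> [[|n]]; first by case=> ->; left.
rewrite iterSr /=; case E: (e v) => [u|] /= H; first by right; exists u; last exists n.
by rewrite iter_obind_None in H.
Qed.
Lemma rch_root e v w : e v = None -> rch e v w -> v = w.
Proof. by move=> ev /rch_inv[//|[u]]; rewrite ev. Qed.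
Lemma rch_loop e v w : e v = Some v -> rch e v w -> v = w.
Proof.
by move=> ev [n]; elim: n => [[]//|n IH]; rewrite iterSr /= ev.
Qed.
Lemma rch_ind e w (P : V -> Prop) : P w ->
    (forall v u, e v = Some u -> rch e u w -> P u -> P v) ->
  forall v, rch e v w -> P v.
Proof.
move=> Pw Ps v [n]; elim: n v => [v [->]//|n IH v].
rewrite iterSr /=; case E: (e v) => [u|] /=.
  by move=> H; apply: Ps E _ (IH _ H); exists n.
by rewrite iter_obind_None.
Qed.
Lemma rch_next e v w u : rch e v w -> v <> w -> e v = Some u -> rch e u w.
Proof. by move=> /rch_inv[//|[u' -> uw] _ [<-]]. Qed.
Lemma rch_total e v w w' : rch e v w -> rch e v w' -> rch e w w' \/ rch e w' w.
Proof.
move=> [m mE] [n nE]; case: (leqP m n) => [mn|/ltnW nm]; [left|right].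
  by exists (n - m)%N; rewrite -mE -iterD subnK.
by exists (m - n)%N; rewrite -nE -iterD subnK.
Qed.

Lemma rch_connect e v w : reflect (rch e v w) (connect (fun a b => e a == Some b) v w).
Proof.
apply: (iffP connectP) => [[p]|].
  elim: p v => [v _ -> /=|u p IH v /= /andP[/eqP vu] pp wE]; first exact: rch_refl.
  exact: rch_trans (rch_step vu) (IH _ pp wE).
move: v; apply: rch_ind => [|v u vu uw [p pp wE]]; first by exists [::].
by exists (u :: p); rewrite //= vu eqxx.
Qed.

(** A path to [w] uses only edges leaving nodes that reach [w] and differ from [w]; any other edge,
    that of [w] included, may be changed. The edge surgeries below rest on this. *)
Lemma rch_eq e e' v w : (forall u, rch e u w -> u <> w -> e' u = e u) ->
  rch e v w -> rch e' v w.
Proof.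
move=> ee' vw; move: (vw).
elim/rch_ind: vw => [_|x u xu uw IH xw]; first exact: rch_refl.
have [->|/eqP xw'] := eqVneq x w; first exact: rch_refl.
by apply: (rch_trans _ (IH uw)); apply: rch_step; rewrite ee'.
Qed.

End Reach.

Section Weights.
Variables (k q : nat).

(* A partial map with [k] numbered points and a tuple of marks; the covertices
   of a forest are such marks, and so are the auxiliary roots of subtrees. *)
Definition stru (V : finType) : finType :=
  ({ffun V -> option V} * {ffun 'I_k -> V} * q.-tuple V)%type.

Variable V : finType.
Implicit Types (x : stru V) (s : 'S_k) (t : {perm V}).

(** [t] permutes the nodes and [s] records its effect on the root numbers, which carry the sign.
    Marks are fixed one by one: a single covertex brings no sign. *)
Definition auto x s t :=
  [&& [forall v, x.1.1 (t v) == omap t (x.1.1 v)],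
      [forall i, x.1.2 (s i) == t (x.1.2 i)] & map t x.2 == x.2].

Lemma autoP x s t :
  reflect [/\ forall v, x.1.1 (t v) = omap t (x.1.1 v),
              forall i, x.1.2 (s i) = t (x.1.2 i) & map t x.2 = x.2]
          (auto x s t).
Proof.
apply: (iffP and3P) => [[/forallP A /forallP B /eqP C]|[A B C]].
  by split=> // ?; apply/eqP.
by split; [apply/forallP => ?; apply/eqP..|apply/eqP].
Qed.

(* By orbit counting, [wt P / (k! #|V|!)] is the dimension of the span of the
   antisymmetrized isomorphism classes of [P]. *)
Definition wt (P : pred (stru V)) : rat :=
  \sum_(x | P x) \sum_s \sum_(t | auto x s t) (-1) ^+ s.

Lemma wtE P : wt P =
  \sum_(z : stru V * 'S_k * {perm V} | P z.1.1 && auto z.1.1 z.1.2 z.2) (-1) ^+ z.1.2.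
Proof.
rewrite /wt; under eq_bigr do rewrite pair_big_dep /=.
rewrite pair_big_dep /= (reindex (fun z : stru V * 'S_k * {perm V} => (z.1.1, (z.1.2, z.2)))) //=.
by exists (fun z => (z.1, z.2.1, z.2.2)) => [[[]]|[? []]].
Qed.

Lemma eq_wt P P' : P =1 P' -> wt P = wt P'.
Proof. by move=> PP'; apply: eq_bigl. Qed.

Lemma wt_split (P R : pred (stru V)) :
  wt P = wt (fun x => P x && R x) + wt (fun x => P x && ~~ R x).
Proof. exact: bigID. Qed.

End Weights.

(** Corresponding structures keep the same pairs [(s, t)], hence the same signs. One implication per
    direction is enough because [F] and [G] are mutually inverse. *)
Lemma wt_bij k q q' (V : finType) (P : pred (stru k q V)) (Q : pred (stru k q' V)) F G :
    (forall x, P x -> Q (F x) /\ G (F x) = x) ->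
    (forall y, Q y -> P (G y) /\ F (G y) = y) ->
    (forall x s t, P x -> auto x s t -> auto (F x) s t) ->
    (forall y s t, Q y -> auto y s t -> auto (G y) s t) ->
  wt P = wt Q.
Proof.
move=> FP GP Fa Ga; apply: (@sum_bij _ _ _ _ _ F G) => [x Px|//].
have [QF GF] := FP x Px; split=> //; apply: eq_bigr => s _; apply: eq_bigl => t.
by apply/idP/idP => [/Fa->//|/Ga]; rewrite GF; apply.
Qed.

(** * Disjoint unions of structures *)

Section Glue.
Variables (k q1 q2 : nat) (V V1 V2 : finType).
Variables (b : V1 + V2 -> V) (c : V -> V1 + V2).
Hypotheses (bK : cancel b c) (cK : cancel c b).

Definition glue_out (e1 : {ffun V1 -> option V1}) (e2 : {ffun V2 -> option V2}) :=
  [ffun v => match c v with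
             | inl a => omap (b \o inl) (e1 a) | inr a => omap (b \o inr) (e2 a) end].

(** The left part has no numbered root: it is meant to be a tree whose root has become a loop. The
    sign of an automorphism therefore comes from the right part alone. *)
Definition glue (x1 : stru 0 q1 V1) (x2 : stru k q2 V2) : stru k (q1 + q2) V :=
  (glue_out x1.1.1 x2.1.1, [ffun i => b (inr (x2.1.2 i))],
   cat_tuple (map_tuple (b \o inl) x1.2) (map_tuple (b \o inr) x2.2)).

Let bl_inj : injective (b \o inl).
Proof. by move=> u v /(can_inj bK)[]. Qed.
Let br_inj : injective (b \o inr).
Proof. by move=> u v /(can_inj bK)[]. Qed.

Lemma glue_outl e1 e2 a : glue_out e1 e2 (b (inl a)) = omap (b \o inl) (e1 a).
Proof. by rewrite ffunE bK. Qed.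
Lemma glue_outr e1 e2 a : glue_out e1 e2 (b (inr a)) = omap (b \o inr) (e2 a).
Proof. by rewrite ffunE bK. Qed.

Lemma glue_ind (P : V -> Prop) :
  (forall a, P (b (inl a))) -> (forall a, P (b (inr a))) -> forall v, P v.
Proof. by move=> Pl Pr v; rewrite -[v]cK; case: (c v). Qed.

Lemma glue_iterl e1 e2 n a : iter n (obind (glue_out e1 e2)) (Some (b (inl a)))
  = omap (b \o inl) (iter n (obind e1) (Some a)).
Proof.
by elim: n => //= n ->; case: (iter n _ _) => //= a'; rewrite glue_outl.
Qed.
Lemma glue_iterr e1 e2 n a : iter n (obind (glue_out e1 e2)) (Some (b (inr a)))
  = omap (b \o inr) (iter n (obind e2) (Some a)).
Proof.
by elim: n => //= n ->; case: (iter n _ _) => //= a'; rewrite glue_outr.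
Qed.

Lemma glue_rchl e1 e2 a w : rch (glue_out e1 e2) (b (inl a)) w <->
  exists2 a', w = b (inl a') & rch e1 a a'.
Proof.
split=> [[n]|[a' -> [n H]]]; last by exists n; rewrite glue_iterl H.
by rewrite glue_iterl; case E: (iter n _ _) => [a'|]//= [<-]; exists a'; last exists n.
Qed.
Lemma glue_rchr e1 e2 a w : rch (glue_out e1 e2) (b (inr a)) w <->
  exists2 a', w = b (inr a') & rch e2 a a'.
Proof.
split=> [[n]|[a' -> [n H]]]; last by exists n; rewrite glue_iterr H.
by rewrite glue_iterr; case E: (iter n _ _) => [a'|]//= [<-]; exists a'; last exists n.
Qed.
Lemma glue_rchll e1 e2 a a' : rch (glue_out e1 e2) (b (inl a)) (b (inl a')) <-> rch e1 a a'.
Proof. by rewrite glue_rchl; split=> [[u /(can_inj bK)[->]]|]; last exists a'. Qed.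
Lemma glue_rchrr e1 e2 a a' : rch (glue_out e1 e2) (b (inr a)) (b (inr a')) <-> rch e2 a a'.
Proof. by rewrite glue_rchr; split=> [[u /(can_inj bK)[->]]|]; last exists a'. Qed.
Lemma glue_rchrl e1 e2 a a' : ~ rch (glue_out e1 e2) (b (inr a)) (b (inl a')).
Proof. by rewrite glue_rchr => -[u /(can_inj bK)]. Qed.

Lemma omap_inj (A B : Type) (f : A -> B) : injective f -> injective (omap f).
Proof. by move=> fI [u|] [v|] //= [/fI->]. Qed.

Lemma glue_inj x1 x2 y1 y2 : glue x1 x2 = glue y1 y2 -> x1 = y1 /\ x2 = y2.
Proof.
case: x1 x2 y1 y2 => [[e1 r1] m1] [[e2 r2] m2] [[e1' r1'] m1'] [[e2' r2'] m2'].
move=> /= [/ffunP eE /ffunP rE /eqP]; rewrite eqseq_cat ?size_map ?size_tuple //.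
case/andP=> /eqP/(inj_map bl_inj) m1E /eqP/(inj_map br_inj) m2E.
have -> : m1' = m1 by apply: val_inj.
have -> : m2' = m2 by apply: val_inj.
have -> : r1' = r1 by apply/ffunP => -[].
have -> : r2' = r2.
  by apply/ffunP => i; have := rE i; rewrite !ffunE => /br_inj.
have -> : e1' = e1.
  apply/ffunP => a; have := eE (b (inl a)); rewrite !glue_outl.
  by move/(omap_inj bl_inj).
have -> : e2' = e2.
  apply/ffunP => a; have := eE (b (inr a)); rewrite !glue_outr.
  by move/(omap_inj br_inj).
by [].
Qed.

Fact gperm_subproof (t1 : {perm V1}) (t2 : {perm V2}) :
  injective (fun v => match c v with inl a => b (inl (t1 a)) | inr a => b (inr (t2 a)) end).
Proof.
elim/glue_ind=> a; elim/glue_ind=> a'; rewrite !bK => /(can_inj bK) // -[/perm_inj-> //].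
Qed.
Definition gperm t1 t2 := perm (@gperm_subproof t1 t2).
Lemma gperml t1 t2 a : gperm t1 t2 (b (inl a)) = b (inl (t1 a)).
Proof. by rewrite permE bK. Qed.
Lemma gpermr t1 t2 a : gperm t1 t2 (b (inr a)) = b (inr (t2 a)).
Proof. by rewrite permE bK. Qed.
Lemma gperm_inj t1 t2 u1 u2 : gperm t1 t2 = gperm u1 u2 -> t1 = u1 /\ t2 = u2.
Proof.
move/permP => E; split; apply/permP => a.
  by have := E (b (inl a)); rewrite !gperml => /bl_inj.
by have := E (b (inr a)); rewrite !gpermr => /br_inj.
Qed.

Lemma glue_auto x1 x2 s s' t1 t2 :
  auto (glue x1 x2) s (gperm t1 t2) = auto x1 s' t1 && auto x2 s t2.
Proof.
have mE : map (gperm t1 t2) (glue x1 x2).2 =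
    map (b \o inl) (map t1 x1.2) ++ map (b \o inr) (map t2 x2.2).
  rewrite map_cat -!map_comp; congr (_ ++ _); apply: eq_map => a /=.
    by rewrite gperml.
  by rewrite gpermr.
apply/autoP/andP => [[A B C]|[/autoP[A B C] /autoP[A' B' C']]].
  move/eqP: C; rewrite mE eqseq_cat ?size_map //.
  case/andP=> /eqP/(inj_map bl_inj) C1 /eqP/(inj_map br_inj) C2.
  split; apply/autoP; split=> //.
  - move=> a; apply: (omap_inj bl_inj); have := A (b (inl a)).
    rewrite gperml !glue_outl => ->; case: (x1.1.1 a) => //= w.
    by rewrite gperml.
  - by case.
  - move=> a; apply: (omap_inj br_inj); have := A (b (inr a)).
    rewrite gpermr !glue_outr => ->; case: (x2.1.1 a) => //= w.
    by rewrite gpermr.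
  - move=> i; have := B i; rewrite !ffunE gpermr.
    exact: br_inj.
split.
- elim/glue_ind=> a.
    rewrite gperml !glue_outl A; case: (x1.1.1 a) => //= w; by rewrite gperml.
  rewrite gpermr !glue_outr A'; case: (x2.1.1 a) => //= w; by rewrite gpermr.
- by move=> i; rewrite !ffunE B' gpermr.
- by rewrite mE C C'.
Qed.

Lemma glue_perm_surj (t : {perm V}) :
    (forall a, exists a', t (b (inl a)) = b (inl a')) ->
    (forall a, exists a', t (b (inr a)) = b (inr a')) ->
  exists t1 t2, t = gperm t1 t2.
Proof.
move=> /fin_all_exists[f1 f1E] /fin_all_exists[f2 f2E].
have I1 : injective f1.
  move=> u v uv; have := f1E u; rewrite uv -f1E => /perm_inj; exact: bl_inj.
have I2 : injective f2.
  move=> u v uv; have := f2E u; rewrite uv -f2E => /perm_inj; exact: br_inj.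
exists (perm I1), (perm I2); apply/permP; elim/glue_ind=> a.
  by rewrite gperml permE.
by rewrite gpermr permE.
Qed.

Lemma glue_out_surj (e : {ffun V -> option V}) :
    (forall a, exists o, e (b (inl a)) = omap (b \o inl) o) ->
    (forall a, exists o, e (b (inr a)) = omap (b \o inr) o) ->
  exists e1 e2, e = glue_out e1 e2.
Proof.
move=> /fin_all_exists[f1 f1E] /fin_all_exists[f2 f2E].
exists (finfun f1), (finfun f2); apply/ffunP; elim/glue_ind=> a.
  by rewrite glue_outl ffunE.
by rewrite glue_outr ffunE.
Qed.

Lemma tuple_lift (A B : finType) (f : A -> B) n (m : n.-tuple B) :
  (forall v, v \in m -> exists a, v = f a) -> exists m' : n.-tuple A, m = map_tuple f m'.
Proof.
move=> H; have [g gE] : exists g : 'I_n -> A, forall i, tnth m i = f (g i).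
    apply: (fin_all_exists (P := fun i a => tnth m i = f a)) => i.
  by apply: H; apply: mem_tnth.
exists [tuple g i | i < n]; apply: eq_from_tnth => i.
by rewrite tnth_map tnth_mktuple.
Qed.

Lemma glue_surj (e : {ffun V -> option V}) (r : {ffun 'I_k -> V})
    (m1 : q1.-tuple V) (m2 : q2.-tuple V) :
    (forall a, exists o, e (b (inl a)) = omap (b \o inl) o) ->
    (forall a, exists o, e (b (inr a)) = omap (b \o inr) o) ->
    (forall i, exists a, r i = b (inr a)) ->
    (forall v, v \in m1 -> exists a, v = b (inl a)) ->
    (forall v, v \in m2 -> exists a, v = b (inr a)) ->
  exists x1 x2, (e, r, cat_tuple m1 m2) = glue x1 x2.
Proof.
move=> H1 H2 /fin_all_exists[f fE] /(tuple_lift (f := b \o inl))[n1 n1E].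
move=> /(tuple_lift (f := b \o inr))[n2 n2E].
have [e1 [e2 eE]] := glue_out_surj H1 H2.
exists (e1, finfun (fun i : 'I_0 => match i with Ordinal _ h => match notF h with end end), n1).
exists (e2, finfun f, n2).
rewrite /glue /= -eE n1E n2E; congr (_, _, _).
by apply/ffunP => i; rewrite !ffunE fE.
Qed.

End Glue.

Lemma sum_image (A : nmodType) (X Y : finType) (P : pred X) (Q : pred Y)
    (h : X -> Y) (f : Y -> A) :
    (forall x x', P x -> P x' -> h x = h x' -> x = x') ->
    (forall x, P x -> Q (h x)) ->
    (forall y, Q y -> exists2 x, P x & h x = y) ->
  \sum_(y | Q y) f y = \sum_(x | P x) f (h x).
Proof.
move=> hI PQ QP; rewrite -(big_imset _ (h := h) (A := P)) /=; last first.
  by move=> x x' Px Px'; apply: hI.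
apply: eq_bigl => y; apply/idP/imsetP => [/QP[x Px <-]|[x Px ->]]; last exact: PQ.
by exists x.
Qed.

(** * Invariance of the counts under relabelling *)

Section Transport.
Variables (k q : nat).

Definition smap (V V' : finType) (f : V -> V') (g : V' -> V) (x : stru k q V) : stru k q V' :=
  ([ffun v' => omap f (x.1.1 (g v'))], [ffun i => f (x.1.2 i)], map_tuple f x.2).

(** Invariance under relabelling; the implication is enough, as the inverse bijection gives the
    converse. *)
Definition natural (Q : forall V : finType, pred (stru k q V)) :=
  forall (V V' : finType) (f : V -> V') (g : V' -> V), cancel f g -> cancel g f ->
  forall x, Q V x -> Q V' (smap f g x).

Lemma smapK (V V' : finType) (f : V -> V') (g : V' -> V) : cancel f g -> cancel (smap f g) (smap g f).
Proof.
move=> fK [[e r] m]; rewrite /smap /=; congr (_, _, _).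
- by apply/ffunP => v; rewrite !ffunE fK; case: (e v) => //= w; rewrite fK.
- by apply/ffunP => i; rewrite !ffunE fK.
- by apply: eq_from_tnth => i; rewrite !tnth_map fK.
Qed.

Lemma smap_iter (V V' : finType) (f : V -> V') (g : V' -> V) x n v : cancel f g ->
  iter n (obind (smap f g x).1.1) (Some (f v)) = omap f (iter n (obind x.1.1) (Some v)).
Proof.
by move=> fK; elim: n => //= n ->; case: (iter n _ _) => //= w; rewrite ffunE fK.
Qed.

Lemma smap_rch (V V' : finType) (f : V -> V') (g : V' -> V) x v w : cancel f g ->
  rch (smap f g x).1.1 (f v) (f w) <-> rch x.1.1 v w.
Proof.
move=> fK; split=> -[n]; rewrite /rch => H; exists n; rewrite ?smap_iter ?H //.
move: H; rewrite smap_iter //; case: (iter n _ _) => //= u [/(can_inj fK)->//].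
Qed.

Lemma smap_ed (V V' : finType) (f : V -> V') (g : V' -> V) x v : cancel f g ->
  (smap f g x).1.1 (f v) = omap f (x.1.1 v).
Proof. by move=> fK; rewrite ffunE fK. Qed.

Fact pmap_subproof (V V' : finType) (f : V -> V') (g : V' -> V) (t : {perm V}) :
  cancel f g -> cancel g f -> injective (fun v => f (t (g v))).
Proof. by move=> fK gK u v /(can_inj fK)/perm_inj/(can_inj gK). Qed.

Lemma wt_map (V V' : finType) (f : V -> V') (g : V' -> V) Q : cancel f g -> cancel g f ->
  natural Q -> wt (Q V) = wt (Q V').
Proof.
move=> fK gK Qn; rewrite !wtE.
pose pf t := perm (@pmap_subproof V V' f g t fK gK).
pose pg t := perm (@pmap_subproof V' V g f t gK fK).
have au (U U' : finType) (h : U -> U') (h' : U' -> U) (hK : cancel h h') (h'K : cancel h' h) :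
   forall x s (t : {perm U}), auto x s t ->
     auto (smap h h' x) s (perm (@pmap_subproof U U' h h' t hK h'K)).
  move=> x s t /autoP[A B C]; apply/autoP; split=> [v|i|].
  - by rewrite permE !ffunE hK A; case: (x.1.1 _) => //= w; rewrite permE hK.
  - by rewrite !ffunE permE hK B.
  - rewrite /= -map_comp -[in RHS]C -map_comp; apply: eq_map => v /=.
    by rewrite permE hK.
apply: (@sum_bij _ _ _ _ _ (fun z => (smap f g z.1.1, z.1.2, pf z.2))
                         (fun z => (smap g f z.1.1, z.1.2, pg z.2))).
  move=> [[x s] t] /= /andP[Qx a]; split=> //.
    by rewrite (Qn V V') //= au.
  rewrite smapK //; congr (_, _, _); apply/permP => v.
  by rewrite !permE !fK.
move=> [[x s] t] /= /andP[Qx a]; split; first by rewrite (Qn V' V) //= au.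
rewrite smapK //; congr (_, _, _); apply/permP => v.
by rewrite !permE !gK.
Qed.

Lemma card_bij (V V' : finType) : #|V| = #|V'| ->
  exists (f : V -> V') (g : V' -> V), cancel f g /\ cancel g f.
Proof.
move=> VV; exists (fun v => enum_val (cast_ord VV (enum_rank v))).
exists (fun v => enum_val (cast_ord (esym VV) (enum_rank v))).
by split=> v; rewrite enum_valK ?cast_ordK ?cast_ordKV enum_rankK.
Qed.

Lemma wt_card (V V' : finType) Q : #|V| = #|V'| -> natural Q -> wt (Q V) = wt (Q V').
Proof. by move=> /card_bij[f [g [fK gK]]]; apply: wt_map fK gK. Qed.

End Transport.

Section SubSum.
Variables (V : finType) (A : {set V}).
Definition sum_sub (x : {v | v \in A} + {v | v \notin A}) : V :=
  match x with inl a => val a | inr a => val a end.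
Lemma sum_subK : exists2 c, cancel sum_sub c & cancel c sum_sub.
Proof.
suff [c] : bijective sum_sub by exists c.
apply: inj_card_bij => [[a|a] [a'|a'] /= E|].
- by congr inl; apply: val_inj.
- by have := valP a'; rewrite (_ : val a' = val a) // (valP a).
- by have := valP a'; rewrite (_ : val a' = val a) // (negbTE (valP a)).
- by congr inr; apply: val_inj.
by rewrite card_sum !card_sig -(cardC (mem A)).
Qed.
End SubSum.

(** The root is the first mark and carries a loop. Thus a tree has no numbered root, and inside a
    larger structure it is the set of nodes that lead to the mark. *)
Definition is_rtree q (V : finType) (x : stru 0 q.+1 V) :=
  x.1.1 (thead x.2) = Some (thead x.2) /\ forall v, rch x.1.1 v (thead x.2).

Lemma thead_cat q1 q2 (T : Type) (m1 : q1.+1.-tuple T) (m2 : q2.-tuple T) :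
  thead (cat_tuple m1 m2 : (q1 + q2).+1.-tuple T) = thead m1.
Proof. by case/tupleP: m1 => a m1; rewrite /thead !(tnth_nth a). Qed.

Lemma tuple_catP q1 q2 (T : Type) (m : (q1 + q2).-tuple T) :
  exists (m1 : q1.-tuple T) (m2 : q2.-tuple T), m = cat_tuple m1 m2.
Proof.
have h1 : size (take q1 m) == q1 by rewrite size_takel // size_tuple leq_addr.
have h2 : size (drop q1 m) == q2 by rewrite size_drop size_tuple addKn.
by exists (Tuple h1), (Tuple h2); apply: val_inj; rewrite /= cat_take_drop.
Qed.

Lemma perm0 (s : 'S_0) : s = 1%g. Proof. by apply/permP => -[]. Qed.

Section ProductLemma.
Variables (k q1 q2 : nat).
Variables (T : forall V : finType, pred (stru 0 q1.+1 V)) (Q : forall V : finType, pred (stru k q2 V)).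
Hypothesis T_tree : forall (V : finType) (x : stru 0 q1.+1 V), T x -> is_rtree x.

Section Fixed.
Variables (V : finType) (Z : pred (stru k (q1.+1 + q2) V)).
Hypothesis Z_tree : forall e r m1 m2, Z (e, r, cat_tuple m1 m2) ->
  [/\ e (thead m1) = Some (thead m1), forall i, ~ rch e (r i) (thead m1),
      {in m1, forall v, rch e v (thead m1)} & {in m2, forall v, ~ rch e v (thead m1)}].
Hypothesis Z_glue : forall (V1 V2 : finType) (b : V1 + V2 -> V) c, cancel b c -> cancel c b ->
  forall (x1 : stru 0 q1.+1 V1) (x2 : stru k q2 V2), is_rtree x1 ->
  Z (glue b c x1 x2) = T x1 && Q x2.

(** [A] is the set of nodes leading to the first mark. An automorphism fixes this mark, hence
    preserves [A], and so it is a pair of automorphisms of the two parts. *)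
Lemma wt_product :
  wt Z = \sum_(A : {set V}) wt (@T {v | v \in A}) * wt (@Q {v | v \notin A}).
Proof.
rewrite wtE.
pose br (z : stru k (q1.+1 + q2) V * 'S_k * {perm V}) :=
  [set v | `[< rch z.1.1.1.1 v (thead (z.1.1.2 : (q1 + q2).+1.-tuple V)) >]].
rewrite (partition_big br predT) //=; apply: eq_bigr => A _.
have [c bK cK] := sum_subK A; set b := @sum_sub V A in bK cK.
rewrite !wtE big_distrlr /= pair_big /=.
pose V1 : finType := {v | v \in A}; pose V2 : finType := {v | v \notin A}.
pose h (w : (stru 0 q1.+1 V1 * 'S_0 * {perm V1}) * (stru k q2 V2 * 'S_k * {perm V2})) :=
  (glue b c w.1.1.1 w.2.1.1, w.2.1.2, gperm bK cK w.1.2 w.2.2).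
rewrite (@sum_image _ _ _ (fun w => (T w.1.1.1 && auto w.1.1.1 w.1.1.2 w.1.2)
    && (Q w.2.1.1 && auto w.2.1.1 w.2.1.2 w.2.2)) _ h) /=; first last.
- move=> [[[[e r] m] s] t] /=; rewrite /br /=.
  have [m1 [m2 mE]] := tuple_catP m; rewrite {m}mE.
  rewrite thead_cat => /andP[/andP[Zx a] /eqP AE].
  have rchA v : reflect (rch e v (thead m1)) (v \in A).
    by rewrite -AE inE; apply: asboolP.
  have [eh rh h1 h2] := Z_tree Zx.
  have inA v : v \in A -> exists a, v = b (inl a) by move=> vA; exists (Sub v vA).
  have notA v : v \notin A -> exists a, v = b (inr a) by move=> vA; exists (Sub v vA).
  have bA a' : b (inl a') \in A by exact: valP.
  have bnA a' : b (inr a') \notin A by exact: (valP a').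
  (* No edge crosses the border of [A]: the only edge that could leave it, that of the mark, is a
     loop. *)
  have Astep v u : e v = Some u -> (u \in A) = (v \in A).
    move=> vu; apply/rchA/rchA => [|vr]; first exact/rch_trans/rch_step.
    have [vE|/eqP vE] := eqVneq v (thead m1); last exact: rch_next vr vE vu.
    by move: vu; rewrite vE eh => -[<-]; apply: rch_refl.
  have [|||||x1 [x2 xE]] := @glue_surj k q1.+1 q2 V _ _ b c bK cK e r m1 m2.
  + move=> a'; case E: (e (b (inl a'))) => [u|].
      have /inA[u' ->] : u \in A by rewrite (Astep _ _ E).
      by exists (Some u').
    by exists None.
  + move=> a'; case E: (e (b (inr a'))) => [u|].
      have /notA[u' ->] : u \notin A by rewrite (Astep _ _ E).
      by exists (Some u').
    by exists None.
  + by move=> i; apply: notA; apply/rchA/rh.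
  + by move=> v /h1/rchA/inA.
  + by move=> v /h2/rchA/notA.
  have tA v : (t v \in A) = (v \in A).
    case/autoP: (a) => /= A1 _; rewrite map_cat => /eqP.
    rewrite eqseq_cat ?size_map // => /andP[/eqP m1t _].
    have trho : t (thead m1) = thead m1.
      by move: m1t; case/tupleP: (m1) => a0 m0 /= [].
    have it n w : iter n (obind e) (Some (t w)) = omap t (iter n (obind e) (Some w)).
      by elim: n => //= n ->; case: (iter n _ _) => //= u; rewrite A1.
    apply/rchA/rchA => -[n H]; exists n.
      by move: H; rewrite it; case: (iter n _ _) => //= u [/esym]; rewrite -[in LHS]trho => /perm_inj->.
    by rewrite it H /= trho.
  have [||t1 [t2 tE]] := glue_perm_surj bK cK (t := t).
  + by move=> a'; apply: inA; rewrite tA.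
  + by move=> a'; apply: notA; rewrite tA.
  have x1t : is_rtree x1.
    case: x1 xE => [[e1 r1] n1] [eE _ /eqP].
    rewrite eqseq_cat ?size_map ?size_tuple // => /andP[/eqP m1E _].
    have hE : thead m1 = b (inl (thead n1)).
      by move: m1E; case/tupleP: (m1) => a0 m0; case/tupleP: (n1) => a1 n0 /= [].
    split=> /=.
      move: eh; rewrite eE hE (glue_outl bK).
      by case: (e1 _) => //= u [] /val_inj ->.
    move=> v; have /rchA := bA v; rewrite eE hE; exact: (glue_rchll bK _ _ _ _).1.
  exists ((x1, 1%g, t1), (x2, s, t2)); last by rewrite /h /= -xE -tE.
  move: Zx a; rewrite xE tE (Z_glue bK cK) // (glue_auto bK cK _ _ _ 1%g).
  by case/andP=> -> -> /andP[-> ->].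
- move=> [[[x1 s1] t1] [[x2 s2] t2]] /= /andP[/andP[Tx1 a1] /andP[Qx2 a2]].
  rewrite (Z_glue bK cK) //; last exact: T_tree Tx1.
  rewrite Tx1 Qx2 (glue_auto bK cK _ _ _ s1) a1 a2 /=.
  apply/eqP/setP => v; rewrite inE thead_cat.
  have [xl xr] := T_tree Tx1.
  have hE : thead (map_tuple (b \o inl) x1.2) = b (inl (thead x1.2)).
    by rewrite /thead tnth_map.
  rewrite hE; apply/asboolP/idP; elim/(glue_ind cK): v => a; rewrite /b //=.
  + by move=> _; exact: valP.
  + by move/(glue_rchrl bK).
  + by move=> _; apply/(glue_rchll bK).
  + by rewrite (negbTE (valP a)).
- move=> [[[x1 s1] t1] [[x2 s2] t2]] [[[y1 u1] v1] [[y2 u2] v2]] _ _ E.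
  have [/= -> ->] := glue_inj bK (congr1 (fun w => w.1.1) E).
  have [/= -> ->] := gperm_inj (congr1 snd E).
  by have /= -> := congr1 (fun w => w.1.2) E; rewrite (perm0 s1) (perm0 u1).
apply: eq_bigr => -[[[x1 s1] t1] [[x2 s2] t2]] _ /=.
by rewrite (perm0 s1) odd_perm1 mul1r.
Qed.

End Fixed.
End ProductLemma.

Lemma sum_subsets (A : nmodType) (V : finType) (f : nat -> A) :
  \sum_(S : {set V}) f #|S| = \sum_(i < #|V|.+1) f i *+ 'C(#|V|, i).
Proof.
pose h (S : {set V}) : 'I_#|V|.+1 := inord #|S|.
have hE S : h S = #|S| :> nat by rewrite inordK // ltnS max_card.
rewrite (partition_big h predT) //=; apply: eq_bigr => i _.
rewrite (eq_bigr (fun=> f i)) => [|S /eqP <-]; last by rewrite hE.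
rewrite sumr_const -card_draws; congr (_ *+ _); apply: eq_card => S.
by rewrite inE unfold_in eqE /= hE.
Qed.

Definition sclass k q := forall V : finType, pred (stru k q V).

(** The factor [N!] makes this exponential in the labelled nodes, hence multiplicative; with [k!] it
    is, by orbit counting, the ordinary series of dimensions of antisymmetrized classes. *)
Definition cnt k q (Q : sclass k q) : fps rat :=
  Fps (fun N => wt (Q 'I_N) / (k`! * N`!)%:R).

Lemma fact_rat_neq0 n : n`!%:R != 0 :> rat.
Proof. by rewrite pnatr_eq0 -lt0n fact_gt0. Qed.

Section Count.
Variables (k q1 q2 : nat) (T : sclass 0 q1.+1) (Q : sclass k q2) (Z : sclass k (q1.+1 + q2)).
Hypotheses (T_nat : natural T) (Q_nat : natural Q).
Hypothesis T_tree : forall (V : finType) (x : stru 0 q1.+1 V), T x -> is_rtree x.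
Hypothesis Z_tree : forall V e r m1 m2, @Z V (e, r, cat_tuple m1 m2) ->
  [/\ e (thead m1) = Some (thead m1), forall i, ~ rch e (r i) (thead m1),
      {in m1, forall v, rch e v (thead m1)} & {in m2, forall v, ~ rch e v (thead m1)}].
Hypothesis Z_glue : forall (V V1 V2 : finType) (b : V1 + V2 -> V) c, cancel b c -> cancel c b ->
  forall (x1 : stru 0 q1.+1 V1) (x2 : stru k q2 V2), is_rtree x1 ->
  Z (glue b c x1 x2) = T x1 && Q x2.

(** The number of node sets of size [i] is the binomial coefficient that the two exponential
    normalizations absorb; [k!] belongs to [Q] alone. *)
Lemma cnt_product : cnt Z = cnt T * cnt Q.
Proof.
apply: fpsP => N /=.
rewrite (wt_product T_tree (Z_tree (V := 'I_N)) (Z_glue (V := 'I_N))).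
pose f i := wt (@T 'I_i) * wt (@Q 'I_(N - i)).
rewrite (eq_bigr (fun A : {set 'I_N} => f #|A|)) => [|A _]; last first.
  congr (_ * _); apply: wt_card => //; rewrite card_sig ?card_ord //.
  by have := cardC (mem A); rewrite card_ord; move: #|mem A| #|[predC (mem A)]| => a a2; lia.
rewrite sum_subsets card_ord mulr_suml; apply: eq_bigr => i _.
have iN : (i <= N)%N by rewrite -ltnS.
rewrite /f fact0 mul1n -(bin_fact iN) !natrM !invfM -mulr_natr.
have [] : [/\ 'C(N, i)%:R != 0 :> rat, i`!%:R != 0 :> rat, k`!%:R != 0 :> rat & (N - i)`!%:R != 0 :> rat].
  by rewrite !fact_rat_neq0 pnatr_eq0 -lt0n bin_gt0.
move=> h1 h2 h3 h4.
by field; rewrite h1 h2 h3 h4.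
Qed.
End Count.

(** * Cutting an edge *)

Section Surgery.
Variable V : finType.
Implicit Types (e : {ffun V -> option V}) (v w : V).

Definition set_out e v o : {ffun V -> option V} := [ffun w => if w == v then o else e w].

Lemma set_outE e v o w : set_out e v o w = if w == v then o else e w.
Proof. by rewrite ffunE. Qed.
Lemma set_out_id e v : set_out e v (e v) = e.
Proof. by apply/ffunP => w; rewrite ffunE; case: eqP => // ->. Qed.
Lemma set_out2 e v o o' : set_out (set_out e v o) v o' = set_out e v o'.
Proof. by apply/ffunP => w; rewrite !ffunE; case: eqP. Qed.
Lemma set_out_same e v o : set_out e v o v = o.
Proof. by rewrite ffunE eqxx. Qed.
Lemma set_out_auto e (t : {perm V}) v o : (forall w, e (t w) = omap t (e w)) ->
  t v = v -> omap t o = o -> forall w, set_out e v o (t w) = omap t (set_out e v o w).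
Proof. by move=> et tv to w; rewrite !ffunE -{1}tv (inj_eq perm_inj); case: eqP. Qed.
End Surgery.

Section Cut.
Variables (k q : nat) (V : finType).

(** The marked node becomes a loop and its former target is recorded as the second mark. The default
    [c] is junk, met only when the marked node is a root. *)
Definition cut (x : stru k q.+1 V) : stru k q.+2 V :=
  let c := thead x.2 in
  (set_out x.1.1 c (Some c), x.1.2, [tuple of c :: odflt c (x.1.1 c) :: behead x.2]).

Definition uncut (y : stru k q.+2 V) : stru k q.+1 V :=
  let c := thead y.2 in
  (set_out y.1.1 c (Some (nth c y.2 1)), y.1.2, [tuple of c :: behead (behead y.2)]).

Lemma auto_cons (q' : nat) e r (m : q'.+1.-tuple V) (s : 'S_k) (t : {perm V}) :
  auto (k := k) (e, r, m) s t -> t (thead m) = thead m.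
Proof. by case/autoP => _ _ /=; case/tupleP: m => a m /= []. Qed.

(** An automorphism fixes the mark, hence the target of its edge as well: recording this target as a
    mark loses no automorphism. *)
Lemma wt_cut (P : pred (stru k q.+1 V)) :
  wt (fun x : stru k q.+1 V => P x && (x.1.1 (thead x.2) != None)) =
  wt (fun y : stru k q.+2 V => (y.1.1 (thead y.2) == Some (thead y.2)) && P (uncut y)).
Proof.
have ucK (x : stru k q.+1 V) : x.1.1 (thead x.2) != None -> uncut (cut x) = x.
  case: x => [[e r] m] /=; case/tupleP: m => c m; rewrite /cut /uncut /=.
  rewrite theadE; case E: (e c) => [d|] //= _; rewrite set_out2 -E set_out_id.
  by congr (_, _); apply: val_inj.
apply: (@wt_bij _ _ _ _ _ _ cut uncut).
- move=> x /andP[Px ec]; rewrite ucK // Px; split=> //.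
  by rewrite /= theadE set_out_same eqxx.
- move=> y /andP[/eqP ec Px]; rewrite Px /= theadE set_out_same; split=> //.
  case: y ec {Px} => [[e r] m] /=; case/tupleP: m => c m; case/tupleP: m => d m.
  rewrite /cut /uncut /= !theadE /= set_out_same => ec.
  by rewrite set_out2 -ec set_out_id; congr (_, _); apply: val_inj.
- move=> [[e r] m] s t /andP[_ +] a; have tc := auto_cons a; move: a tc.
  case/tupleP: m => c m; rewrite /= theadE => /autoP[/= A1 A2 A3] tc.
  case E: (e c) => [d|] // _; apply/autoP; rewrite /cut /= theadE E /=.
  have td : t d = d by have := A1 c; rewrite tc E => -[].
  case: A3 => _ A3; split=> //; last by rewrite tc td A3.
  by apply: set_out_auto => //=; rewrite tc.
- move=> [[e r] m] s t /andP[_ _] a; have tc := auto_cons a; move: a tc.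
  case/tupleP: m => c m; case/tupleP: m => d m.
  rewrite /= theadE => /autoP[/= A1 A2 A3] tc; apply/autoP; rewrite /uncut /= theadE.
  case: A3 => _ td A3; split=> //; last by rewrite tc A3.
  by apply: set_out_auto => //=; rewrite td.
Qed.

End Cut.

Section RootLoop.
Variables (k : nat) (V : finType).

Definition loop_mark (x : stru k.+1 1 V) (i : 'I_k.+1) : stru k 1 V :=
  let c := thead x.2 in
  (set_out x.1.1 c (Some c), [ffun j => x.1.2 (lift i j)], x.2).

Definition unloop_mark (y : stru k 1 V) (i : 'I_k.+1) : stru k.+1 1 V :=
  let c := thead y.2 in
  (set_out y.1.1 c None, [ffun j => if unlift i j is Some j' then y.1.2 j' else c], y.2).

(* The mark is a root; it may carry any of the [k.+1] root numbers, and an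
   automorphism permutes the other numbers. *)
Lemma wt_root (P : pred (stru k.+1 1 V)) (Q : pred (stru k 1 V)) :
    (forall x, P x -> x.1.1 (thead x.2) = None /\ exists i, x.1.2 i = thead x.2) ->
    (forall x, P x -> injective x.1.2) ->
    (forall (x : stru k.+1 1 V) i, x.1.1 (thead x.2) = None -> x.1.2 i = thead x.2 -> P x = Q (loop_mark x i)) ->
    (forall y, Q y -> y.1.1 (thead y.2) = Some (thead y.2)) ->
  wt P = k.+1%:R * wt Q.
Proof.
move=> P1 P2 PQ Q1.
rewrite !wtE.
pose h (z : 'I_k.+1 * (stru k 1 V * 'S_k * {perm V})) :=
  (unloop_mark z.2.1.1 z.1, lift_perm z.1 z.1 z.2.1.2, z.2.2).
have lK y i : Q y -> loop_mark (unloop_mark y i) i = y.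
  case: y => [[e r] m] /Q1 /= ec; rewrite /loop_mark /unloop_mark /= set_out2.
  rewrite -ec set_out_id; congr (_, _, _).
  by apply/ffunP => j; rewrite !ffunE liftK.
have uK (x : stru k.+1 1 V) i : x.1.1 (thead x.2) = None -> x.1.2 i = thead x.2 ->
    unloop_mark (loop_mark x i) i = x.
  case: x => [[e r] m] /= ec ri; rewrite /loop_mark /unloop_mark /= set_out2.
  rewrite -ec set_out_id; congr (_, _, _).
  apply/ffunP => j; rewrite !ffunE; case: unliftP => [j' ->|-> //]; by rewrite ffunE.
have un y i : (unloop_mark y i).1.1 (thead (unloop_mark y i).2) = None.
  by rewrite /= set_out_same.
have ur y i : (unloop_mark y i).1.2 i = thead (unloop_mark y i).2.
  by rewrite /= ffunE unlift_none.
rewrite (@sum_image _ _ _ (fun z => Q z.2.1.1 && auto z.2.1.1 z.2.1.2 z.2.2) _ h) /=; first last.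
- move=> [[x s] t] /= /andP[Px a]; have [xN [i ri]] := P1 _ Px.
  have := a; case: (x) {a} (Px) xN ri => [[e r] m] /= Pem xN ri a.
  have tc := auto_cons a; case/autoP: (a) => /= A1 A2 A3.
  have rI := P2 _ Pem.
  (* The marked node is fixed by [t], so its root number is fixed by [s], and [s] is the lift of a
     permutation of the other numbers. *)
  have si : s i = i by apply: rI; rewrite /= A2 ri tc.
  have /fin_all_exists[g gE] : forall j, exists j', s (lift i j) = lift i j'.
    move=> j; case: (unliftP i (s (lift i j))) => [j' ->|]; first by exists j'.
    by rewrite -{2}si => /perm_inj/eqP; rewrite eq_sym (negbTE (neq_lift i j)).
  have gI : injective g.
    by move=> j j' gj; apply: (@lift_inj _ i); apply: (@perm_inj _ s); rewrite !gE gj.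
  have sE : s = lift_perm i i (perm gI).
    apply/permP => j; case: (unliftP i j) => [j' ->|->]; last by rewrite lift_perm_id si.
    by rewrite lift_perm_lift permE gE.
  exists (i, (loop_mark (e, r, m) i, perm gI, t)); last by rewrite /h /= uK // -sE.
  rewrite /= -(PQ (e, r, m)) // Pem /=; apply/autoP; split=> //=.
    by apply: set_out_auto => //=; rewrite tc.
  by move=> j; rewrite !ffunE permE -gE A2.
- move=> [i [[y s] t]] /= /andP[Qy a].
  rewrite (PQ _ i) // lK // Qy /=.
  have := a; case: y Qy {a} => [[e r] m] Qy a; have tc := auto_cons a.
  case/autoP: a => A1 A2 A3; apply/autoP; split=> //=.
    by apply: set_out_auto.
  move=> j; rewrite !ffunE; case: (unliftP i j) => [j' ->|->].
    by rewrite lift_perm_lift liftK A2.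
  by rewrite lift_perm_id unlift_none tc.
- move=> [i [[y s] t]] [i' [[y' s'] t']] /= /andP[Qy _] /andP[Qy' _] E.
  have E1 : unloop_mark y i = unloop_mark y' i' := congr1 (fun w => w.1.1) E.
  have ii' : i = i'.
    have: P (unloop_mark y i) by rewrite (PQ _ i) // lK.
    by move/P2; apply; rewrite ur {2}E1 ur E1.
  rewrite -ii' in E1 E *.
  have -> : y = y' by rewrite -(lK y i) // E1 lK.
  have /permP E2 : lift_perm i i s = lift_perm i i s' := congr1 (fun w => w.1.2) E.
  have -> : s = s'.
    apply/permP => j; have := E2 (lift i j); rewrite !lift_perm_lift; exact: lift_inj.
  by have /= -> := congr1 snd E.
(* The parity of [i] enters twice, once as source and once as image, so lifting does not change the
   sign. *)
under eq_bigr do rewrite odd_lift_perm addbb addFb.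
rewrite -(pair_big_dep predT (fun _ (z : stru k 1 V * 'S_k * {perm V}) => Q z.1.1 && auto z.1.1 z.1.2 z.2)
   (fun _ z => (-1) ^+ (z.1.2 : bool))) /=.
by rewrite sumr_const card_ord mulr_natl.
Qed.

End RootLoop.

(** * Classes of forests and their generating functions *)

Section Predicates.
Variables (lf : bool) (k q : nat) (V : finType).

(* Forests with numbered roots, away from the first mark; [lf] forbids loops. *)
Definition off_forest (c : option V) (x : stru k q V) : Prop :=
  [/\ injective x.1.2, forall v, x.1.1 v = None <-> exists i, x.1.2 i = v
    & lf -> forall v, Some v <> c -> x.1.1 v <> Some v].

Definition is_forest := off_forest None.
End Predicates.

Section Naturality.
Variables (V V' : finType) (f : V -> V') (g : V' -> V).
Hypotheses (fK : cancel f g) (gK : cancel g f).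

Lemma smap_edE k q (x : stru k q V) v : (smap f g x).1.1 v = omap f (x.1.1 (g v)).
Proof. by rewrite ffunE. Qed.

Lemma smap_forest lf k q (x : stru k q V) : is_forest lf x -> is_forest lf (smap f g x).
Proof.
case=> rI eN loop; split.
- by move=> i j; rewrite !ffunE => /(can_inj fK)/rI.
- move=> v; rewrite smap_edE; split=> [|[i]].
    case E: (x.1.1 _) => // _; have /eN[i ri] := E; exists i.
    by rewrite ffunE ri gK.
  rewrite ffunE => <-; rewrite fK.
  by have -> : x.1.1 (x.1.2 i) = None by apply/eN; exists i.
- move=> l v _; rewrite smap_edE; have : x.1.1 (g v) <> Some (g v) by exact: loop.
  by case: (x.1.1 _) => //= w H [wE]; apply: H; rewrite -wE fK.
Qed.

Lemma smap_rchE k q (x : stru k q V) v w : rch (smap f g x).1.1 v w <-> rch x.1.1 (g v) (g w).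
Proof. by rewrite -{1}[v]gK -{1}[w]gK; apply: smap_rch. Qed.

Lemma smap_thead k q (x : stru k q.+1 V) : thead (smap f g x).2 = f (thead x.2).
Proof. by rewrite /thead tnth_map. Qed.

Lemma smap_rtree q (x : stru 0 q.+1 V) : is_rtree x -> is_rtree (smap f g x).
Proof.
case=> h1 h2; split; first by rewrite smap_thead smap_ed // h1.
by move=> v; rewrite smap_rchE smap_thead fK.
Qed.
End Naturality.

Section Classes.
Variable lf : bool.

Definition cl_forest k q : sclass k q := fun V x => `[< is_forest lf x >].
Definition cl_tree : sclass 0 1 := fun V x => `[< is_rtree x >].
Definition cl_point : sclass 0 1 := fun V x =>
  `[< x.1.1 (thead x.2) = Some (thead x.2) /\ forall v, v = thead x.2 >].
(* The marked node is the second mark here, the first one in [cl_mark_tree];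
   the other mark is the root, made a loop. *)
Definition cl_tree_mark : sclass 0 2 := fun V x =>
  `[< is_rtree x /\ (lf -> nth (thead x.2) x.2 1 <> thead x.2) >].
Definition cl_mark_tree : sclass 0 2 := fun V x =>
  `[< let r := nth (thead x.2) x.2 1 in x.1.1 r = Some r /\ forall v, rch x.1.1 v r >].
Definition cl_looped : sclass 0 0 := fun V x =>
  `[< forall v, exists2 w, rch x.1.1 v w & x.1.1 w = Some w >].

Lemma cl_forest_nat k q : natural (@cl_forest k q).
Proof. by move=> V V' f g fK gK x /asboolP H; apply/asboolP/smap_forest. Qed.
Lemma cl_tree_nat : natural cl_tree.
Proof. by move=> V V' f g fK gK x /asboolP H; apply/asboolP/smap_rtree. Qed.
Lemma cl_point_nat : natural cl_point.
Proof.
move=> V V' f g fK gK x /asboolP[h1 h2]; apply/asboolP; split.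
  by rewrite smap_thead smap_ed // h1.
by move=> v; rewrite smap_thead -[v]gK (h2 (g v)).
Qed.
Lemma nth1_map (V V' : finType) (f : V -> V') (g : V' -> V) (x : stru 0 2 V) :
  nth (thead (smap f g x).2) (smap f g x).2 1 = f (nth (thead x.2) x.2 1).
Proof. by rewrite (nth_map (thead x.2)) // size_tuple. Qed.
Lemma cl_tree_mark_nat : natural cl_tree_mark.
Proof.
move=> V V' f g fK gK x /asboolP[h1 h2]; apply/asboolP; split.
  exact: smap_rtree.
by move=> /h2 h; rewrite nth1_map smap_thead => /(can_inj fK).
Qed.
Lemma cl_mark_tree_nat : natural cl_mark_tree.
Proof.
move=> V V' f g fK gK x /asboolP[h1 h2]; apply/asboolP; split.
  by rewrite nth1_map smap_ed // h1.
by move=> v; rewrite nth1_map smap_rchE // fK.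
Qed.
Lemma cl_looped_nat : natural cl_looped.
Proof.
move=> V V' f g fK gK x /asboolP H; apply/asboolP => v.
have [w vw ww] := H (g v); exists (f w); first by rewrite smap_rchE // fK.
by rewrite smap_ed // ww.
Qed.

Lemma cl_tree_tree (V : finType) (x : stru 0 1 V) : cl_tree x -> is_rtree x.
Proof. by move/asboolP. Qed.
Lemma cl_point_tree (V : finType) (x : stru 0 1 V) : cl_point x -> is_rtree x.
Proof. by move=> /asboolP[h1 h2]; split=> // v; rewrite (h2 v); apply: rch_refl. Qed.
Lemma cl_tree_mark_tree (V : finType) (x : stru 0 2 V) : cl_tree_mark x -> is_rtree x.
Proof. by move=> /asboolP[]. Qed.

(** The mark is a loop by convention, standing for a root or for a node whose edge was cut; this is
    why [off_forest] exempts it when [lf] forbids loops. *)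
Definition cl_loop k : sclass k 1 := fun V x => let c := thead x.2 in
  `[< x.1.1 c = Some c /\ off_forest lf (Some c) x >].
Definition cl_lone_loop k : sclass k 1 := fun V x => let c := thead x.2 in
  `[< [/\ x.1.1 c = Some c, off_forest lf (Some c) x
        & forall v, v <> c -> x.1.1 v <> Some c] >].
Definition cl_lone_looped : sclass 0 1 := fun V x => let c := thead x.2 in
  `[< [/\ x.1.1 c = Some c, forall v, v <> c -> x.1.1 v <> Some c
        & forall v, exists2 w, rch x.1.1 v w & x.1.1 w = Some w] >].
(* Second mark: the former target of the first one. *)
Definition cl_cut_off k : sclass k 2 := fun V x => let c := thead x.2 in let d := nth c x.2 1 in
  `[< [/\ x.1.1 c = Some c, off_forest lf (Some c) x & ~ rch x.1.1 d c] >].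
Definition cl_cut_on k : sclass k 2 := fun V x => let c := thead x.2 in let d := nth c x.2 1 in
  `[< [/\ x.1.1 c = Some c, off_forest lf (Some c) x, rch x.1.1 d c & lf -> d <> c] >].
Definition cl_cut_bare : sclass 0 2 := fun V x => let c := thead x.2 in let d := nth c x.2 1 in
  `[< [/\ x.1.1 c = Some c, off_forest lf (Some c) x, d <> c
        & forall v, v <> c -> x.1.1 v <> Some c] >].
Definition cl_cut_tree : sclass 0 3 := fun V x =>
  let c := thead x.2 in let d := nth c x.2 1 in let r := nth c x.2 2 in
  `[< [/\ x.1.1 c = Some c, x.1.1 r = Some r, r <> c, rch x.1.1 d r
        & forall v, rch x.1.1 v c \/ rch x.1.1 v r] >].

Section GlueOff.
Variables (k q1 q2 : nat) (V V1 V2 : finType) (b : V1 + V2 -> V) (c : V -> V1 + V2).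
Hypotheses (bK : cancel b c) (cK : cancel c b).
Variables (x1 : stru 0 q1.+1 V1) (x2 : stru k q2 V2).
Hypothesis x1_tree : is_rtree x1.
Let x : stru k (q1.+1 + q2) V := glue b c x1 x2.

Lemma rtree_out a : x1.1.1 a <> None.
Proof.
have [h1 h2] := x1_tree; move=> aN; have := rch_root aN (h2 a) => aE.
by move: aN; rewrite aE h1.
Qed.

Lemma glue_thead : thead (x.2 : (q1 + q2).+1.-tuple V) = b (inl (thead x1.2)).
Proof. by rewrite /= thead_cat /thead tnth_map. Qed.

Lemma glue_loop : x.1.1 (b (inl (thead x1.2))) = Some (b (inl (thead x1.2))).
Proof. by rewrite /= (glue_outl bK) (x1_tree.1). Qed.

(** All nodes of the left part lead to the marked loop, so it contains no root and no other loop: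
    only the right part is constrained. *)
Lemma glue_off : off_forest lf (Some (b (inl (thead x1.2)))) x <-> is_forest lf x2.
Proof.
have [h1 h2] := x1_tree; split=> -[rI eN loop]; split.
- by move=> i j rij; apply: rI; rewrite !ffunE rij.
- move=> v; have := eN (b (inr v)); rewrite /= (glue_outr bK).
  case: (x2.1.1 v) => [u|] /= E; split=> //.
    by move=> [i ri]; suff: Some (b (inr u)) = None by []; apply/E; exists i; rewrite ffunE ri.
  move=> _; have [i] := E.1 erefl; rewrite ffunE => /(can_inj bK)[ri].
  by exists i.
- move=> /loop H v _ vE; apply: (H (b (inr v))); first by case=> /(can_inj bK).
  by rewrite /= (glue_outr bK) vE.
- by move=> i j; rewrite !ffunE => /(can_inj bK)[/rI].
- apply: (glue_ind cK) => a; rewrite /= ?(glue_outl bK) ?(glue_outr bK).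
    case E: (x1.1.1 a) => [u|]; last by case: (@rtree_out a).
    by split=> // -[i]; rewrite ffunE => /(can_inj bK).
  have := eN a; case: (x2.1.1 a) => [u|] [E1 E2]; split=> //.
  + by move=> [i]; rewrite ffunE => /(can_inj bK)[ri]; have : Some u = None by apply: E2; exists i.
  + by move=> _; have [i ri] := E1 erefl; exists i; rewrite ffunE ri.
- move=> /loop H; apply: (glue_ind cK) => a; rewrite /= ?(glue_outl bK) ?(glue_outr bK).
    move=> ac aE; have {}aE : x1.1.1 a = Some a.
      by case: (x1.1.1 a) aE => //= u [/(can_inj bK)[->]].
    by apply: ac; rewrite (rch_loop aE (h2 a)).
  move=> _ aE; apply: (H a) => //.
  by case: (x2.1.1 a) aE => //= u [/(can_inj bK)[->]].
Qed.

(** In a tree with a second node, some node other than the root has its edge into the root; edges of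
    the right part never enter the left one. *)
Lemma glue_isolated : (forall v, v <> b (inl (thead x1.2)) -> x.1.1 v <> Some (b (inl (thead x1.2))))
  <-> forall a, a = thead x1.2.
Proof.
have [h1 h2] := x1_tree; split=> H.
  move=> a; have [//|/eqP ac] := eqVneq a (thead x1.2).
  have [u ua uc] : exists2 u, u <> thead x1.2 & x1.1.1 u = Some (thead x1.2).
    move: (h2 a) ac; elim/rch_ind: a / => [//|a u au uc IH ac].
    have [uE|/eqP uE] := eqVneq u (thead x1.2); last exact: IH.
    by exists a; rewrite // au uE.
  case: (H (b (inl u))); first by move/(can_inj bK) => [].
  by rewrite /= (glue_outl bK) uc.
apply: (glue_ind cK) => a; first by rewrite (H a).
move=> _; rewrite /= (glue_outr bK); case: (x2.1.1 a) => //= u [].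
by move/(can_inj bK).
Qed.
End GlueOff.
End Classes.

Lemma off_marks lf k q1 q2 (V : finType) (e : {ffun V -> option V}) (r : {ffun 'I_k -> V})
    (m1 : q1.+1.-tuple V) (m2 : q2.-tuple V) c :
  e (thead m1) = Some (thead m1) ->
  off_forest lf c ((e, r, cat_tuple m1 m2) : stru k (q1.+1 + q2) V) ->
  forall i, ~ rch e (r i) (thead m1).
Proof.
move=> em [_ /= eN _] i; have rN : e (r i) = None by apply/eN; exists i.
by move/(rch_root rN) => E; move: rN; rewrite E em.
Qed.

Lemma in_tuple1 (T : eqType) (m : 1.-tuple T) v : v \in m -> v = thead m.
Proof. by case/tupleP: m => a m; rewrite (tuple0 m) !inE theadE => /eqP. Qed.

Lemma in_tuple2 (T : eqType) (m : 2.-tuple T) v : v \in m -> v = thead m \/ v = nth (thead m) m 1.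
Proof.
case/tupleP: m => a m; case/tupleP: m => d m; rewrite (tuple0 m) !inE theadE.
by case/orP=> /eqP; [left|right].
Qed.

Lemma nth_cat1 (T : Type) q (m1 : 1.-tuple T) (m2 : q.+1.-tuple T) d j :
  nth d (m1 ++ m2) j.+1 = nth d m2 j.
Proof. by case/tupleP: m1 => a m; rewrite (tuple0 m). Qed.

Lemma nth_thead (T : Type) q (m : q.+1.-tuple T) d : nth d m 0 = thead m.
Proof. by case/tupleP: m => a m. Qed.

(** * Factorizations obtained by splitting off a marked loop *)

Section Instances.
Variables (lf : bool).

Lemma cnt_cl_loop k : cnt (@cl_loop lf k) = cnt cl_tree * cnt (@cl_forest lf k 0).
Proof.
apply: (@cnt_product k 0 0 cl_tree (@cl_forest lf k 0) (@cl_loop lf k)).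
- exact: cl_tree_nat.
- exact: cl_forest_nat.
- exact: cl_tree_tree.
- move=> V e r m1 m2 /asboolP; rewrite (thead_cat m1 m2) /= => -[ec xoff]; split=> //.
  + exact: off_marks ec xoff.
  + by move=> v /in_tuple1 ->; apply: rch_refl.
  + by move=> v; rewrite (tuple0 m2).
- move=> V V1 V2 b c bK cK x1 x2 x1t.
  have tE := glue_thead b c x1 x2.
  apply/asboolP/andP; rewrite tE.
    by case=> _ /(glue_off lf bK cK x2 x1t) ?; split; apply/asboolP.
  case=> _ /asboolP x2F; split; first exact: glue_loop.
  exact/(glue_off lf bK cK x2 x1t).
Qed.

Lemma cnt_cl_lone_loop k : cnt (@cl_lone_loop lf k) = cnt cl_point * cnt (@cl_forest lf k 0).
Proof.
apply: (@cnt_product k 0 0 cl_point (@cl_forest lf k 0) (@cl_lone_loop lf k)).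
- exact: cl_point_nat.
- exact: cl_forest_nat.
- exact: cl_point_tree.
- move=> V e r m1 m2 /asboolP; rewrite (thead_cat m1 m2) /= => -[ec xoff _]; split=> //.
  + exact: off_marks ec xoff.
  + by move=> v /in_tuple1 ->; apply: rch_refl.
  + by move=> v; rewrite (tuple0 m2).
- move=> V V1 V2 b c bK cK x1 x2 x1t.
  have tE := glue_thead b c x1 x2.
  apply/asboolP/andP; rewrite tE.
    case=> _ /(glue_off lf bK cK x2 x1t) ? /(glue_isolated bK cK x2 x1t) S.
    by split; apply/asboolP => //; split=> //; apply: x1t.1.
  case=> /asboolP[_ S] /asboolP x2F; split; first exact: glue_loop.
    exact/(glue_off lf bK cK x2 x1t).
  exact/(glue_isolated bK cK x2 x1t).
Qed.

Lemma cnt_cl_cut_off k : cnt (@cl_cut_off lf k) = cnt cl_tree * cnt (@cl_forest lf k 1).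
Proof.
apply: (@cnt_product k 0 1 cl_tree (@cl_forest lf k 1) (@cl_cut_off lf k)).
- exact: cl_tree_nat.
- exact: cl_forest_nat.
- exact: cl_tree_tree.
- move=> V e r m1 m2 /asboolP; rewrite (thead_cat m1 m2) /= => -[ec xoff dc]; split=> //.
  + exact: off_marks ec xoff.
  + by move=> v /in_tuple1 ->; apply: rch_refl.
  + by move=> v /in_tuple1 ->; move: dc; rewrite nth_cat1 nth_thead.
- move=> V V1 V2 b c bK cK x1 x2 x1t.
  have tE := glue_thead b c x1 x2.
  apply/asboolP/andP; rewrite tE.
    by case=> _ /(glue_off lf bK cK x2 x1t) ? _; split; apply/asboolP.
  case=> _ /asboolP x2F; split; first exact: glue_loop.
    exact/(glue_off lf bK cK x2 x1t).
  by rewrite nth_cat1 nth_thead /thead tnth_map; apply: (glue_rchrl bK).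
Qed.

(** The former target lies in the tree and becomes its marked node; it must differ from the root
    when restoring the edge may not create a loop. *)
Lemma cnt_cl_cut_on k : cnt (@cl_cut_on lf k) = cnt (cl_tree_mark lf) * cnt (@cl_forest lf k 0).
Proof.
apply: (@cnt_product k 1 0 (cl_tree_mark lf) (@cl_forest lf k 0) (@cl_cut_on lf k)).
- exact: cl_tree_mark_nat.
- exact: cl_forest_nat.
- exact: cl_tree_mark_tree.
- move=> V e r m1 m2 /asboolP; rewrite (thead_cat m1 m2) /= => -[ec xoff dc _]; split=> //.
  + exact: off_marks ec xoff.
  + move=> v /in_tuple2[->|->]; first exact: rch_refl.
    by move: dc; rewrite (tuple0 m2) cats0.
  + by move=> v; rewrite (tuple0 m2).
- move=> V V1 V2 b c bK cK x1 x2 x1t.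
  have tE := glue_thead b c x1 x2.
  have nE d : nth d (glue b c x1 x2).2 1 = b (inl (nth (thead x1.2) x1.2 1)).
    by rewrite /= (tuple0 x2.2) cats0 (nth_map (thead x1.2)) // size_tuple.
  apply/asboolP/andP; rewrite tE nE.
    case=> _ /(glue_off lf bK cK x2 x1t) ? _ dc.
    split; apply/asboolP => //; split=> // /dc dc'; by move=> E; apply: dc'; rewrite E.
  case=> /asboolP[_ dc] /asboolP x2F; split; first exact: glue_loop.
  + exact/(glue_off lf bK cK x2 x1t).
  + by apply/(glue_rchll bK); apply: x1t.2.
  + by move=> /dc dc' /(can_inj bK)[].
Qed.

Lemma cnt_cl_cut_bare : cnt (cl_cut_bare lf) = cnt cl_point * cnt (@cl_forest lf 0 1).
Proof.
apply: (@cnt_product 0 0 1 cl_point (@cl_forest lf 0 1) (cl_cut_bare lf)).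
- exact: cl_point_nat.
- exact: cl_forest_nat.
- exact: cl_point_tree.
- move=> V e r m1 m2 /asboolP; rewrite (thead_cat m1 m2) /= => -[ec xoff dc iso]; split=> //.
  + exact: off_marks ec xoff.
  + by move=> v /in_tuple1 ->; apply: rch_refl.
  (* Only the first mark itself leads to the isolated loop, so a second mark different from it lies
     outside its component. *)
  + move=> v /in_tuple1 ->; move: dc; rewrite nth_cat1 nth_thead => dc dr.
    suff: thead m2 = thead m1 by [].
    move: dr; elim/rch_ind => // v' u vu uc IH; subst u.
    by have [//|/eqP/iso] := eqVneq v' (thead m1).
- move=> V V1 V2 b c bK cK x1 x2 x1t.
  have tE := glue_thead b c x1 x2.
  apply/asboolP/andP; rewrite tE.
    case=> _ /(glue_off lf bK cK x2 x1t) ? _ /(glue_isolated bK cK x2 x1t) S.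
    by split; apply/asboolP => //; split=> //; apply: x1t.1.
  case=> /asboolP[_ S] /asboolP x2F; split; first exact: glue_loop.
  + exact/(glue_off lf bK cK x2 x1t).
  + by rewrite nth_cat1 nth_thead /thead tnth_map => /(can_inj bK).
  + exact/(glue_isolated bK cK x2 x1t).
Qed.
End Instances.

Lemma cnt_cl_lone_looped : cnt cl_lone_looped = cnt cl_point * cnt cl_looped.
Proof.
apply: (@cnt_product 0 0 0 cl_point cl_looped cl_lone_looped).
- exact: cl_point_nat.
- exact: cl_looped_nat.
- exact: cl_point_tree.
- move=> V e r m1 m2 /asboolP; rewrite (thead_cat m1 m2) /= => -[ec _ _]; split=> //.
  + by case.
  + by move=> v /in_tuple1 ->; apply: rch_refl.
  + by move=> v; rewrite (tuple0 m2).
- move=> V V1 V2 b c bK cK x1 x2 x1t.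
  have tE := glue_thead b c x1 x2.
  apply/asboolP/andP; rewrite tE.
    case=> _ /(glue_isolated bK cK x2 x1t) S H.
    split; apply/asboolP; first by split=> //; apply: x1t.1.
    move=> v; have [w] := H (b (inr v)) => /(glue_rchr bK)[w' -> vw'].
    rewrite (glue_outr bK) => E; exists w' => //.
    by case: (x2.1.1 w') E => //= u [/(can_inj bK)[->]].
  case=> /asboolP[_ S] /asboolP H; split; first exact: glue_loop.
    exact/(glue_isolated bK cK x2 x1t).
  apply: (glue_ind cK) => a.
    exists (b (inl (thead x1.2))); last exact: glue_loop.
    by apply/(glue_rchll bK); apply: x1t.2.
  have [w aw ww] := H a; exists (b (inr w)); first exact/(glue_rchrr bK).
  by rewrite /= (glue_outr bK) ww.
Qed.

Lemma cnt_cl_cut_tree : cnt cl_cut_tree = cnt cl_tree * cnt cl_mark_tree.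
Proof.
apply: (@cnt_product 0 0 2 cl_tree cl_mark_tree cl_cut_tree).
- exact: cl_tree_nat.
- exact: cl_mark_tree_nat.
- exact: cl_tree_tree.
- move=> V e r m1 m2 /asboolP; rewrite (thead_cat m1 m2) /= !nth_cat1 nth_thead.
  move=> [ec er rc dr H]; split=> //.
  + by case.
  + by move=> v /in_tuple1 ->; apply: rch_refl.
  (* A node cannot lead to two distinct loops. *)
  + have disj v : rch e v (thead m1) -> rch e v (nth (thead m1) m2 1) -> False.
      move=> vc vr; case: (rch_total vc vr) => [/(rch_loop ec)/esym//|/(rch_loop er)//].
    rewrite (set_nth_default (thead m2)) ?size_tuple // in er rc dr disj *.
    move=> v /in_tuple2[->|->] vc; apply: (disj _ vc) => //.
    exact: rch_refl.
- move=> V V1 V2 b c bK cK x1 x2 x1t.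
  have tE := glue_thead b c x1 x2.
  have n2E d : nth d (glue b c x1 x2).2 2 = b (inr (nth (thead x2.2) x2.2 1)).
    by rewrite /= nth_cat1 (nth_map (thead x2.2)) // size_tuple.
  have n1E d : nth d (glue b c x1 x2).2 1 = b (inr (thead x2.2)).
    by rewrite /= nth_cat1 nth_thead /thead tnth_map.
  apply/asboolP/andP; rewrite tE n1E n2E.
    case=> _ er _ _ H; split; apply/asboolP => //; split.
      move: er; rewrite /= (glue_outr bK); case: (x2.1.1 _) => //= u [].
      by move/(can_inj bK) => [->].
    move=> v; case: (H (b (inr v))); first by move/(glue_rchrl bK).
    by move/(glue_rchrr bK).
  case=> _ /asboolP[er H]; split.
  + exact: glue_loop.
  + by rewrite /= (glue_outr bK) er.
  + by move/(can_inj bK).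
  + exact/(glue_rchrr bK).
  + apply: (glue_ind cK) => a; [left|right]; first by apply/(glue_rchll bK); apply: x1t.2.
    exact/(glue_rchrr bK).
Qed.

Lemma eq_cnt k q q' (P : sclass k q) (Q : sclass k q') :
  (forall V, wt (@P V) = wt (@Q V)) -> cnt P = cnt Q.
Proof. by move=> PQ; apply: fpsP => N /=; rewrite PQ. Qed.

Lemma cnt_split k q q' q'' (P : sclass k q) (Q : sclass k q') (Q' : sclass k q'') :
  (forall V, wt (@P V) = wt (@Q V) + wt (@Q' V)) -> cnt P = cnt Q + cnt Q'.
Proof. by move=> PQ; apply: fpsP => N /=; rewrite PQ mulrDl. Qed.

Section CutForest.
Variables (lf : bool) (k : nat).

Lemma uncut_forest (V : finType) (y : stru k 2 V) (c := thead y.2) : y.1.1 c = Some c ->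
  is_forest lf (uncut y) <-> off_forest lf (Some c) y /\ (lf -> nth c y.2 1 <> c).
Proof.
move=> yc; rewrite /is_forest /off_forest /= -/c; split=> [[rI eN loop]|[[rI eN loop] dc]].
  split; [split=> //|].
  - move=> v; rewrite -eN set_outE; case: eqP => // ->; by rewrite yc.
  - by move=> l v vc; have := loop l v; rewrite set_outE; case: eqP => [vE|_]; [case: vc; rewrite vE|apply].
  - by move=> l dc; have := loop l c; rewrite set_out_same dc; apply.
split=> //.
- move=> v; rewrite -eN set_outE; case: eqP => // ->; by rewrite yc.
- move=> l v _; rewrite set_outE; case: eqP => [->|vc]; first by case=> /(dc l).
  by apply: loop => // -[].
Qed.

Definition cl_root : sclass k 1 := fun V x =>
  `[< is_forest lf x /\ x.1.1 (thead x.2) = None >].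

(** The three terms: the covertex is a root; the target of its edge lies outside the tree above the
    covertex; the target lies inside it and closes a cycle. *)
Lemma cnt_marked : cnt (@cl_forest lf k 1) =
  cnt cl_root + cnt cl_tree * cnt (@cl_forest lf k 1) + cnt (cl_tree_mark lf) * cnt (@cl_forest lf k 0).
Proof.
rewrite -cnt_cl_cut_off -cnt_cl_cut_on -addrA; apply: fpsP => N /=; rewrite -!mulrDl; congr (_ / _).
rewrite (wt_split _ (fun x : stru k 1 'I_N => x.1.1 (thead x.2) == None)) wt_cut.
congr (_ + _).
  apply: eq_wt => x; apply/andP/asboolP => [[/asboolP xF /eqP xN]|[xF xN]].
    by split.
  by split; [apply/asboolP|apply/eqP].
rewrite (wt_split _ (fun y : stru k 2 'I_N => `[< rch y.1.1 (nth (thead y.2) y.2 1) (thead y.2) >])).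
rewrite addrC; congr (_ + _); apply: eq_wt => y.
  apply/andP/asboolP => [[/andP[/eqP yc /asboolP]]|[yc yo dc]].
    by move=> /(uncut_forest yc)[? _] /asboolP.
  split; last exact/asboolPn.
  apply/andP; split; [exact/eqP|apply/asboolP/(uncut_forest yc); split=> //].
  by move=> _ E; apply: dc; rewrite E; apply: rch_refl.
apply/andP/asboolP => [[/andP[/eqP yc /asboolP]]|[yc yo dc ld]].
  by move=> /(uncut_forest yc)[? ?] /asboolP.
split; last exact/asboolP.
by apply/andP; split; [exact/eqP|apply/asboolP/(uncut_forest yc)].
Qed.
End CutForest.

Lemma cnt_root0 lf : cnt (@cl_root lf 0) = 0.
Proof.
apply: fpsP => N /=; rewrite /wt big_pred0 ?mul0r // => x.
by apply/negP => /asboolP[[_ eN _] /eN[[]]].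
Qed.

Lemma loop_forest lf k (V : finType) (x : stru k.+1 1 V) i :
  x.1.1 (thead x.2) = None -> x.1.2 i = thead x.2 ->
  is_forest lf x <-> off_forest lf (Some (thead x.2)) (loop_mark x i).
Proof.
move=> xN ri; split=> -[rI eN loop]; split.
- by move=> j j'; rewrite !ffunE => /rI/lift_inj.
- move=> v; rewrite set_outE; case: eqP => [->|vc]; split=> //.
  + by case=> j; rewrite ffunE -ri => /rI/eqP; rewrite eq_sym (negbTE (neq_lift i j)).
  + move=> /eN[j]; case: (unliftP i j) => [j' ->|->]; last by rewrite ri => /esym/vc.
    by move=> <-; exists j'; rewrite ffunE.
  + by move=> [j]; rewrite ffunE => <-; apply/eN; exists (lift i j).
- by move=> l v vc; rewrite set_outE; case: eqP => [E|_]; [case: vc; rewrite E|apply: loop].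
- move=> j j'; case: (unliftP i j) => [a ->|->]; case: (unliftP i j') => [a' ->|->] // E.
  + by congr lift; apply: rI; rewrite !ffunE.
  + suff: (loop_mark x i).1.1 (thead x.2) = None by rewrite set_out_same.
    by apply/eN; exists a; rewrite ffunE E.
  + suff: (loop_mark x i).1.1 (thead x.2) = None by rewrite set_out_same.
    by apply/eN; exists a'; rewrite ffunE -E.
- move=> v; have := eN v; rewrite set_outE; case: eqP => [->|vc] E.
    by split=> // _; exists i.
  split=> [/E[j]|[j]]; first by rewrite ffunE => <-; exists (lift i j).
  case: (unliftP i j) => [a ->|->]; last by rewrite ri => /esym/vc.
  by move=> av; apply/E; exists a; rewrite ffunE.
- move=> l v _; have [->|/eqP vc] := eqVneq v (thead x.2); first by rewrite xN.
  have := loop l v; rewrite set_outE; case: eqP => // _; apply; by case.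
Qed.

(** The covertex is a root, which is made a loop. The factor [k.+1] from the choice of its number
    cancels the passage from [(k+1)!] to [k!]. *)
Lemma cnt_rootS lf k : cnt (@cl_root lf k.+1) = cnt (@cl_loop lf k).
Proof.
apply: fpsP => N /=; rewrite (@wt_root _ _ _ (@cl_loop lf k 'I_N)).
- rewrite factS -mulnA natrM invfM mulrACA divff ?mul1r //.
  by rewrite pnatr_eq0.
- by move=> x /asboolP[[_ eN _] xN]; split=> //; apply/eN.
- by move=> x /asboolP[[]].
- move=> x i xN ri; apply/asboolP/asboolP => [[xF _]|[_ /(loop_forest lf xN ri)]] //.
  split; first by rewrite /= set_out_same.
  exact/(loop_forest lf xN ri).
- by move=> y /asboolP[].
Qed.

(* Redirecting every other loop to the marked one turns a forest with an
   isolated marked loop into one without other loops. *)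
Section Redirect.
Variables (k : nat) (V : finType).

Definition gather (x : stru k 1 V) : stru k 1 V := let c := thead x.2 in
  ([ffun v => if (v != c) && (x.1.1 v == Some v) then Some c else x.1.1 v], x.1.2, x.2).
Definition scatter (x : stru k 1 V) : stru k 1 V := let c := thead x.2 in
  ([ffun v => if (v != c) && (x.1.1 v == Some c) then Some v else x.1.1 v], x.1.2, x.2).

Lemma wt_gather (P Q : pred (stru k 1 V)) :
    (forall x, P x -> [/\ x.1.1 (thead x.2) = Some (thead x.2),
       forall v, v <> thead x.2 -> x.1.1 v <> Some (thead x.2) & Q (gather x)]) ->
    (forall x, Q x -> [/\ x.1.1 (thead x.2) = Some (thead x.2),
       forall v, v <> thead x.2 -> x.1.1 v <> Some v & P (scatter x)]) ->
  wt P = wt Q.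
Proof.
move=> PQ QP; apply: (@wt_bij _ _ _ _ _ _ gather scatter).
- move=> x Px; have [xc xi Qx] := PQ _ Px; split=> //.
  case: x xc xi {Px Qx} => [[e r] m] /= ec ei; congr (_, _, _).
  apply/ffunP => v; rewrite !ffunE /=; case: eqP => //= vc.
  case: (e v =P Some v) => [->|_]; first by rewrite eqxx.
  by have /eqP/negbTE -> := ei _ vc.
- move=> x Qx; have [xc xi Px] := QP _ Qx; split=> //.
  case: x xc xi {Px Qx} => [[e r] m] /= ec ei; congr (_, _, _).
  apply/ffunP => v; rewrite !ffunE /=; case: eqP => //= vc.
  case: (e v =P Some (thead m)) => [->|_]; first by rewrite eqxx.
  by have /eqP/negbTE -> := ei _ vc.
- move=> [[e r] m] s t _ a; have tc := auto_cons a; case/autoP: a => /= A1 A2 A3.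
  apply/autoP; split=> //= v; rewrite !ffunE -{1}tc (inj_eq perm_inj) A1.
  by rewrite (_ : Some (t v) = omap t (Some v)) // (inj_eq (omap_inj perm_inj)); case: ifP => //=; rewrite tc.
- move=> [[e r] m] s t _ a; have tc := auto_cons a; case/autoP: a => /= A1 A2 A3.
  apply/autoP; split=> //= v.
  have E : (omap t (e v) == Some (thead m)) = (e v == Some (thead m)).
    by rewrite -{1}tc -[Some (t _)]/(omap t (Some _)) (inj_eq (omap_inj perm_inj)).
  by rewrite !ffunE -{1}tc (inj_eq perm_inj) A1 E; case: ifP.
Qed.
End Redirect.

Lemma cnt_gather k : cnt (@cl_lone_loop false k) = cnt (@cl_loop true k).
Proof.
apply: eq_cnt => V; apply: wt_gather => x /asboolP.
  case=> xc [rI eN _] iso; split=> //; apply/asboolP; split=> /=.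
    by rewrite ffunE eqxx.
  split=> // [v|_ v vc]; rewrite ffunE.
    by rewrite -eN; case: ifP => // /andP[_ /eqP ->].
  case: ifP => [_ [/esym]|/negbT]; first by move=> E; apply: vc; rewrite E.
  by rewrite negb_and negbK => /orP[/eqP E|/eqP//]; case: vc; rewrite E.
case=> xc [rI eN loop]; split=> //.
  by move=> v vc; apply: loop => // -[].
apply/asboolP; split=> /=; first by rewrite ffunE eqxx.
  by split=> // v; rewrite ffunE -eN; case: ifP => // /andP[_ /eqP ->].
move=> v vc; rewrite ffunE; case: ifP => [_ [/vc]|] // /negbT.
by rewrite negb_and negbK => /orP[/eqP/vc|/eqP].
Qed.

(** When every node leads to a loop, redirecting the loops to the isolated one gives a tree rooted
    there. Combined with [cnt_cl_lone_looped] this reads [t = z * looped], which drives all that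
    follows about looped components. *)
Lemma cnt_cl_lone_looped_T : cnt cl_lone_looped = cnt cl_tree.
Proof.
apply: eq_cnt => V; apply: wt_gather => x /asboolP.
  case=> xc iso H; split=> //; apply/asboolP; split=> /=; first by rewrite ffunE eqxx.
  move=> v; have [w vw ww] := H v; have [wc|/eqP wc] := eqVneq w (thead x.2).
    subst w; apply: (rch_eq _ vw) => u uc ucN; rewrite ffunE; case: ifP => // /andP[_ /eqP uu].
    by case: ucN; apply: rch_loop uu uc.
  apply: (@rch_trans _ _ _ w).
    apply: (rch_eq _ vw) => u uw uwN; rewrite ffunE; case: ifP => // /andP[_ /eqP uu].
    by case: uwN; apply: rch_loop uu uw.
  by apply: rch_step; rewrite ffunE ww eqxx andbT; case: eqP.
case=> xc H; split=> //.
  by move=> v vc vv; apply: vc; apply: rch_loop vv (H v).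
apply/asboolP; split=> /=; first by rewrite ffunE eqxx.
  move=> v vc; rewrite ffunE; case: ifP => [_ [/vc]|] // /negbT.
  by rewrite negb_and negbK => /orP[/eqP/vc|/eqP].
move=> v; elim/rch_ind: v / (H v) => [|v u vu uc [w uw ww]].
  by exists (thead x.2); [apply: rch_refl|rewrite ffunE eqxx].
have [vc|/eqP vc] := eqVneq v (thead x.2).
  by exists v; [apply: rch_refl|rewrite ffunE vc eqxx].
have [ucE|/eqP ucN] := eqVneq u (thead x.2).
  exists v; first exact: rch_refl.
  by rewrite ffunE vu ucE eqxx; case: eqP.
exists w => //; apply: rch_trans uw; apply: rch_step.
by rewrite ffunE vu; case: eqP => // _; case: eqP => // -[/ucN].
Qed.

(** Either the marked node is the root, or cutting its edge leaves the tree above it and a tree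
    whose marked node is the former target. *)
Lemma cl_mark_tree_cut : cnt cl_mark_tree = cnt cl_tree + cnt cl_tree * cnt cl_mark_tree.
Proof.
rewrite -cnt_cl_cut_tree; apply: cnt_split => V.
rewrite (wt_split _ (fun x : stru 0 2 V => thead x.2 == nth (thead x.2) x.2 1)).
congr (_ + _).
  apply: (@wt_bij _ _ _ _ _ _ (fun x => (x.1.1, x.1.2, [tuple thead x.2]))
     (fun y => (y.1.1, y.1.2, [tuple thead y.2; thead y.2]))).
  - move=> [[e r] m] /= /andP[]; case/tupleP: m => d m; case/tupleP: m => a m.
    rewrite (tuple0 m) /= !theadE => /asboolP[/= ea H] /eqP da; subst d.
    by split; [apply/asboolP|congr (_, _); apply: val_inj].
  - move=> [[e r] m]; case/tupleP: m => d m; rewrite (tuple0 m) /= !theadE => /asboolP[/= er H].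
    split; last by congr (_, _); apply: val_inj.
    by apply/andP; split=> //=; apply/asboolP.
  - move=> [[e r] m] s t _ a; have tc := auto_cons a; case/autoP: a => A1 A2 _.
    by apply/autoP; split=> //=; rewrite tc.
  - move=> [[e r] m] s t _ a; have tc := auto_cons a; case/autoP: a => A1 A2 _.
    by apply/autoP; split=> //=; rewrite tc.
pose P : pred (stru 0 2 V) := fun x => cl_mark_tree x && (thead x.2 != nth (thead x.2) x.2 1).
rewrite -(@eq_wt _ _ _ (fun x : stru 0 2 V => P x && (x.1.1 (thead x.2) != None))); last first.
  move=> x; rewrite /P /cl_mark_tree; case: asboolP => //= -[er H]; case: eqP => //= xr.
  case E: (x.1.1 _) => //; exfalso; apply: xr.
  exact: rch_root E (H (thead x.2)).
rewrite wt_cut; apply: eq_wt.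
move=> [[e r] m]; case/tupleP: m => c m; case/tupleP: m => d m; case/tupleP: m => a m.
rewrite (tuple0 m) /P /cl_cut_tree /cl_mark_tree /uncut /= !theadE /=.
apply/andP/asboolP => [[/eqP ec /andP[/asboolP[ea H] /eqP ca]]|[ec ea ac da H]].
  have ea' : e a = Some a by move: ea; rewrite set_outE; case: eqP => // /esym/ca.
  set e' := set_out e c (Some d) in ea H.
  have e'E u : u <> c -> e' u = e u by rewrite set_outE; case: eqP.
  have e'c : e' c = Some d by rewrite set_out_same.
  have Hd v : rch e v c \/ rch e v a.
    elim/rch_ind: v / (H v) => [|v u vu ua IH]; first by right; apply: rch_refl.
    have [->|/eqP vc] := eqVneq v c; first by left; apply: rch_refl.
    have vu' := rch_step (etrans (esym (e'E _ vc)) vu).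
    by case: IH => IH; [left|right]; apply: rch_trans vu' IH.
  split=> //; first by move=> E; apply: ca.
  (* If [d] led to [c], restoring the edge from [c] to [d] would close a cycle: no node leading to
     [a] could lead to [c], although [c] leads to [a]. *)
  case: (Hd d) => // dc; exfalso.
  have dc' : rch e' d c by apply: rch_eq dc => u _; apply: e'E.
  suff: forall v, rch e' v a -> ~ rch e' v c by move=> /(_ c (H c)); apply; apply: rch_refl.
  apply: rch_ind => [/(rch_loop ea) E|v u vu ua IH vc]; first by apply: ca.
  apply: IH; have [vE|/eqP vE] := eqVneq v c; last exact: rch_next vc vE vu.
  by move: vu; rewrite vE e'c => -[<-].
set e' := set_out e c (Some d).
have e'E u : u <> c -> e' u = e u by rewrite set_outE; case: eqP.
split; first exact/eqP.
apply/andP; split; last by apply/eqP => /esym.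
apply/asboolP; split; first by rewrite e'E.
have da' : rch e' d a.
  apply: rch_eq da => u ua uN; apply: e'E => uc; apply: uN; rewrite uc.
  by apply: rch_loop ec _; rewrite -uc.
move=> v; case: (H v) => [vc|va].
  apply: (@rch_trans _ _ _ c); first by apply: rch_eq vc => u _; apply: e'E.
  by apply: rch_trans da'; apply: rch_step; rewrite set_out_same.
apply: rch_eq va => u ua uN; apply: e'E => uc; apply: uN; rewrite uc.
by apply: rch_loop ec _; rewrite -uc.
Qed.

Lemma cnt_cl_tree_mark0 : cnt (cl_tree_mark false) = cnt cl_mark_tree.
Proof.
apply: eq_cnt => V; apply: (@wt_bij _ _ _ _ _ _
  (fun x => (x.1.1, x.1.2, [tuple nth (thead x.2) x.2 1; thead x.2]))
  (fun x => (x.1.1, x.1.2, [tuple nth (thead x.2) x.2 1; thead x.2]))).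
- move=> [[e r] m] /=; case/tupleP: m => d m; case/tupleP: m => a m.
  rewrite (tuple0 m) /= !theadE => /asboolP[[/= ea H] _].
  by split; [apply/asboolP|congr (_, _); apply: val_inj].
- move=> [[e r] m] /=; case/tupleP: m => d m; case/tupleP: m => a m.
  rewrite (tuple0 m) /= !theadE => /asboolP[/= ea H].
  by split; [apply/asboolP; split|congr (_, _); apply: val_inj].
- move=> [[e r] m]; case/tupleP: m => d m; case/tupleP: m => a m.
  move=> s t _ /autoP[A1 A2]; rewrite (tuple0 m) /= => -[td ta].
  by apply/autoP; split=> //=; rewrite theadE td ta.
- move=> [[e r] m]; case/tupleP: m => d m; case/tupleP: m => a m.
  move=> s t _ /autoP[A1 A2]; rewrite (tuple0 m) /= => -[td ta].
  by apply/autoP; split=> //=; rewrite theadE td ta.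
Qed.

(** In [t' = t + t t'] the first summand is the case where the marked node is the root; removing it
    leaves the second. *)
Lemma cnt_cl_tree_mark1 : cnt (cl_tree_mark true) = cnt cl_tree * cnt cl_mark_tree.
Proof.
rewrite -cnt_cl_cut_tree; apply: (addrI (cnt cl_tree)); rewrite cnt_cl_cut_tree -cl_mark_tree_cut -cnt_cl_tree_mark0.
apply/esym/cnt_split => V.
rewrite (wt_split _ (fun x : stru 0 2 V => nth (thead x.2) x.2 1 == thead x.2)).
congr (_ + _).
  apply: (@wt_bij _ _ _ _ _ _ (fun x => (x.1.1, x.1.2, [tuple thead x.2]))
     (fun y => (y.1.1, y.1.2, [tuple thead y.2; thead y.2]))).
  - move=> [[e r] m] /= /andP[]; case/tupleP: m => d m; case/tupleP: m => a m.
    rewrite (tuple0 m) /= !theadE => /asboolP[/= [ea H] _] /eqP da; subst d.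
    by split; [apply/asboolP|congr (_, _); apply: val_inj].
  - move=> [[e r] m]; case/tupleP: m => d m; rewrite (tuple0 m) /= !theadE => /asboolP[/= er H].
    split; last by congr (_, _); apply: val_inj.
    by apply/andP; split=> //=; apply/asboolP.
  - move=> [[e r] m] s t _ a; have tc := auto_cons a; case/autoP: a => A1 A2 _.
    by apply/autoP; split=> //=; rewrite tc.
  - move=> [[e r] m] s t _ a; have tc := auto_cons a; case/autoP: a => A1 A2 _.
    by apply/autoP; split=> //=; rewrite tc.
apply: eq_wt => x; apply/andP/asboolP => [[/asboolP[xt _] /eqP xr]|[xt xr]] //.
by split; [apply/asboolP|apply/eqP/xr].
Qed.

Section RootOne.
Variable V : finType.

(** This is [wt_root] with no other root, the mark being placed on the unique root. *)
Lemma wt_root1 (P : pred (stru 1 0 V)) (Q : pred (stru 0 1 V)) :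
    (forall x, P x -> x.1.1 (x.1.2 ord0) = None) ->
    (forall x : stru 1 0 V, x.1.1 (x.1.2 ord0) = None -> P x =
      Q (set_out x.1.1 (x.1.2 ord0) (Some (x.1.2 ord0)), [ffun j => x.1.2 (lift ord0 j)],
         [tuple x.1.2 ord0])) ->
    (forall y, Q y -> y.1.1 (thead y.2) = Some (thead y.2)) ->
  wt P = wt Q.
Proof.
move=> P1 PQ Q1; rewrite -[RHS]mul1r.
have rI (r : {ffun 'I_1 -> V}) : injective r by move=> i j _; rewrite (ord1 i) (ord1 j).
rewrite -(@wt_root 0 V (fun x => P (x.1.1, x.1.2, [tuple]) && (x.1.2 ord0 == thead x.2)) Q) //.
- apply: (@wt_bij _ _ _ _ _ _ (fun x => (x.1.1, x.1.2, [tuple x.1.2 ord0]))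
     (fun x => (x.1.1, x.1.2, [tuple]))).
  + move=> [[e r] m] /= Px; rewrite (tuple0 m) in Px *; split=> //.
    by apply/andP; split; [rewrite (_ : [tuple] = [tuple of [::]]) //; apply: val_inj|].
  + move=> [[e r] m] /= /andP[Px /eqP rE]; split=> //; rewrite rE; congr (_, _).
    by case/tupleP: m {Px} rE => a m; rewrite (tuple0 m) => _; apply: val_inj.
  + move=> [[e r] m] s t _ /autoP[A1 A2 A3]; apply/autoP; split=> //=.
    by rewrite -A2; congr [:: r _]; apply: val_inj; rewrite ord1.
  + by move=> [[e r] m] s t _ /autoP[A1 A2 A3]; apply/autoP.
- by move=> x /andP[/P1 /= xN /eqP <-]; split=> //; exists ord0.
- move=> x i xN; rewrite (ord1 i) => ri; rewrite ri eqxx andbT (PQ (x.1.1, x.1.2, [tuple])) /= ri //.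
  congr (Q (_, _, _)); case: x {ri xN} => [[e r] m] /=.
  by case/tupleP: m => a m; rewrite (tuple0 m); apply: val_inj.
Qed.
End RootOne.

Definition cl_tree1 : sclass 1 0 := fun V x =>
  `[< is_forest false x /\ forall v, rch x.1.1 v (x.1.2 ord0) >].
Definition cl_lone_root : sclass 1 0 := fun V x => let c := x.1.2 ord0 in
  `[< [/\ is_forest false x, forall v, x.1.1 v <> Some c
     & forall v, v <> c -> exists2 w, rch x.1.1 v w & x.1.1 w = Some w] >].

Lemma forest1_root (V : finType) (x : stru 1 0 V) lf : is_forest lf x -> x.1.1 (x.1.2 ord0) = None.
Proof. by case=> _ eN _; apply/eN; exists ord0. Qed.

Lemma forest1E (V : finType) (x : stru 1 0 V) : is_forest false x <-> 
  forall v, x.1.1 v = None <-> v = x.1.2 ord0.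
Proof.
split=> [[_ eN _] v|H].
  by rewrite eN; split=> [[i <-]|->]; [rewrite (ord1 i)|exists ord0].
split=> // [i j _|v]; first by rewrite (ord1 i) (ord1 j).
by rewrite H; split=> [->|[i <-]]; [exists ord0|rewrite (ord1 i)].
Qed.

Lemma cnt_cl_forest1 : cnt (@cl_forest false 1 0) = cnt (@cl_loop false 0).
Proof.
apply: fpsP => N /=; congr (_ / _); apply: wt_root1.
- by move=> x /asboolP/forest1_root.
- move=> x xN; set c := x.1.2 ord0 in xN *.
  apply/asboolP/asboolP => [/forest1E eN|[_ [_ /= eN _]]].
    split; rewrite /= theadE ?set_out_same //; split=> //= [[]//|v].
    split=> [|[[]//]]; rewrite set_outE; case: eqP => // vc /eN E.
    by case: vc.
  apply/forest1E => v; have := eN v; rewrite set_outE; case: eqP => [-> _|vc [E _]].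
    by split.
  by split=> [/E[[]]|/vc].
- by move=> y /asboolP[].
Qed.

Lemma cnt_cl_tree1 : cnt cl_tree1 = cnt cl_tree.
Proof.
apply: fpsP => N /=; congr (_ / _); apply: wt_root1.
- by move=> x /asboolP[/forest1_root].
- move=> x xN; set c := x.1.2 ord0 in xN *.
  set e' := set_out _ _ _.
  have e'E u : u <> c -> e' u = x.1.1 u by rewrite set_outE; case: eqP.
  apply/asboolP/asboolP => [[/forest1E eN H]|[_ /= H]].
    split; rewrite /= theadE ?set_out_same // => v.
    by apply: rch_eq (H v) => u _; apply: e'E.
  rewrite theadE in H; have H' v : rch x.1.1 v c.
    by apply: rch_eq (H v) => u _ uc; rewrite e'E.
  split=> //; apply/forest1E => v; split=> [vN|->//].
  exact: rch_root vN (H' v).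
- by move=> y /asboolP[].
Qed.

(** Turning the isolated root into a loop gives [cl_lone_looped], which [gather] turns into trees.
    This is why K has [T_N] classes. *)
Lemma cnt_cl_lone_root : cnt cl_lone_root = cnt cl_tree.
Proof.
rewrite -cnt_cl_lone_looped_T; apply: fpsP => N /=; congr (_ / _); apply: wt_root1.
- by move=> x /asboolP[/forest1_root].
- move=> x xN; set c := x.1.2 ord0 in xN *.
  set e' := set_out _ _ _.
  have e'c : e' c = Some c by rewrite set_out_same.
  have e'E u : u <> c -> e' u = x.1.1 u by rewrite set_outE; case: eqP.
  apply/asboolP/asboolP => [[/forest1E eN iso H]|[_ iso H]]; rewrite /= ?theadE in iso H *.
    split=> // [v vc|v]; first by rewrite e'E.
    have [->|/eqP vc] := eqVneq v c; first by exists c; [apply: rch_refl|].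
    have [w vw ww] := H _ vc; exists w.
      apply: rch_eq vw => u uw uN; apply: e'E => uc; move: uw; rewrite uc.
      by move/(rch_root xN) => E; apply: uN; rewrite uc.
    by rewrite e'E // => wc; move: ww; rewrite wc xN.
  have iso' v : x.1.1 v <> Some c.
    have [->|/eqP vc] := eqVneq v c; first by rewrite xN.
    by rewrite -e'E //; apply: iso.
  split=> //.
    apply/forest1E => v; split=> [vN|->//].
    have [//|/eqP vc] := eqVneq v c.
    have [w vw ww] := H v; have vw' := rch_root _ vw.
    by rewrite e'E // vN in vw'; move: ww; rewrite -vw' // e'E // vN.
  move=> v vc; have [w vw ww] := H v.
  elim/rch_ind: v / vw vc => [wc|v u vu uw IH vc].
    by exists w; [apply: rch_refl|rewrite -e'E].
  have xvu : x.1.1 v = Some u by rewrite -e'E.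
  have uc : u <> c by move=> E; apply: (iso' v); rewrite xvu E.
  by have [w' uw' ww'] := IH uc; exists w' => //; apply: rch_trans (rch_step xvu) uw'.
- by move=> y /asboolP[].
Qed.

Definition cl_bare lf : sclass 0 1 := fun V x =>
  `[< is_forest lf x /\ forall v, x.1.1 v <> Some (thead x.2) >].

(** Without roots the covertex has an outgoing edge, so it can be cut. Having no predecessor means
    that the loop obtained is isolated and that the former target is another node. *)
Lemma cnt_cl_bare lf : cnt (cl_bare lf) = cnt (cl_cut_bare lf).
Proof.
apply: eq_cnt => V.
rewrite -(@eq_wt _ _ _ (fun x : stru 0 1 V => cl_bare lf x && (x.1.1 (thead x.2) != None))); last first.
  move=> x; rewrite /cl_bare; case: asboolP => //= -[[_ eN _] _]; case: eqP => // /eN[[]].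
  by [].
rewrite wt_cut; apply: eq_wt => -[[e r] m].
set y : stru 0 2 V := (e, r, m); set c := thead m.
apply/andP/asboolP => [[/eqP yc /asboolP[/(uncut_forest lf yc) [yo _] iso]]|[yc yo dc iso]].
  split=> // [E|v vc]; have := iso _; rewrite /= theadE.
    by move/(_ c); rewrite set_out_same; apply; rewrite E.
  by move/(_ v); rewrite set_outE; case: eqP.
split; first exact/eqP.
apply/asboolP; split; first exact/(uncut_forest lf yc).
move=> v; rewrite /= theadE set_outE; case: eqP => [_ [/dc]|vc] //; exact: iso.
Qed.

Lemma cnt_cl_point N : fcoef (cnt cl_point) N = (N == 1)%:R.
Proof.
rewrite /=; have [->|N1] := eqVneq N 1.
  rewrite (_ : wt _ = 1) //.
  pose x0 : stru 0 1 'I_1 := ([ffun=> Some ord0], [ffun=> ord0], [tuple ord0]).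
  rewrite /wt (big_pred1 x0) => [|[[e r] m]]; last first.
    apply/asboolP/eqP => [[+ _]|[-> _ mE]].
      case/tupleP: m => a m; rewrite (tuple0 m) (ord1 a) /= => e0.
      rewrite /x0; congr (_, _, _).
      - by apply/ffunP => v; rewrite ffunE (ord1 v).
      - by apply/ffunP => -[].
    split=> [|v]; last by rewrite (ord1 v) [RHS]ord1.
    by rewrite /= ffunE [thead _]ord1.
  rewrite (big_pred1 1%g) => [|s]; last by rewrite (perm0 s) /= eqxx.
  rewrite (big_pred1 1%g) => [|t]; first by rewrite odd_perm1.
  have -> : t = 1%g by apply/permP => v; rewrite !ord1.
  rewrite /= eqxx; apply/autoP; split=> //= [v|[]//|]; last by rewrite perm1.
  by rewrite !ffunE /= perm1.
rewrite /wt big_pred0 ?mul0r // => x; apply/asboolP => -[_ H].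
have : #|'I_N| = 1%N.
  by apply: (@eq_card1 _ (thead x.2)) => v; rewrite [RHS]inE (H v) eqxx.
by rewrite card_ord => /eqP; rewrite (negbTE N1).
Qed.

Local Open Scope quotient_scope.

(** * Dimensions as weighted counts *)

Section IdempotentTrace.
Variables (K : fieldType) (T : finType).

Lemma fvecE (t u : T) : (fvec K t : {ffun T -> K^o}) u = (u == t)%:R.
Proof. by rewrite ffunE. Qed.

Lemma lfun_fvec (V : vectType K) (f : 'Hom({ffun T -> K^o}, V)) a :
  f a = \sum_t (a t : K) *: f (fvec K t).
Proof. by rewrite {1}[a]fvec_sum linear_sum; apply: eq_bigr => t _; rewrite linearZ. Qed.

Lemma dim_idempotent (f : 'End({ffun T -> K^o})) : (forall a, f (f a) = f a) ->
  (\dim (limg f))%:R = \sum_t (f (fvec K t) t : K).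
Proof.
move=> ff; set U := limg f; pose b := vbasis U.
have fb (i : 'I_(\dim U)) : f b`_i = b`_i.
  have /memv_imgP[a _ ->] : b`_i \in U by apply: vbasis_mem; rewrite mem_nth // size_tuple.
  by rewrite ff.
have fE t : f (fvec K t) = \sum_i coord b i (f (fvec K t)) *: b`_i.
  by apply: coord_vbasis; apply/memv_img/memvf.
rewrite (eq_bigr (fun t => \sum_(i < \dim U) (b`_i t : K) * coord b i (f (fvec K t)))); last first.
  move=> t _; rewrite [in LHS]fE sum_ffunE; apply: eq_bigr => i _.
  by rewrite ffunE /GRing.scale /= mulrC.
rewrite exchange_big /= -[in LHS](card_ord (\dim U)) -sum1_card natr_sum.
(* An idempotent fixes each vector of a basis of its image, so each of them contributes 1 to the
   trace. *)
apply: eq_bigr => i _; rewrite -[LHS](_ : coord b i (f b`_i) = 1); last first.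
  by rewrite fb coord_free ?eqxx //; apply: basis_free (vbasisP U).
by rewrite lfun_fvec linear_sum; apply: eq_bigr => t _; rewrite linearZ.
Qed.
End IdempotentTrace.

Section Dimension.
Variables (k p N : nat).
Implicit Types x y : lforest k p N.
Local Notation cls := (\pi_(aforest k p N)).

Definition to_stru x : stru k p 'I_N := (out x, rt x, [tuple cov x j | j < p]).

(** Automorphisms become isomorphisms from [x] to a renumbered copy, whose existence says that the
    renumbering fixes the class of [x]. *)
Lemma auto_iso x s t : auto (to_stru x) s t = iso_by t x (perm_rt s^-1 x).
Proof.
apply/autoP/iso_byP => -[/= A B C]; split=> //.
- by move=> i; rewrite ffunE invgK B.
- move=> j; move: C; rewrite -map_comp => /eq_in_map H.
  have /H : j \in enum 'I_p by rewrite mem_enum.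
  by rewrite /= => ->.
- by move=> i; rewrite -B ffunE invgK.
- by rewrite -map_comp; apply: eq_map => j /=; rewrite -C.
Qed.

Lemma iso_by_comp x y z s t : iso_by s x y -> iso_by t y z -> iso_by (s * t)%g x z.
Proof.
move=> /iso_byP[A B C] /iso_byP[A' B' C']; apply/iso_byP; split=> v.
- by rewrite permM A' A; case: (out x v) => //= w; rewrite permM.
- by rewrite B' B permM.
- by rewrite C' C permM.
Qed.

Lemma iso_by_inv x y s : iso_by s x y -> iso_by s^-1%g y x.
Proof.
move=> /iso_byP[A B C]; apply/iso_byP; split=> v; rewrite ?B ?C ?permK //.
by rewrite -{2}(permKV s v) A; case: (out x _) => //= w; rewrite permK.
Qed.

Lemma iso_by_exists x s : exists y, iso_by s x y.
Proof.
have ax : lforest_axiom [ffun v => omap s (out x (s^-1%g v))] [ffun i => s (rt x i)]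
    [ffun j => s (cov x j)].
  apply/and3P; split.
  - by apply/injectiveP => i j; rewrite !ffunE => /perm_inj/rt_inj.
  - apply/forallP => v; rewrite ffunE; apply/eqP; have := mem_rt x (s^-1%g v).
    case: (out x _) => [w|] /= E; last first.
      have /codomP[i vE] : s^-1%g v \in codom (rt x) by rewrite E eqxx.
      by rewrite eqxx; apply/codomP; exists i; rewrite ffunE -vE permKV.
    apply/negbTE/negP => /codomP[i]; rewrite ffunE => vE.
    by move/negbT/negP: E; apply; apply/codomP; exists i; rewrite vE permK.
  - by apply/injectiveP => i j; rewrite !ffunE => /perm_inj/cov_inj.
exists (@LForest _ _ _ (_, _, _) ax); apply/iso_byP; split=> v.
- by rewrite ffunE permK.
- by rewrite ffunE.
- by rewrite ffunE.
Qed.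

Lemma iso_by_fun x y z s : iso_by s x y -> iso_by s x z -> y = z.
Proof.
move=> /iso_byP[A B C] /iso_byP[A' B' C']; apply: lforestP => v.
- by rewrite -(permKV s v) A A'.
- by rewrite B B'.
- by rewrite C C'.
Qed.

Lemma sum_iso x : (\sum_y #|[set s | iso_by s x y]| = N`!)%N.
Proof.
transitivity (\sum_(s : 'S_N) 1)%N; last by rewrite sum1_card card_Sn.
under eq_bigr do rewrite -sum1_card big_mkcond /=.
rewrite exchange_big /=; apply: eq_bigr => s _.
have [y xy] := iso_by_exists x s; rewrite (bigD1 y) //= inE xy big1 // => z zy.
rewrite inE; case: ifP => // xz; by move: zy; rewrite (iso_by_fun xz xy) eqxx.
Qed.

Lemma card_iso x y z : iso x y -> iso y z ->
  #|[set s | iso_by s y z]| = #|[set s | iso_by s x y]|.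
Proof.
case/existsP=> a xy /existsP[b yz].
rewrite -(card_imset _ (f := fun s => (a * s * b^-1)%g)); last first.
  by move=> s t /mulIg/mulgI.
apply: eq_card => s; rewrite inE; apply/imsetP/idP => [[t]|sxy].
  rewrite inE => yzt ->; apply: iso_by_comp (iso_by_inv yz).
  exact: iso_by_comp xy yzt.
exists (a^-1 * s * b)%g; last by rewrite !mulgA mulgV mul1g mulgK.
by rewrite inE; apply: iso_by_comp yz; apply: iso_by_comp sxy; apply: iso_by_inv.
Qed.

(** If renumbering by [s] fixes [g], then [card_iso] replaces the isomorphisms from [x] to
    [perm_rt s x] by those from [repr g] to [x]. Each permutation sends [repr g] to exactly one
    forest, whence [N!] in all. *)
Lemma sum_class (g : aforest k p N) (s : 'S_k) :
  (\sum_(x | cls x == g) #|[set t | iso_by t x (perm_rt s x)]| =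
   (cls (perm_rt s (repr g)) == g) * N`!)%N.
Proof.
have sE x : cls x == g -> (cls (perm_rt s x) == g) = (cls (perm_rt s (repr g)) == g).
  move=> /eqP <-; congr (_ == _); apply/pi_iso/perm_rt_iso/pi_iso; by rewrite reprK.
case: eqVneq => [sg|sg].
  rewrite mul1n -(sum_iso (repr g)) [RHS](bigID (fun y => cls y == g)) /=.
  rewrite [X in _ = (_ + X)%N]big1 ?addn0.
    apply: eq_bigr => x xg; apply: card_iso.
      by apply/pi_iso; rewrite reprK (eqP xg).
    have := sE _ xg; rewrite sg eqxx => /eqP; rewrite -{1}(eqP xg) => E.
    exact/pi_iso/esym.
  move=> y yg; apply/eqP; rewrite cards_eq0 -subset0; apply/subsetP => t.
  rewrite inE => ty; case/eqP: yg; rewrite -[RHS]reprK; apply/esym/pi_iso.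
  by apply/existsP; exists t.
rewrite mul0n big1 // => x xg; apply/eqP; rewrite cards_eq0 -subset0; apply/subsetP => t.
rewrite inE => tx; have: cls (perm_rt s x) == g.
  by rewrite -(eqP xg); apply/eqP/esym/pi_iso/existsP; exists t.
by rewrite sE // (negbTE sg).
Qed.

(* [C] describes the structures of the forests whose class satisfies [Q]. *)
Variables (Q : pred (aforest k p N)) (C : sclass k p).
Hypothesis QC : forall x, Q (cls x) = C (to_stru x).
Hypothesis C_forest : forall y : stru k p 'I_N, C y -> exists x, y = to_stru x.

Lemma to_stru_inj : injective to_stru.
Proof.
move=> x y [E1 E2 /eq_in_map E3]; apply: lforestP => v; rewrite ?E1 ?E2 //.
by apply: E3; rewrite mem_enum.
Qed.

Lemma wt_classes : wt (@C 'I_N) =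
  (\sum_(s : 'S_k) (-1) ^+ s * #|[set g | Q g & cls (perm_rt s (repr g)) == g]|%:R) * N`!%:R.
Proof.
rewrite /wt (@sum_image _ _ _ (fun x => Q (cls x)) _ to_stru) /=; first last.
- by move=> y Cy; have [x yE] := C_forest Cy; exists x; rewrite // QC -yE.
- by move=> x; rewrite QC.
- by move=> x y _ _ /to_stru_inj.
(* Replacing [s] by its inverse, which has the same sign, undoes the inverse in [auto_iso]. *)
rewrite exchange_big /= (reindex_inj (@invg_inj _)) /= mulr_suml; apply: eq_bigr => s _.
rewrite odd_permV -mulrA -natrM.
rewrite (eq_bigr (fun x => (-1) ^+ s * #|[set t | iso_by t x (perm_rt s x)]|%:R)); last first.
  move=> x _; rewrite mulr_natr -sumr_const; apply: eq_bigl => t.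
  by rewrite inE auto_iso invgK.
rewrite -mulr_sumr -natr_sum; congr (_ * _%:R).
rewrite (partition_big cls Q) //= -sum1_card big_distrl /= big_mkcond [RHS]big_mkcond /=.
apply: eq_bigr => g _; rewrite inE; case: ifP => //= Qg.
rewrite mul1n -[RHS](_ : (cls (perm_rt s (repr g)) == g) * N`! = _)%N; last by case: eqP => // _; rewrite mul1n.
rewrite -sum_class; apply: eq_bigl => x; case: eqP => [->|_]; rewrite ?andbF //.
by rewrite Qg.
Qed.

Lemma perm_rtM x s u : perm_rt u (perm_rt s x) = perm_rt (s * u) x.
Proof.
by apply: lforestP => // i; rewrite !ffunE invMg permM.
Qed.

Local Opaque odd_perm.
Variable R : realType.
Hypothesis p1 : (p <= 1)%N.
Local Notation w := (wedge R k p N).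

Lemma permI1 (s : 'S_p) : s = 1%g.
Proof.
apply/permP => i; rewrite perm1; apply: val_inj => /=.
by have := ltn_ord i; have := ltn_ord (s i); lia.
Qed.

Lemma wedge_cls x : w (fvec R (cls x)) =
  (k`!%:R^-1 : R) *: \sum_(s : 'S_k) ((-1) ^+ s : R) *: fvec R (cls (perm_rt s x)).
Proof.
rewrite wedge_fvec (big_pred1 1%g) => [|s]; last by rewrite (permI1 s) /= eqxx.
have -> : p`! = 1%N by case: (p) p1 => [|[]].
rewrite mulr1n invr1 mul1r.
have H s : cls (perm_rt s (perm_cov 1%g (repr (cls x)))) = cls (perm_rt s x).
  apply/pi_iso/perm_rt_iso.
  have -> : perm_cov 1%g (repr (cls x)) = repr (cls x).
    by apply: lforestP => // i; rewrite !ffunE invg1 perm1.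
  by apply/pi_iso; rewrite reprK.
refine (congr1 (GRing.scale _) (eq_bigr _ _)) => s _.
by rewrite odd_perm1 mul1r H.
Qed.

Lemma wedge_perm x s : w (fvec R (cls (perm_rt s x))) = ((-1) ^+ s : R) *: w (fvec R (cls x)).
Proof.
refine (etrans (wedge_cls _) (etrans _ (esym (congr1 (GRing.scale _) (wedge_cls _))))).
rewrite [RHS]scalerA [X in _ = X *: _]mulrC -[RHS]scalerA [in RHS]scaler_sumr.
refine (congr1 (GRing.scale _) (etrans (eq_bigr _ _) (esym (reindex_inj (mulgI s))))) => u _.
by rewrite perm_rtM scalerA odd_permM signr_addb mulrA -expr2 sqrr_sign mul1r.
Qed.

Hypothesis Q_perm : forall x s, Q (cls (perm_rt s x)) = Q (cls x).

Lemma dim_wedge_span :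
  (\dim <<[seq w (fvec R g) | g in Q]>>%VS)%:R = fcoef (cnt C) N.
Proof.
(* Antisymmetrization restricted to the classes in [Q]; it is idempotent because [Q] is stable under
   renumbering of the roots. *)
pose T : 'End(fspan R k p N) := lin_ext (fun g => if Q g then w (fvec R g) else 0).
have TE g : T (fvec R g) = if Q g then w (fvec R g) else 0 by apply: lin_ext_fvec.
have -> : <<[seq w (fvec R g) | g in Q]>>%VS = limg T.
  apply/eqP; rewrite eqEsubv; apply/andP; split.
    apply/span_subvP => _ /imageP[g Qg ->]; rewrite -[w _](_ : T (fvec R g) = _).
      exact/memv_img/memvf.
    by rewrite TE (Qg : Q g).
  apply/subvP => _ /memv_imgP[a _ ->]; rewrite lfun_fvec; apply: rpred_sum => g _.
  apply: rpredZ; rewrite TE; case: ifP => Qg; last exact: mem0v.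
  by apply/memv_span/imageP; exists g.
have TW x : Q (cls x) -> T (w (fvec R (cls x))) = w (fvec R (cls x)).
  move=> Qx; rewrite {1}wedge_cls linearZ linear_sum /=.
  under eq_bigr => s _ do
    rewrite linearZ /= TE Q_perm Qx wedge_perm scalerA -expr2 sqrr_sign scale1r.
  rewrite sumr_const card_Sn -scaler_nat scalerA mulVf ?scale1r //.
  by rewrite pnatr_eq0 -lt0n fact_gt0.
have TT a : T (T a) = T a.
  rewrite [T a]lfun_fvec [LHS]linear_sum; apply: eq_bigr => g _; rewrite linearZ /=.
  rewrite TE; case: ifP => Qg; last by rewrite linear0.
  by have := TW (repr g); rewrite reprK => /(_ Qg) ->.
(* The trace lives in [R] and the count in [rat]; after multiplication by [k!] the identity is one
   between integers, which embed in both fields. *)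
have dimE : (\dim (limg T) * k`!)%:Z = \sum_(s : 'S_k) (-1) ^+ s *
    #|[set g | Q g & cls (perm_rt s (repr g)) == g]|%:Z.
  apply: (@intr_inj R); rewrite -pmulrn natrM (dim_idempotent TT) rmorph_sum /=.
  rewrite (eq_bigr (fun g => \sum_(s : 'S_k) (k`!%:R^-1 : R) *
      ((-1) ^+ s * (Q g && (cls (perm_rt s (repr g)) == g))%:R))); last first.
    move=> g _; rewrite TE; case: (Q g); last first.
      by rewrite ffunE big1 // => s _; rewrite !mulr0.
    rewrite -[g in LHS]reprK wedge_cls ffunE sum_ffunE /GRing.scale /= mulr_sumr.
    by apply: eq_bigr => s _; rewrite !ffunE reprK [g == _]eq_sym.
  rewrite exchange_big mulr_suml; apply: eq_bigr => s _ /=.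
  rewrite -mulr_sumr mulrC mulVKf ?pnatr_eq0 -?lt0n ?fact_gt0 // -mulr_sumr.
  rewrite rmorphM rmorphXn rmorphN1 /= (_ : _%:~R =
    #|[set g | Q g & cls (perm_rt s (repr g)) == g]|%:R) // -sum1_card natr_sum [in RHS]big_mkcond /=.
  congr (_ * _); apply: eq_bigr => g _; rewrite inE; by case: ifP.
rewrite /= wt_classes natrM invfM mulrACA divff ?fact_rat_neq0 // mulr1.
apply: (canRL (mulfK (fact_rat_neq0 _))); rewrite -natrM.
rewrite pmulrn dimE rmorph_sum; apply: eq_bigr => s _ /=.
by rewrite rmorphM rmorphXn rmorphN1.
Qed.
End Dimension.

Local Close Scope quotient_scope.

Local Open Scope quotient_scope.

Section ForestClass.
Variables (k p N : nat).
Implicit Types x : lforest k p N.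
Local Notation cls := (\pi_(aforest k p N)).

Lemma to_stru_forest lf x : is_forest lf (to_stru x) <-> (lf -> ~~ has_loop x).
Proof.
split=> [[_ _ loop] l|loop].
  by apply/existsP => -[v /eqP xv]; apply: (loop l v).
split=> [|v|l v _ xv]; first exact: rt_inj.
  rewrite /=; split=> [xv|[i <-]].
    have /codomP[i ->] : v \in codom (rt x) by rewrite mem_rt xv.
    by exists i.
  by apply/eqP; rewrite -mem_rt; apply/codomP; exists i.
by move/existsP: (loop l); apply; exists v; apply/eqP.
Qed.

Lemma stru_forest (y : stru k p 'I_N) : (p <= 1)%N -> is_forest false y -> exists x, y = to_stru x.
Proof.
case: y => [[e r] m] p1 [rI eN _].
have ax : lforest_axiom e r [ffun j => tnth m j].
  apply/and3P; split; first exact/injectiveP.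
    apply/forallP => v; apply/eqP; apply/codomP/eqP => [[i ->]|/eN[i <-]].
      by apply/eN; exists i.
    by exists i.
  apply/injectiveP => i j _; apply: val_inj => /=.
  by have := ltn_ord i; have := ltn_ord j; lia.
exists (@LForest _ _ _ (_, _, _) ax); rewrite /to_stru /=; congr (_, _).
by apply: eq_from_tnth => j; rewrite tnth_mktuple /cov /= ffunE.
Qed.

Lemma is_forestW lf (y : stru k p 'I_N) : is_forest lf y -> is_forest false y.
Proof. by case=> rI eN _. Qed.

Lemma cl_forest_cls lf x : ~~ (lf && ahas_loop (cls x)) = @cl_forest lf k p 'I_N (to_stru x).
Proof.
rewrite ahas_loop_pi; apply/idP/asboolP => [H|/to_stru_forest]; last by case: lf => // ->.
by apply/to_stru_forest => l; move: H; rewrite l.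
Qed.

End ForestClass.

Section Dimensions.
Variable R : realType.

Lemma OmegaE k p N : Omega R k p N = <<[seq wedge R k p N (fvec R g) | g in predT]>>%VS.
Proof.
apply/eqP; rewrite eqEsubv; apply/andP; split.
  apply/subvP => _ /memv_imgP[a _ ->]; rewrite lfun_fvec; apply: rpred_sum => g _.
  by apply/rpredZ/memv_span/imageP; exists g.
by apply/span_subvP => _ /imageP[g _ ->]; apply/memv_img/memvf.
Qed.

Lemma dim_Omega k p N : (p <= 1)%N -> (\dim (Omega R k p N))%:R = fcoef (cnt (@cl_forest false k p)) N.
Proof.
move=> p1; rewrite OmegaE; apply: dim_wedge_span => //.
- by move=> x; rewrite -cl_forest_cls.
- by move=> y /asboolP/stru_forest; apply.
Qed.

Lemma dim_Omega_df k p N : (p <= 1)%N -> (\dim (Omega_df R k p N))%:R = fcoef (cnt (@cl_forest true k p)) N.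
Proof.
move=> p1; apply: dim_wedge_span => //.
- by move=> x; rewrite -cl_forest_cls.
- by move=> y /asboolP/is_forestW/stru_forest; apply.
- by move=> x s /=; rewrite /in_mem /= !ahas_loop_pi.
Qed.

Lemma dim_fvec_span (K : numFieldType) (T : finType) (Q : pred T) : \dim <<[seq fvec K t | t in Q]>>%VS = #|Q|.
Proof.
pose f : 'End({ffun T -> K^o}) := lin_ext (fun t => if Q t then fvec K t else 0).
have fE t : f (fvec K t) = if Q t then fvec K t else 0 by apply: lin_ext_fvec.
have -> : <<[seq fvec K t | t in Q]>>%VS = limg f.
  apply/eqP; rewrite eqEsubv; apply/andP; split.
    apply/span_subvP => _ /imageP[g Qg ->]; rewrite -[fvec K g](_ : f (fvec K g) = _).
      exact/memv_img/memvf.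
    by rewrite fE (Qg : Q g).
  apply/subvP => _ /memv_imgP[a _ ->]; rewrite lfun_fvec; apply: rpred_sum => g _.
  apply: rpredZ; rewrite fE; case: ifP => Qg; last exact: mem0v.
  by apply/memv_span/imageP; exists g.
have ff a : f (f a) = f a.
  rewrite [f a]lfun_fvec [LHS]linear_sum; apply: eq_bigr => t _; rewrite linearZ /=.
  by rewrite fE; case: ifP => Qt; rewrite ?linear0 // fE Qt.
apply/eqP; rewrite -(eqr_nat K) (dim_idempotent ff) -sum1_card natr_sum [X in _ == X]big_mkcond.
apply/eqP; apply: eq_bigr => t _; rewrite fE /in_mem /=.
by case: (Q t); rewrite !ffunE ?eqxx.
Qed.

Lemma perm1_small k (s : 'S_k) : (k <= 1)%N -> s = 1%g.
Proof. move=> k1; exact: permI1. Qed.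

Lemma perm_rt1 k p N (x : lforest k p N) : perm_rt 1%g x = x.
Proof. by apply: lforestP => // i; rewrite !ffunE invg1 perm1. Qed.

Lemma wedge_id k p N a : (k <= 1)%N -> (p <= 1)%N -> wedge R k p N a = a.
Proof.
move=> k1 p1; rewrite lfun_fvec [RHS]fvec_sum; apply: eq_bigr => g _; congr (_ *: _).
rewrite -[g]reprK wedge_cls // (big_pred1 1%g) => [|s]; last first.
  by rewrite (perm1_small s k1) /= eqxx.
rewrite odd_perm1 scale1r perm_rt1 (_ : k`! = 1%N); last by case: (k) k1 => [|[]].
by rewrite mulr1n invr1 scale1r.
Qed.

(** With at most one root the identity is the only renumbering: no sign appears and the coefficient
    is a plain number of classes. *)
Lemma cnt_card k p N (Q : pred (aforest k p N)) (C : sclass k p) : (k <= 1)%N ->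
    (forall x, Q (\pi_(aforest k p N) x) = C _ (to_stru x)) ->
    (forall y : stru k p 'I_N, C _ y -> exists x : lforest k p N, y = to_stru x) ->
  fcoef (cnt C) N = #|Q|%:R.
Proof.
move=> k1 QC CF; rewrite /= (wt_classes QC CF) (big_pred1 1%g) => [|s]; last first.
  by rewrite (perm1_small s k1) /= eqxx.
rewrite odd_perm1 mul1r natrM (_ : k`! = 1%N); last by case: (k) k1 => [|[]].
rewrite mul1r mulfK ?fact_rat_neq0 //; congr _%:R; apply: eq_card => g.
by rewrite inE perm_rt1 reprK eqxx andbT.
Qed.

Lemma num_treesE N : (num_trees N)%:R = fcoef (cnt cl_tree1) N.
Proof.
rewrite /num_trees cardsE; apply/esym/cnt_card => //.
- move=> x; apply/forallP/asboolP => [H|[_ H] v].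
    split; first exact/to_stru_forest.
    have /existsP[s /iso_byP[A B _]] : iso (repr (\pi_(aforest 1 0 N) x)) x by apply/pi_iso; rewrite reprK.
    move=> v; have := H (s^-1%g v) => /rch_connect[n nE]; exists n.
    rewrite /= B -{1}(permKV s v).
    have it m w : iter m (obind (out x)) (Some (s w)) =
        omap s (iter m (obind (out (repr (\pi_(aforest 1 0 N) x)))) (Some w)).
      by elim: m => //= m ->; case: (iter m _ _) => //= u; rewrite A.
    by rewrite it nE.
  have /existsP[s /iso_byP[A B _]] : iso x (repr (\pi_(aforest 1 0 N) x)) by apply/pi_iso; rewrite reprK.
  apply/rch_connect; have [n nE] := H (s^-1%g v); exists n.
  rewrite B -{1}(permKV s v).
  have it m w : iter m (obind (out (repr (\pi_(aforest 1 0 N) x)))) (Some (s w)) =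
      omap s (iter m (obind (out x)) (Some w)).
    by elim: m => //= m ->; case: (iter m _ _) => //= u; rewrite A.
  by rewrite it nE.
- by move=> y /asboolP[/stru_forest H _]; apply: H.
Qed.

(** * The image of the operator I *)

Section Interior.
Variable N : nat.
Local Notation cls := (\pi_(aforest 0 1 N)).

Definition bare (x : lforest 0 1 N) := [forall v, out x v != Some (cov x ord0)].

Lemma bare_iso x y : iso x y -> bare x -> bare y.
Proof.
case/existsP=> s /iso_byP[A _ C] /forallP H; apply/forallP => v; rewrite -(permKV s v) A C.
by have := H (s^-1%g v); case: (out x _) => //= u; apply: contraNneq => -[/perm_inj ->].
Qed.
Lemma bare_cls x : bare (repr (cls x)) = bare x.
Proof.
have xr : iso (repr (cls x)) x by apply/pi_iso; rewrite reprK.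
by apply/idP/idP; apply: bare_iso; rewrite // iso_sym.
Qed.

Lemma redirect_bare (x : lforest 0 1 N) h : bare (@redirect N x h).
Proof.
apply/forallP => v; rewrite /redirect {1}/out /= ffunE; case: insubP => [v' _ _|].
  by apply/eqP => -[E]; have /eqP := valP (h v'); apply.
by rewrite inE.
Qed.

(** Without predecessors of the covertex there is exactly one redirection, the empty one, and the
    sign is [(-1)^0]. So I fixes these forests, which also contain its image. *)
Lemma Iop_bare (g : aforest 0 1 N) : bare (repr g) -> Iop R N (fvec R g) = fvec R g.
Proof.
move=> gb; rewrite lin_ext_fvec /=; set x := repr g; set c := cov x ord0.
have p0 v : v \notin preds x c by rewrite inE (forallP gb).
have -> : #|preds x c| = 0%N by apply: eq_card0 => v; rewrite (negbTE (p0 v)).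
rewrite expr0 scale1r.
have red h : @redirect N x h = x.
  apply: lforestP => v; [|by []|by []].
  rewrite /redirect {1}/out /= ffunE; case: insubP => // v' vp.
  by have := p0 v; rewrite vp.
under eq_bigr => h _ do rewrite red.
rewrite sumr_const reprK card_ffun (_ : #|{: {v | v \in preds x c}}| = 0%N) ?expn0 //.
by rewrite card_sig; apply: eq_card0 => v; rewrite unfold_in /= (negbTE (p0 v)).
Qed.

Lemma Iop_span (g : aforest 0 1 N) : Iop R N (fvec R g) \in <<[seq fvec R g | g in [pred g : aforest 0 1 N | bare (repr g)]]>>%VS.
Proof.
rewrite lin_ext_fvec /=; apply/rpredZ/rpred_sum => h _; apply/memv_span/imageP.
by eexists; last reflexivity; rewrite inE bare_cls redirect_bare.
Qed.

Lemma cl_bare_cls lf x : bare (repr (cls x)) && ~~ (lf && ahas_loop (cls x)) = cl_bare lf (to_stru x).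
Proof.
rewrite bare_cls cl_forest_cls; apply/andP/asboolP => [[/forallP xb /asboolP xF]|[xF xb]]; split=> //.
- by move=> v E; have := xb v; rewrite -[out x v]/((to_stru x).1.1 v) E /thead tnth_mktuple eqxx.
- by apply/forallP => v; apply/eqP; have := xb v; rewrite /thead tnth_mktuple.
- exact/asboolP.
Qed.

Lemma dim_calI1 : (\dim (calI1 R N))%:R = fcoef (cnt (cl_bare false)) N.
Proof.
rewrite (@cnt_card 0 1 N [pred g | bare (repr g)]) //; first last.
- by move=> y /asboolP[/stru_forest H _]; apply: H.
- by move=> x; rewrite -cl_bare_cls andbT.
rewrite -(dim_fvec_span R); congr (\dim _)%:R; apply/eqP; rewrite eqEsubv; apply/andP; split.
  apply/subvP => _ /memv_imgP[a _ ->]; rewrite lfun_fvec.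
  by apply: rpred_sum => g _; apply/rpredZ/Iop_span.
apply/span_subvP => _ /imageP[g gb ->]; rewrite -Iop_bare //; apply: memv_img.
by rewrite -[fvec R g](@wedge_id 0 1) //; apply/memv_img/memvf.
Qed.

Lemma dim_calI1_df : (\dim (calI1_df R N))%:R = fcoef (cnt (cl_bare true)) N.
Proof.
rewrite (@cnt_card 0 1 N [pred g | bare (repr g) & ~~ ahas_loop g]) //; first last.
- by move=> y /asboolP[/is_forestW/stru_forest H _]; apply: H.
- by move=> x; rewrite -cl_bare_cls.
rewrite -(dim_fvec_span R); congr (\dim _)%:R; apply/eqP; rewrite eqEsubv; apply/andP; split.
  apply/subvP => _ /memv_imgP[a _ ->]; rewrite comp_lfunE.
  pose B := <<[seq fvec R g | g in [pred g : aforest 0 1 N | bare (repr g)]]>>%VS.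
  have aB : Iop R N a \in B.
    by rewrite lfun_fvec; apply: rpred_sum => g _; apply/rpredZ/Iop_span.
  apply: subvP (memv_img (kill_loops R 0 1 N) aB); rewrite limg_span.
  apply/span_subvP => _ /mapP[_ /imageP[g gb ->] ->]; rewrite lin_ext_fvec.
  case: ifP => gl; first exact: mem0v.
  by apply/memv_span/imageP; exists g; rewrite // inE gl andbT.
apply/span_subvP => _ /imageP[g /andP[gb gl] ->].
have -> : fvec R g = (kill_loops R 0 1 N \o Iop R N)%VF (fvec R g).
  by rewrite comp_lfunE Iop_bare // lin_ext_fvec (negbTE gl).
apply/memv_img/memv_span/imageP; exists g => //.
by rewrite wedge_id.
Qed.
End Interior.
End Dimensions.

Local Close Scope quotient_scope.

(** * Counting reduced maps *)

Section Endofunctions.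
Variable V : finType.
Local Notation E := {ffun V -> V}.
Implicit Types (e f g h y z : E) (v w u r : V) (A S : {set V}).

Definition upd e r u : E := [ffun v => if v == r then u else e v].

Lemma updE e r u v : upd e r u v = if v == r then u else e v.
Proof. by rewrite ffunE. Qed.
Lemma upd_same e r u : upd e r u r = u. Proof. by rewrite updE eqxx. Qed.
Lemma upd_upd e r u u' : upd (upd e r u) r u' = upd e r u'.
Proof. by apply/ffunP => v; rewrite !updE; case: eqP. Qed.
Lemma upd_id e r : upd e r (e r) = e.
Proof. by apply/ffunP => v; rewrite updE; case: eqP => // ->. Qed.

(* The nodes whose component contains a loop. *)
Definition LC e : {set V} := [set v | `[< exists n, e (iter n e v) = iter n e v >]].

Lemma LCP e v : reflect (exists n, e (iter n e v) = iter n e v) (v \in LC e).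
Proof. by rewrite inE; apply: asboolP. Qed.

Lemma LC_loop e v : e v = v -> v \in LC e.
Proof. by move=> vv; apply/LCP; exists 0%N. Qed.

Lemma LC_step e v : (e v \in LC e) = (v \in LC e).
Proof.
apply/LCP/LCP => -[n H]; first by exists n.+1; rewrite iterSr.
by case: n H => [|n] H; [exists 0%N; rewrite /= in H *; rewrite !H|exists n; rewrite -iterSr].
Qed.

Lemma LC_min e A : (forall v, e v = v -> v \in A) ->
  (forall v, e v \in A -> v \in A) -> LC e \subset A.
Proof.
move=> lA sA; apply/subsetP => v /LCP[n]; elim: n v => [|n IH] v H; first exact: lA.
by apply/sA/IH; rewrite -iterSr.
Qed.

(** If [r] leads to no loop before or after the change, no path to a loop passes through [r] in
    either map. *)
Lemma LC_upd e r u : r \notin LC e -> r \notin LC (upd e r u) -> LC (upd e r u) = LC e.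
Proof.
suff H f g : (forall v, v != r -> f v = g v) -> r \notin LC f -> r \notin LC g -> LC f \subset LC g.
  move=> re ru; apply/eqP; rewrite eqEsubset !H // => v vr;
  by rewrite updE (negbTE vr).
move=> fg rf rg; suff: LC f \subset LC g :&: LC f by move/subsetIP => [].
apply: LC_min => v.
  move=> vv; rewrite in_setI (LC_loop vv) andbT; apply: LC_loop; rewrite -fg //.
  by apply: contraNneq rf => <-; apply: LC_loop.
rewrite !in_setI; case/andP; rewrite (LC_step f) => gv fv; rewrite fv andbT.
rewrite -LC_step -fg //.
by apply: contraNneq rf => <-.
Qed.

Definition is_loopless e := [forall v, e v != v].

Lemma LC_loopless e : is_loopless e = (LC e == set0).
Proof.
apply/forallP/eqP => [H|E0 v].
  by apply/eqP; rewrite -subset0; apply: LC_min => v; rewrite ?inE // => /eqP; rewrite (negbTE (H v)).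
by apply/eqP => /LC_loop; rewrite E0 inE.
Qed.

Lemma sum_family (Q : V -> pred V) (F : V -> V -> int) :
  \sum_(f : E | [forall v, Q v (f v)]) \prod_v F v (f v) = \prod_v \sum_(u | Q v u) F v u.
Proof.
rewrite bigA_distr_big_dep; apply: eq_bigl => f.
by apply/forallP/familyP.
Qed.

Definition splits f A := [forall v, (f v \in A) == (v \in A)].
Lemma splits_setP f A : reflect (forall v, (f v \in A) = (v \in A)) (splits f A).
Proof. by apply: (iffP forallP) => H v; [apply/eqP|apply/eqP]. Qed.

Definition restr f A : E := [ffun v => if v \in A then f v else v].
Definition paste A h g : E := [ffun v => if v \in A then h v else g v].

(** Self-maps of [A], extended by the identity so as to remain in [E]. The nodes outside [A] are
    then loops, so that [LC h == setT] in [full] only constrains [A]. *)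
Definition inside A : pred E := fun h => [forall v, if v \in A then h v \in A else h v == v].
Lemma insideP A h : reflect (forall v, if v \in A then h v \in A else h v == v) (inside A h).
Proof. exact: forallP. Qed.

Definition full A : pred E := fun h => inside A h && (LC h == setT).
Definition nfull A := #|[pred h | full A h]|.

Lemma restr_iter f A n v : splits f A -> v \in A ->
  iter n (restr f A) v = iter n f v /\ iter n f v \in A.
Proof.
move=> /splits_setP sA vA; elim: n => //= n [-> IH].
by rewrite ffunE IH sA IH.
Qed.

Lemma paste_splits A h g : inside A h -> inside (~: A) g -> splits (paste A h g) A.
Proof.
move=> /insideP hA /insideP gB; apply/splits_setP => v; rewrite ffunE; case: ifP => vA.
  by have := hA v; rewrite vA.
by have := gB v; rewrite !inE vA /= => /negbTE.
Qed.

Lemma restr_pasteL A h g : inside A h -> inside (~: A) g -> restr (paste A h g) A = h.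
Proof.
move=> /insideP hA /insideP gB; apply/ffunP => v; rewrite !ffunE; case vA: (v \in A) => //.
by have := hA v; rewrite vA => /eqP.
Qed.

Lemma restr_pasteR A h g : inside A h -> inside (~: A) g -> restr (paste A h g) (~: A) = g.
Proof.
move=> /insideP hA /insideP gB; apply/ffunP => v; rewrite !ffunE inE; case vA: (v \in A) => //=.
by have := gB v; rewrite inE vA /= => /eqP.
Qed.

Lemma restr_inside f A : splits f A -> inside A (restr f A).
Proof. by move=> /splits_setP sA; apply/insideP => v; rewrite ffunE; case vA: (v \in A); rewrite ?sA. Qed.

Lemma splitsC f A : splits f A -> splits f (~: A).
Proof. by move=> /splits_setP sA; apply/splits_setP => v; rewrite !inE sA. Qed.

Lemma paste_restr f A : paste A (restr f A) (restr f (~: A)) = f.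
Proof. by apply/ffunP => v; rewrite !ffunE !inE; case: (v \in A). Qed.

Lemma LC_restr f A : splits f A -> (LC (restr f A) == setT) = (A \subset LC f).
Proof.
move=> sA; apply/eqP/subsetP => [LT v vA|H].
  have /LCP[n H] : v \in LC (restr f A) by rewrite LT inE.
  apply/LCP; exists n; have [E1 E2] := restr_iter n sA vA; move: H.
  by rewrite E1 ffunE E2.
apply/setP => v; rewrite [RHS]inE; have [vA|vA] := boolP (v \in A).
  have /LCP[n vn] := H v vA; apply/LCP; exists n.
  by have [-> E2] := restr_iter n sA vA; rewrite ffunE E2.
by apply: LC_loop; rewrite ffunE (negbTE vA).
Qed.

(** Such a map is pasted from an element of [full A] and an arbitrary self-map of the complement.
    Only the inclusion of [A] in [LC f] is imposed, which leaves room for the cancellation in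
    [sum_split_sign]. *)
Lemma sum_split A (w : E -> int) :
  \sum_(f | splits f A && (A \subset LC f)) w (restr f (~: A)) =
  (nfull A)%:R * \sum_(g | inside (~: A) g) w g.
Proof.
rewrite (@sum_image _ _ _ (fun p : E * E => full A p.1 && inside (~: A) p.2) _
   (fun p => paste A p.1 p.2)) /=; first last.
- move=> f /andP[sA AL]; exists (restr f A, restr f (~: A)); last exact: paste_restr.
  by rewrite /= /full restr_inside //= LC_restr // AL restr_inside // splitsC.
- move=> [h g] /= /andP[/andP[hA hL] gB]; rewrite paste_splits //= -LC_restr ?paste_splits //.
  by rewrite restr_pasteL.
- move=> [h g] [h' g'] /= /andP[/andP[hA hL] gB] /andP[/andP[hA' hL'] gB'] EE.
  have -> : h = h' by rewrite -(restr_pasteL hA gB) EE restr_pasteL.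
  by have -> : g = g' by rewrite -(restr_pasteR hA gB) EE restr_pasteR.
rewrite /nfull -sum1_card natr_sum big_distrlr /= pair_big /=; apply: eq_bigr => -[h g].
by case/andP=> /andP[hA _] gB; rewrite mul1r restr_pasteR.
Qed.

Lemma sum_inside A (F : V -> V -> int) :
  \sum_(g | inside A g) \prod_(v in A) F v (g v) = \prod_(v in A) \sum_(u in A) F v u.
Proof.
rewrite [RHS]big_mkcond /=.
pose F' v u := if v \in A then F v u else 1.
pose Q v : pred V := fun u => if v \in A then u \in A else u == v.
transitivity (\prod_v \sum_(u | Q v u) F' v u); last first.
  apply: eq_bigr => v _; rewrite /Q /F'; case: ifP => // _.
  by rewrite big_pred1_eq.
rewrite -sum_family; apply: eq_big => g; last by rewrite big_mkcond.
by [].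
Qed.

(* Cancellation: the component of a loop can be moved in and out of [A]. *)
Lemma sum_split_sign f :
  \sum_(A | splits f A && (A \subset LC f)) (-1) ^+ #|[set v in ~: A | f v == v]| =
  (is_loopless f)%:R :> int.
Proof.
case: (boolP (is_loopless f)) => [fl|].
  have := fl; rewrite LC_loopless => /eqP L0.
  rewrite (big_pred1 set0) => [|A].
    rewrite (_ : [set v in _ | _] = set0) ?cards0 //.
    by apply/setP => v; rewrite !inE (negbTE (forallP fl v)).
  rewrite L0 subset0 /= andbC; case: eqP => //= ->.
  by apply/splits_setP => v; rewrite !inE.
case/forallPn => r /negPn/eqP rr.
pose R := [set v | `[< exists n, iter n f v = r >]].
have RP v : reflect (exists n, iter n f v = r) (v \in R) by rewrite inE; apply: asboolP.
have rR : r \in R by apply/RP; exists 0%N.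
have Rstep v : (f v \in R) = (v \in R).
  apply/RP/RP => -[n H]; first by exists n.+1; rewrite iterSr.
  case: n H => [|n] H; last by exists n; rewrite -iterSr.
  by exists 0%N; rewrite /= in H *; rewrite H.
have RL : R \subset LC f.
  by apply/subsetP => v /RP[n H]; apply/LCP; exists n; rewrite H.
have Rloop v : v \in R -> f v = v -> v = r.
  move=> /RP[n H] vv; rewrite -H {H}; elim: n => //= n <- //.
pose D A := [set v | (v \in A) (+) (v \in R)].
have DE B v : (v \in D B) = (v \in B) (+) (v \in R) by rewrite in_set.
have DK : involutive D by move=> A; apply/setP => v; rewrite !DE addbK.
have Dok A : splits f (D A) && (D A \subset LC f) = splits f A && (A \subset LC f).
  suff H B : splits f B && (B \subset LC f) -> splits f (D B) && (D B \subset LC f).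
    by apply/idP/idP => [/H|/H//]; rewrite DK.
  case/andP=> /splits_setP sB /subsetP BL; apply/andP; split.
    by apply/splits_setP => v; rewrite !DE sB Rstep.
  apply/subsetP => v; rewrite DE.
  by case vB: (v \in B); [move=> _; apply: BL|move/(subsetP RL)].
(* [R] is the component of the loop [r] and contains no other loop, so adding it to [A] or removing
   it changes the number of loops outside [A] by one. *)
have sgn A : (-1) ^+ #|[set v in ~: D A | f v == v]| =
   - (-1) ^+ #|[set v in ~: A | f v == v]| :> int.
  have E1 B : #|[set v in ~: B | f v == v]| =
     ((r \notin B) + #|[set v in ~: B | f v == v] :\ r|)%N.
    by rewrite (cardsD1 r) !inE rr eqxx andbT.
  have -> : #|[set v in ~: D A | f v == v]| =
      ((r \in A) + #|[set v in ~: A | f v == v] :\ r|)%N.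
    rewrite E1; congr (_ + _)%N; first by rewrite DE rR addbT negbK.
    apply: eq_card => v; rewrite !in_setD1; case: eqVneq => //= vr.
    rewrite [LHS]in_set [RHS]in_set !in_setC DE.
    case: (f v =P v) => [vv|]; rewrite ?andbF //.
    suff -> : (v \in R) = false by rewrite addbF.
    by apply/negP => vR; move: vr; rewrite (Rloop v vR vv) eqxx.
  by rewrite E1 !exprD; case: (r \in A); rewrite ?expr1 ?expr0 ?mulN1r ?mul1r ?opprK.
set S := LHS; suff SS : S = - S by rewrite -[RHS]/(0 : int); lia.
rewrite {1}/S (reindex_inj (inv_inj DK)) /=.
by rewrite (eq_big _ _ Dok (fun A _ => sgn A)) sumrN.
Qed.

(** Each node has [#|B| - 1] targets of weight 1, and itself with weight -1. *)
Lemma prod_signed (B : {set V}) :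
  \prod_(v in B) \sum_(u in B) (-1) ^+ (u == v) = (#|B|%:R - 2) ^+ #|B| :> int.
Proof.
rewrite -prodr_const; apply: eq_bigr => v vB.
rewrite (bigD1 v) //= eqxx expr1 (eq_bigr (fun=> 1)) => [|u /andP[_ /negbTE ->]] //.
rewrite sumr_const (_ : #|_| = #|B :\ v|); last by apply: eq_card => u; rewrite !inE andbC.
by have := cardsD1 v B; rewrite vB add1n => ->; rewrite -natr1; ring.
Qed.

(** With a weight x for each loop outside [A], and B the complement of [A], the power would be
    [(|B| - 1 + x)^|B|]. The value x = -1 is chosen because [sum_split_sign] then leaves only the
    loopless maps. *)
Lemma sum_nfull : \sum_(A : {set V}) (nfull A)%:R * (#|~: A|%:R - 2) ^+ #|~: A| =
  #|[pred e | is_loopless e]|%:R :> int.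
Proof.
transitivity (\sum_f \sum_(A | splits f A && (A \subset LC f))
    ((-1) ^+ #|[set v in ~: A | f v == v]| : int)).
  rewrite (exchange_big_dep predT) //=; apply: eq_bigr => A _.
  rewrite -prod_signed -(sum_inside _ (fun v u => (-1) ^+ (u == v))) -sum_split.
  apply: eq_bigr => f _; rewrite -prodr_const big_mkcond [RHS]big_mkcond /=.
  apply: eq_bigr => v _; rewrite ffunE !inE; case: (v \in A) => //=.
  by case: (f v == v).
rewrite (eq_bigr _ (fun f _ => sum_split_sign f)) -natr_sum; congr _%:R.
rewrite -sum1_card [RHS]big_mkcond; apply: eq_bigr => f _; rewrite inE; by case: ifP.
Qed.

(* Outside [LC y], the least node has no predecessor and avoids one target. *)
Definition forb (B : {set V}) v : option V :=
  if [pick c in B] == Some v then [pick u in B :\ v] else [pick c in B].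
Definition reduced y := [forall v, (v \notin LC y) ==> (forb (~: LC y) v != Some (y v))].

(** If B has two elements or more, each node avoids two distinct targets in B, itself and its
    forbidden one. If B is a single node nothing is left: the product is 0 while the power is -1,
    hence the correction. *)
Lemma prod_forb (B : {set V}) :
  \prod_(v in B) \sum_(u in B) ((u != v) && (forb B v != Some u))%:R =
  (#|B|%:R - 2) ^+ #|B| + (#|B| == 1%N)%:R :> int.
Proof.
have [B1|B1] := eqVneq #|B| 1%N.
  have /cards1P[c ->] := introT eqP B1.
  by rewrite big_set1 big_set1 eqxx cards1.
rewrite addr0 -prodr_const; apply: eq_bigr => v vB.
have [w [wB wv fE]] : exists w, [/\ w \in B, w != v & forb B v = Some w].
  rewrite /forb; case: pickP => [c cB|/(_ v)]; last by rewrite vB.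
  have [_|cv] := eqVneq (Some c) (Some v).
    case: pickP => [u|H].
      by rewrite !inE => /andP[uv uB]; exists u.
    case/eqP: B1; rewrite (cardsD1 v) vB; congr (_ + _)%N; apply: eq_card0 => u.
    by rewrite H.
  by exists c; split=> //; apply: contra cv => /eqP ->.
rewrite fE (bigD1 v) //= eqxx (bigD1 w) ?wB //= eqxx andbF !add0r.
rewrite (eq_bigr (fun=> 1)) => [|u /andP[/andP[uB ->] uw]].
  rewrite sumr_const.
  rewrite (_ : #|_| = #|B :\ v :\ w|); last by apply: eq_card => u; rewrite !inE; lia.
  have := cardsD1 v B; have := cardsD1 w (B :\ v); rewrite vB !inE wv wB /=; lia.
by rewrite (inj_eq (@Some_inj _)) eq_sym uw.
Qed.

Lemma reduced_split y (A := LC y) :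
  reduced y = [forall v in ~: A, (restr y (~: A) v != v) && (forb (~: A) v != Some (restr y (~: A) v))].
Proof.
apply/forallP/forall_inP => [H v vA|H v].
  rewrite ffunE vA; have := H v; rewrite -in_setC vA /= => ->; rewrite andbT.
  by apply: contraTneq vA => /LC_loop; rewrite in_setC => ->.
apply/implyP; rewrite -in_setC => vA; have := H v vA.
by rewrite ffunE vA => /andP[].
Qed.

(** The powers of [prod_forb] are those of [sum_nfull] and give the loopless maps; the corrections,
    at complements of single nodes, give the second sum. *)
Lemma card_reduced : #|[pred y | reduced y]| =
  (#|[pred e | is_loopless e]| + \sum_r nfull (~: [set r]))%N.
Proof.
apply/eqP; rewrite -(eqr_nat int) natrD; apply/eqP.
transitivity (\sum_(A : {set V}) (nfull A)%:R *
    ((#|~: A|%:R - 2) ^+ #|~: A| + (#|~: A| == 1%N)%:R) : int).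
  rewrite -sum1_card natr_sum (partition_big LC predT) //=; apply: eq_bigr => A _.
  rewrite -prod_forb.
  rewrite -(sum_inside _ (fun v u => ((u != v) && (forb (~: A) v != Some u))%:R)) -sum_split.
  rewrite big_mkcond [RHS]big_mkcond /=; apply: eq_bigr => y _.
  set P := \prod_(v in _) _.
  have PE : P = [forall v in ~: A, (restr y (~: A) v != v) && (forb (~: A) v != Some (restr y (~: A) v))]%:R.
    rewrite /P; case: forall_inP => [H|/forall_inP].
      by rewrite big1 // => v /H ->.
    case/forall_inPn => v vA /negbTE H; rewrite (bigD1 v) //= H mul0r //.
  have [LA|LA] := eqVneq (LC y) A.
    (* A reduced map selects [A = LC y]. For a proper subset the product vanishes: had it no zero
       factor, no loop would lie outside [A] and [LC_min] would force equality. *)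
    have sA : splits y A by apply/splits_setP => v; rewrite -LA LC_step.
    by rewrite sA LA subxx /= andbT PE inE reduced_split LA; case: ifP.
  rewrite andbF; case: ifP => // /andP[/splits_setP sA AL]; rewrite PE.
  case: forall_inP => // H; case/eqP: LA; apply/eqP; rewrite eqEsubset AL andbT.
  apply: LC_min => v; last by rewrite sA.
  move=> vv; apply: contraT => vA; have := H v; rewrite in_setC vA ffunE in_setC vA vv eqxx.
  by move=> /(_ isT).
rewrite (eq_bigr _ (fun A _ => mulrDr _ _ _)) big_split /= sum_nfull.
congr (_ + _); rewrite natr_sum.
rewrite (bigID (fun A : {set V} => #|~: A| == 1%N)) /= addrC big1 ?add0r; last first.
  by move=> A /negbTE ->; rewrite mulr0.
rewrite (@sum_image _ _ _ predT _ (fun r => ~: [set r])) //=.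
- by apply: eq_bigr => r _; rewrite setCK cards1 mulr1.
- by move=> r r' _ _ /setC_inj/set1_inj.
- by move=> r _; rewrite setCK cards1.
- by move=> A /cards1P[r rE]; exists r; rewrite // -rE setCK.
Qed.
End Endofunctions.

(** * The rank of the divergence on labelled forests *)

Section Labelled.
Variables (R : realType) (V : finType).
Local Notation E := {ffun V -> V}.
Local Notation fvec := (fvec R).

(* Forests with one root, the root being made a loop. *)
Definition rooted : finType := {x : V * E | x.2 x.1 == x.1}.
Local Notation A1 := {ffun rooted -> R^o}.
Local Notation A0 := {ffun E -> R^o}.
Definition rt1 (x : rooted) : V := (val x).1.
Definition en1 (x : rooted) : E := (val x).2.
Implicit Types (x : rooted) (y z e : E) (r c u v : V).

Fact cut_at_subproof r y : (r, upd y r r).2 (r, upd y r r).1 == (r, upd y r r).1.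
Proof. by rewrite /= upd_same. Qed.
Definition cut_at r y : rooted := exist _ (r, upd y r r) (cut_at_subproof r y).
Definition link x u : E := upd (en1 x) (rt1 x) u.

Lemma link_cut r y : link (cut_at r y) (y r) = y.
Proof. by rewrite /link /= upd_upd upd_id. Qed.
Lemma cut_link x u : cut_at (rt1 x) (link x u) = x.
Proof.
case: x => -[r e] er; apply: val_inj => /=; rewrite upd_upd.
have er' : e r = r by exact/eqP.
have E1 : upd e r r = e by rewrite -{2}er' upd_id.
by congr (_, _).
Qed.
Lemma link_root x u : link x u (rt1 x) = u. Proof. exact: upd_same. Qed.

Section WeightedOperator.
Variable w : V -> E -> bool.

(** [w r y] tells whether the edge of [y] leaving [r] may be added, or cut. Constantly true weights
    give the divergence, [off_LC] gives J. *)
Definition join_op : 'Hom(A1, A0) :=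
  lin_ext (fun x => \sum_(u | w (rt1 x) (link x u)) fvec (link x u)).
Definition cut_op : 'Hom(A0, A1) :=
  lin_ext (fun y => \sum_(r | w r y) fvec (cut_at r y)).

(** Adding an edge at the root and cutting an edge are inverse bijections between pairs of a rooted
    map and a target, and pairs of a map and a node. *)
Lemma sum_join_cut (F : rooted -> E -> R) :
  \sum_x \sum_(u | w (rt1 x) (link x u)) F x (link x u) =
  \sum_y \sum_(r | w r y) F (cut_at r y) y.
Proof.
rewrite !pair_big_dep /=.
apply: (@sum_bij _ _ _ _ _ (fun p : rooted * V => (link p.1 p.2, rt1 p.1))
   (fun p : E * V => (cut_at p.2 p.1, p.1 p.2))) => [[x u]|[y r]] /= H.
  by rewrite cut_link link_root.
by rewrite link_cut.
Qed.

Lemma lin_ext_coef (T U : finType) (f : T -> {ffun U -> R^o}) (a : {ffun T -> R^o}) (i : U) :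
  (lin_ext f a i : R) = \sum_t (a t : R) * (f t i : R).
Proof. by rewrite lin_extE sum_ffunE; apply: eq_bigr => t _; rewrite !ffunE. Qed.

Lemma sum_fvec_coef (T I : finType) (P : pred I) (F : I -> T) t :
  ((\sum_(i | P i) fvec (F i)) t : R) = \sum_(i | P i) (t == F i)%:R.
Proof. by rewrite sum_ffunE; apply: eq_bigr => i _; rewrite ffunE. Qed.

Lemma join_opE a y : (join_op a y : R) = \sum_(r | w r y) (a (cut_at r y) : R).
Proof.
rewrite lin_ext_coef.
under eq_bigr => x _ do rewrite sum_fvec_coef mulr_sumr.
rewrite (sum_join_cut (fun x y' => (a x : R) * (y == y')%:R)) (bigD1 y) //= [X in _ + X]big1 ?addr0.
  by apply: eq_bigr => r _; rewrite eqxx mulr1.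
by move=> y' y'y; rewrite big1 // => r _; rewrite eq_sym (negbTE y'y) mulr0.
Qed.

Lemma cut_opE b x : (cut_op b x : R) = \sum_(u | w (rt1 x) (link x u)) (b (link x u) : R).
Proof.
rewrite lin_ext_coef.
under eq_bigr => y _ do rewrite sum_fvec_coef mulr_sumr.
rewrite -(sum_join_cut (fun x' y => (b y : R) * (x == x')%:R)) (bigD1 x) //= [X in _ + X]big1 ?addr0.
  by apply: eq_bigr => r _; rewrite eqxx mulr1.
by move=> x' x'x; rewrite big1 // => r _; rewrite eq_sym (negbTE x'x) mulr0.
Qed.

Lemma join_cut_adjoint (a : A1) (b : A0) :
  \sum_y (b y : R) * (join_op a y : R) = \sum_x (cut_op b x : R) * (a x : R).
Proof.
under eq_bigr => y _ do rewrite join_opE mulr_sumr.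
under [RHS]eq_bigr => x _ do rewrite cut_opE mulr_suml.
by rewrite (sum_join_cut (fun x y => (b y : R) * (a x : R))).
Qed.

Lemma sum_sqr_eq0 (T : finType) (a : {ffun T -> R^o}) :
  \sum_t (a t : R) * (a t : R) = 0 -> a = 0.
Proof.
move/eqP; rewrite psumr_eq0 => [/allP H|t _]; last by rewrite -expr2 sqr_ge0.
apply/ffunP => t; rewrite ffunE; apply/eqP.
by have := H t; rewrite mem_index_enum mulf_eq0 orbb => /(_ isT).
Qed.

(** By adjunction the sum of the squares of the coefficients of [cut_op b] is the inner product of
    [b] with [join_op (cut_op b)]; real squares with sum 0 vanish. *)
Lemma join_cut_eq0 (b : A0) : join_op (cut_op b) = 0 -> cut_op b = 0.
Proof.
move=> H; apply: sum_sqr_eq0; rewrite -join_cut_adjoint H big1 // => y _.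
by rewrite ffunE mulr0.
Qed.
Lemma cut_join_eq0 (a : A1) : cut_op (join_op a) = 0 -> join_op a = 0.
Proof.
move=> H; apply: sum_sqr_eq0; rewrite join_cut_adjoint H big1 // => y _.
by rewrite ffunE mul0r.
Qed.

Lemma join_cut_inj : (limg cut_op :&: lker join_op = 0)%VS.
Proof.
apply/eqP; rewrite -subv0; apply/subvP => _ /memv_capP[/memv_imgP[b _ ->]].
by rewrite memv_ker => /eqP/join_cut_eq0 ->; rewrite mem0v.
Qed.
Lemma cut_join_inj : (limg join_op :&: lker cut_op = 0)%VS.
Proof.
apply/eqP; rewrite -subv0; apply/subvP => _ /memv_capP[/memv_imgP[b _ ->]].
by rewrite memv_ker => /eqP/cut_join_eq0 ->; rewrite mem0v.
Qed.

Lemma dim_cut_join : \dim (limg cut_op) = \dim (limg join_op).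
Proof.
apply/eqP; rewrite eqn_leq -{1}(limg_dim_eq join_cut_inj) -{2}(limg_dim_eq cut_join_inj).
by rewrite !dimvS //; apply/limgS/subvf.
Qed.

Lemma limg_join_cut : (join_op @: limg cut_op = limg join_op)%VS.
Proof.
apply/eqP; rewrite eqEdim limgS ?subvf //=.
by rewrite (limg_dim_eq join_cut_inj) dim_cut_join.
Qed.
End WeightedOperator.

Definition dH_lab := join_op (fun _ _ => true).
Definition off_LC r y := r \notin LC y.
Definition join_off := join_op off_LC.
Definition cut_off := cut_op off_LC.

Lemma span_fvecP (T : finType) (Q : pred T) (a : {ffun T -> R^o}) :
  reflect (forall t, ~~ Q t -> (a t : R) = 0) (a \in <<[seq fvec t | t in Q]>>%VS).
Proof.
apply: (iffP idP) => [|H].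
  move=> /coord_span -> t Qt; rewrite sum_ffunE big1 // => i _; rewrite ffunE.
  have /imageP[t' Qt' ->] : (in_tuple [seq fvec t | t in Q])`_i \in [seq fvec t | t in Q].
    apply: mem_nth; have := ltn_ord i; by rewrite /= ?size_image ?size_map -?cardE.
  rewrite ffunE; case: eqP => [E'|_]; last by rewrite scaler0.
  by move: Qt'; rewrite -E' => Qt'; rewrite (Qt' : Q t) in Qt.
rewrite [a]fvec_sum; apply: rpred_sum => t _; have [Qt|/H ->] := boolP (Q t); last by rewrite scale0r mem0v.
by apply/rpredZ/memv_span/imageP; exists t.
Qed.

(** * Alternating sums over sets of loops *)

Definition loops_at z (S : {set V}) : E := [ffun v => if v \in S then v else z v].
Lemma cut_loops_at r z S : cut_at r (loops_at z S) = cut_at r (loops_at z (r |: S)).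
Proof.
apply: val_inj; congr (_, _); apply/ffunP => v; rewrite !ffunE !inE.
by case: eqP => // ->.
Qed.

Lemma sum_toggle (P : pred {set V}) r (g : {set V} -> R) :
  (forall S, P (r |: S) = P (S :\ r)) -> \sum_(S | P S) (-1) ^+ #|S| * g (r |: S) = 0.
Proof.
move=> Pr; pose t (S : {set V}) := if r \in S then S :\ r else r |: S.
have tK : involutive t.
  move=> S; rewrite /t; case rS: (r \in S); first by rewrite setD11 setD1K.
  by rewrite setU11 setU1K // rS.
have tP S : P (t S) = P S.
  rewrite /t; case rS: (r \in S); [rewrite -Pr|rewrite Pr]; congr (P _);
    by apply/setP => v; rewrite !inE; case: eqP => //= ->.
have tr S : r |: t S = r |: S.
  by rewrite /t; case: ifP => rS; apply/setP => v; rewrite !inE; case: eqP.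
have ts S : (-1) ^+ #|t S| = - (-1) ^+ #|S| :> R.
  rewrite /t; case rS: (r \in S).
    by rewrite [in RHS](cardsD1 r) rS exprS mulN1r opprK.
  by rewrite cardsU1 rS exprS mulN1r.
set X := LHS; have : X = - X.
  rewrite {1}/X (reindex_inj (inv_inj tK)) -sumrN; apply: eq_big => S; first exact: tP.
  by move=> _; rewrite tr ts mulNr.
by move/eqP; rewrite -addr_eq0 -mulr2n mulrn_eq0 => /eqP.
Qed.

Lemma dH_labE a y : (dH_lab a y : R) = \sum_r (a (cut_at r y) : R).
Proof. exact: join_opE. Qed.

(** Cutting at [r] makes [r] a loop in any case, so the term does not depend on whether [r] is in
    [S]. Toggling [r] therefore cancels the contribution of every root that [P] allows to toggle. *)
Lemma dH_lab_sign a z (P : pred {set V}) (Q : pred V) :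
    (forall r S, ~~ Q r -> P (r |: S) = P (S :\ r)) ->
  \sum_(S | P S) (-1) ^+ #|S| * (dH_lab a (loops_at z S) : R) =
  \sum_(r | Q r) \sum_(S | P S) (-1) ^+ #|S| * (a (cut_at r (loops_at z S)) : R).
Proof.
move=> H; under eq_bigr => S _ do rewrite dH_labE mulr_sumr.
rewrite exchange_big /= (bigID Q) /= [X in _ + X]big1 ?addr0 // => r Qr.
under eq_bigr => S _ do rewrite cut_loops_at.
by rewrite (sum_toggle (fun S => (a (cut_at r (loops_at z S)) : R))) // => S; apply: H.
Qed.

Local Notation loopless_span := <<[seq fvec y | y in is_loopless (V := V)]>>%VS.

(** For a loopless [z], the alternating sum over all sets [S] vanishes on the image. On a
    combination of loopless maps it reduces to the coefficient at [z], because a nonempty [S]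
    creates loops. *)
Lemma dH_lab_loopless : (limg dH_lab :&: loopless_span = 0)%VS.
Proof.
apply/eqP; rewrite -subv0; apply/subvP => _ /memv_capP[/memv_imgP[a _ ->]] /span_fvecP H.
rewrite memv0; apply/eqP/ffunP => z; rewrite [RHS]ffunE.
have [zl|/H->//] := boolP (is_loopless z).
have := dH_lab_sign a z (P := predT) (Q := pred0) (fun _ _ _ => erefl).
rewrite big_pred0_eq (bigD1 set0) //= cards0 expr0 mul1r [X in _ + X]big1 ?addr0 => [|S S0].
  have -> : loops_at z set0 = z by apply/ffunP => v; rewrite ffunE inE.
  by [].
rewrite H ?mulr0 //; case/set0Pn: S0 => v vS; apply/forallPn; exists v.
by rewrite ffunE vS eqxx.
Qed.

(** Cutting a loop of [y] at [r] and applying the divergence gives [y] plus maps with one loop less,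
    whence an induction on the number of loops. *)
Lemma dH_lab_span : (limg dH_lab + loopless_span = fullv)%VS.
Proof.
apply/eqP; rewrite eqEsubv subvf /=; apply/subvP => a _; rewrite [a]fvec_sum.
apply: rpred_sum => y _; apply: rpredZ => {a}.
have [n] := ubnP #|[set v | y v == v]|; elim: n y => // n IH y yn.
have [yl|/forallPn[r /negPn/eqP yr]] := boolP (is_loopless y).
  by apply/(subvP (addvSr _ _))/memv_span/imageP; exists y.
have E : dH_lab (fvec (cut_at r y)) = fvec y + \sum_(u | u != r) fvec (upd y r u).
  rewrite lin_ext_fvec (bigD1 r) //=; congr (_ + _).
    by rewrite -{2}yr link_cut.
  by apply: eq_bigr => u _; rewrite /link /= upd_upd.
have -> : fvec y = dH_lab (fvec (cut_at r y)) - \sum_(u | u != r) fvec (upd y r u).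
  by rewrite E addrK.
apply: rpredB; first by apply/(subvP (addvSl _ _))/memv_img/memvf.
apply: rpred_sum => u ur; apply: IH; rewrite ltnS in yn; apply: leq_trans yn.
rewrite [X in (_ < X)%N](cardsD1 r) inE yr eqxx add1n ltnS subset_leq_card //.
apply/subsetP => v; rewrite !inE updE; case: (eqVneq v r) => [->|] //=.
by rewrite (negbTE ur).
Qed.

Lemma dim_ffun (T : finType) : \dim {:{ffun T -> R^o}} = #|T|.
Proof.
rewrite -[RHS](dim_fvec_span R predT); congr (\dim _); apply/eqP.
rewrite eqEsubv subvf andbT; apply/subvP => a _; exact/span_fvecP.
Qed.

Lemma rank_dH_lab : (\dim (limg dH_lab) + #|is_loopless (V := V)| = #|{: E}|)%N.
Proof.
have := dimv_sum_cap (limg dH_lab) loopless_span.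
by rewrite dH_lab_loopless dH_lab_span dimv0 addn0 dim_ffun dim_fvec_span.
Qed.

(** Modulo the image of J, a map is minus the sum of its variants with the edge of one node outside
    [LC] redirected, [LC] being kept. Edges into the picked node [c] are redirected one after the
    other, then, if needed, the edge of [c] itself. *)
Lemma join_off_span : (limg join_off + <<[seq fvec y | y in reduced (V := V)]>> = fullv)%VS.
Proof.
apply/eqP; rewrite eqEsubv subvf /=; apply/subvP => a _; rewrite [a]fvec_sum.
apply: rpred_sum => y _; apply: rpredZ => {a}.
set W := (_ + _)%VS; have WJ a : join_off a \in W by apply/(subvP (addvSl _ _))/memv_img/memvf.
have Jfvec v y' : v \notin LC y' ->
    join_off (fvec (cut_at v y')) = fvec y' + \sum_(u | off_LC v (upd y' v u) && (u != y' v)) fvec (upd y' v u).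
  move=> vy; rewrite lin_ext_fvec (bigD1 (y' v)) /=; last by rewrite /off_LC link_cut.
  congr (_ + _); first by rewrite link_cut.
  by apply: eq_big => u; rewrite /link /= upd_upd.
have step v y' : v \notin LC y' ->
   (forall u, off_LC v (upd y' v u) -> u != y' v -> fvec (upd y' v u) \in W) -> fvec y' \in W.
  move=> vy H; rewrite (_ : fvec y' = join_off (fvec (cut_at v y')) -
     \sum_(u | off_LC v (upd y' v u) && (u != y' v)) fvec (upd y' v u)); last first.
    by rewrite Jfvec // addrK.
  by apply: rpredB (WJ _) _; apply: rpred_sum => u /andP[]; apply: H.
have Wn y' : reduced y' -> fvec y' \in W.
  by move=> yn; apply/(subvP (addvSr _ _))/memv_span/imageP; exists y'.
case Ec: [pick c in ~: LC y] => [c|]; last first.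
  apply: Wn; apply/forallP => v; apply/implyP => vB.
  by move: Ec; case: pickP => // /(_ v); rewrite in_setC vB.
have cB : c \notin LC y by move: Ec; case: pickP => // c'; rewrite in_setC => + [<-].
have upd_LC y' v u : LC y' = LC y -> v \notin LC y -> off_LC v (upd y' v u) -> LC (upd y' v u) = LC y.
  by move=> yE vy vu; rewrite -yE LC_upd // yE.
have forbE y' v : LC y' = LC y -> v != c -> forb (~: LC y') v = Some c.
  by move=> -> vc; rewrite /forb Ec (inj_eq (@Some_inj _)) eq_sym (negbTE vc).
have no_pred y' : LC y' = LC y -> (forall v, y' v != c) -> fvec y' \in W.
  move=> yE nop; have [/Wn//|/forallPn[v]] := boolP (reduced y').
  rewrite negb_imply negbK => /andP[vL /eqP vf].
  have vc : v = c.
    apply/eqP; apply: contraT => vc; move: vf; rewrite forbE // => -[E'].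
    by have := nop v; rewrite -E' eqxx.
  subst v; apply: (step c) => // u uL uN; apply: Wn; have LE := upd_LC _ _ _ yE cB uL.
  have uc : u != c.
    by apply: contraNneq uL => ->; apply: LC_loop; rewrite upd_same.
  apply/forallP => v; apply/implyP => vL'; have [->|vc] := eqVneq v c.
    by rewrite LE -yE vf upd_same (inj_eq (@Some_inj _)) eq_sym.
  by rewrite forbE // updE (negbTE vc) (inj_eq (@Some_inj _)) eq_sym nop.
have [n] := ubnP #|[set v | y v == c]|; have yy : LC y = LC y by [].
elim: n {-2}y yy => // n IH y' yE yn.
have [/forallP|/forallPn[v /negPn/eqP vc]] := boolP [forall v, y' v != c]; first exact: no_pred.
have vL : v \notin LC y by rewrite -yE -LC_step vc yE.
apply: (step v) => [|u uL uN]; first by rewrite yE.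
apply: IH; first exact: upd_LC.
rewrite ltnS in yn; apply: leq_trans yn.
rewrite [X in (_ < X)%N](cardsD1 v) inE vc eqxx add1n ltnS subset_leq_card //.
apply/subsetP => w; rewrite !inE updE; case: (eqVneq w v) => //= _.
by rewrite -vc (negbTE uN).
Qed.

Definition lone_root : pred rooted := fun x => full (~: [set rt1 x]) (en1 x).
Local Notation Kspan := <<[seq fvec x | x in lone_root]>>%VS.

Lemma card_lone_root : #|lone_root| = (\sum_r nfull (V := V) (~: [set r]))%N.
Proof.
under eq_bigr => r _ do rewrite /nfull -sum1_card.
rewrite pair_big_dep /= -sum1_card.
rewrite (@sum_image _ _ _ lone_root _ (fun x => (rt1 x, en1 x))) //=.
- by move=> [[r e] er] [[r' e'] er'] _ _ [E1 E2]; apply: val_inj; exact: (congr2 pair E1 E2).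
- move=> [r e] /= H; have er : e r == r.
    by case/andP: (H) => /insideP/(_ r); rewrite !inE eqxx.
  by exists (exist _ (r, e) er).
Qed.

Lemma lone_root_pred x v : lone_root x -> en1 x v = rt1 x -> v = rt1 x.
Proof.
case/andP=> /insideP/(_ v); rewrite !inE; case: eqVneq => //= vr.
by move=> + _ E1; rewrite E1 eqxx.
Qed.

(** Choose [x] in the support of [a] with the most loops. An alternating sum of coefficients of
    [dH_lab a] over sets of loops avoiding the root isolates the coefficient of [a] at [x]. *)
Lemma lone_root_inj a : a \in Kspan -> dH_lab a = 0 -> a = 0.
Proof.
move=> /span_fvecP aK a0; apply/ffunP => x0; rewrite ffunE; apply/eqP; apply: contraT => ax0.
pose nl x := #|[set v | en1 x v == v]|.
have [x ax xmax] := @arg_maxnP _ x0 (fun x => (a x : R) != 0) nl ax0.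
have xK : lone_root x by apply: contraNT ax => /aK ->.
set c := rt1 x; set h := en1 x; have hc : h c = c by exact/eqP/(valP x).
(* [z] redirects all loops of [x] to its root [c]; making the nodes of [S0] loops again restores
   [x]. In the alternating sum only the cuts at [c] survive. *)
pose z : E := [ffun v => if h v == v then c else h v].
have zc : z c = c by rewrite ffunE hc eqxx.
have zl v : v != c -> z v != v.
  by move=> vc; rewrite ffunE; case: (h v =P v) => [_|/eqP//]; rewrite eq_sym.
pose S0 := [set v | (h v == v) && (v != c)].
have zS (S : {set V}) : c \notin S -> en1 (cut_at c (loops_at z S)) = loops_at z S.
  move=> cS; apply/ffunP => v; rewrite /en1 /= !ffunE; case: eqP => // ->.
  by rewrite (negbTE cS) hc eqxx.
have zS0 : loops_at z S0 = h.
  apply/ffunP => v; rewrite !ffunE inE; case: (h v =P v) => //= hv.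
  by case: eqVneq => [->|].
have PT r (S : {set V}) : ~~ pred1 c r -> (c \notin r |: S) = (c \notin S :\ r).
  by move=> /= rc; rewrite !inE eq_sym (negbTE rc).
have := dH_lab_sign a z (P := fun S => c \notin S) (Q := pred1 c) PT.
rewrite a0 big1 => [|S _]; last by rewrite ffunE mulr0.
rewrite big_pred1_eq => /esym H.
move: H; rewrite (bigD1 S0) /=; last by rewrite inE eqxx andbF.
rewrite [X in _ + X]big1 ?addr0 => [|S /andP[cS SS0]].
  have -> : cut_at c (loops_at z S0) = x.
    rewrite zS0 -(cut_link x c); congr cut_at.
    by rewrite /link -/h -/c -[X in upd _ _ X]hc upd_id.
  by move/eqP; rewrite mulf_eq0 signr_eq0 (negbTE ax).
have [->|aS] := eqVneq (a (cut_at c (loops_at z S)) : R) 0; first by rewrite mulr0.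
have SK : lone_root (cut_at c (loops_at z S)) by apply: contraNT aS => /aK ->.
(* A node of [S0] outside [S] would be a predecessor of the root, which K excludes. So [S] strictly
   contains [S0] and gives more loops than the maximum. *)
have S0S : S0 \subset S.
  apply/subsetP => v; rewrite inE => /andP[/eqP hv vc]; apply: contraT => vS.
  suff E1 : v = c by rewrite E1 eqxx in vc.
  by apply: (lone_root_pred SK); rewrite zS // ffunE (negbTE vS) ffunE hv eqxx.
have := xmax _ aS; rewrite /nl zS //.
have lE (T : {set V}) : c \notin T -> [set v | loops_at z T v == v] = c |: T.
  move=> cT; apply/setP => v; rewrite !inE ffunE; case: ifP => vT; first by rewrite eqxx orbT.
  have [->|vc] := eqVneq v c; first by rewrite zc eqxx.
  by rewrite (negbTE (zl _ vc)).
have cS0 : c \notin S0 by rewrite inE eqxx andbF.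
have lt : (#|S0| < #|S|)%N by rewrite proper_card // properEneq eq_sym SS0.
rewrite lE // -/h -zS0 lE // /geq /= !cardsU1 cS cS0 /=; lia.
Qed.

(* The nodes that reach a loop other than the root. *)
Definition LC1 x : {set V} := [set v | `[< exists n, let w := iter n (en1 x) v in
   en1 x w = w /\ w <> rt1 x >]].

Lemma LC1P x v : reflect (exists n, let w := iter n (en1 x) v in en1 x w = w /\ w <> rt1 x)
  (v \in LC1 x).
Proof. by rewrite inE; apply: asboolP. Qed.

Lemma en1_root x : en1 x (rt1 x) = rt1 x. Proof. exact/eqP/(valP x). Qed.

Lemma LC1_root x : rt1 x \notin LC1 x.
Proof.
apply/LC1P => -[n /= [_]]; apply; elim: n => //= n ->; exact: en1_root.
Qed.

Lemma LC1_step x v : v != rt1 x -> (en1 x v \in LC1 x) = (v \in LC1 x).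
Proof.
move=> vr; apply/LC1P/LC1P => -[n H]; first by exists n.+1; rewrite iterSr.
case: n H => [|n] H; last by exists n; rewrite -iterSr.
by exists 0%N; case: H => /= H1 H2; rewrite !H1.
Qed.

Lemma LC1_cut_sub r y : LC1 (cut_at r y) \subset LC y.
Proof.
apply/subsetP => v /LC1P[n]; elim: n v => [|n IH] v /=.
  rewrite /en1 /= updE; case: (eqVneq v r) => [-> [_ /(_ erefl)] //|_ [vv _]].
  exact: LC_loop.
rewrite -iterS iterSr => H; have [vr|vr] := eqVneq v r.
  subst v; have := LC1_root (cut_at r y); rewrite -/(rt1 _) => /LC1P[].
  by exists n.+1; rewrite iterSr.
by rewrite -LC_step; have := IH _ H; rewrite /en1 /= updE (negbTE vr).
Qed.

Lemma LC1_cut r y : r \notin LC y -> LC1 (cut_at r y) = LC y.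
Proof.
move=> ry; apply/eqP; rewrite eqEsubset LC1_cut_sub /=.
suff: LC y \subset LC1 (cut_at r y) :&: LC y by move/subsetIP => [].
have ne v : v \in LC y -> v != r by apply: contraTneq => ->.
apply: LC_min => v.
  move=> vv; have vL := LC_loop vv; rewrite in_setI vL andbT; apply/LC1P; exists 0%N.
  by split; [rewrite /en1 /= updE (negbTE (ne _ vL))|apply/eqP/ne].
rewrite !in_setI => /andP[]; rewrite LC_step => H vL; rewrite vL andbT.
by rewrite -LC1_step ?ne //= /en1 /= updE (negbTE (ne _ vL)).
Qed.

Lemma LC1_cut_proper r y : r \in LC y -> (#|LC1 (cut_at r y)| < #|LC y|)%N.
Proof.
move=> rL; apply/proper_card/properP; split; first exact: LC1_cut_sub.
by exists r => //; apply: (LC1_root (cut_at r y)).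
Qed.

(** The root of a forest in K, once linked to another node, leads to a loop; linked to itself, it is
    one. *)
Lemma lone_root_LC r y : lone_root (cut_at r y) -> LC y = setT.
Proof.
move=> yK; have sub : ~: [set r] \subset LC y.
  apply: subset_trans (LC1_cut_sub r y); apply/subsetP => v; rewrite !inE => vr.
  case/andP: (yK) => _ /eqP L; have /LCP[n nE] : v \in LC (en1 (cut_at r y)) by rewrite L inE.
  apply/asboolP; exists n => /=; split=> //.
  elim: n {nE} => [|n IH] /=; first exact/eqP.
  by move/(lone_root_pred yK).
apply/setP => v; rewrite [RHS]inE; have [->|vr] := eqVneq v r; last first.
  by apply: (subsetP sub); rewrite !inE.
have [yr|yr] := eqVneq (y r) r; first exact: LC_loop.
by rewrite -LC_step; apply: (subsetP sub); rewrite !inE.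
Qed.

(** Triangularity: cutting at a node off [LC y] keeps this set, cutting inside shrinks it. By
    induction on its size, the equation at [y] reduces to its J J^T part, and [join_cut_eq0]
    concludes; [a] only enters where [LC y = setT]. *)
Lemma cut_off_lone_root_inj b a : a \in Kspan -> dH_lab (cut_off b + a) = 0 -> cut_off b = 0 /\ a = 0.
Proof.
move=> aK H; suff b0 : cut_off b = 0.
  by split=> //; apply: lone_root_inj aK _; rewrite -H b0 add0r.
suff step j x : #|LC1 x| = j -> (cut_off b x : R) = 0.
  by apply/ffunP => x; rewrite [RHS]ffunE; apply: step erefl.
elim/ltn_ind: j x => j IH x xj.
(* The part of [b] at level [j]. As [cut_off] preserves levels, it yields the values of [cut_off b]
   at level [j] and 0 elsewhere. *)
pose b' : A0 := [ffun y => if #|LC y| == j then b y else 0].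
have LC_link x' u : off_LC (rt1 x') (link x' u) -> #|LC (link x' u)| = #|LC1 x'|.
  by move=> /LC1_cut; rewrite cut_link => ->.
have u'E x' : (cut_off b' x' : R) = if #|LC1 x'| == j then (cut_off b x' : R) else 0.
  rewrite !cut_opE; case: ifP => xj'; last first.
    by rewrite big1 // => u /LC_link E1; rewrite ffunE E1 xj'.
  by apply: eq_bigr => u /LC_link E1; rewrite ffunE E1 xj'.
suff: cut_off b' = 0.
  by move=> /ffunP/(_ x); rewrite ffunE -[LHS]/(cut_off b' x : R) u'E xj eqxx.
apply: join_cut_eq0; apply/ffunP => y; rewrite [RHS]ffunE.
transitivity (\sum_(r | off_LC r y) (cut_off b' (cut_at r y) : R)); first exact: join_opE.
under eq_bigr => r yr do rewrite u'E LC1_cut //.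
case: eqP => yj; last by rewrite big1.
(* At the top level every node leads to a loop, so the sum is empty; [a] contributes to no other
   level. *)
have [j_n|j_n] := eqVneq #|LC y| #|V|.
  rewrite big_pred0 // => r; apply/negbTE; rewrite negbK.
  by have /eqP/setP -> : LC y == setT by rewrite eqEcard subsetT cardsT j_n /=.
have : (dH_lab (cut_off b + a) y : R) = 0 by rewrite H ffunE.
rewrite dH_labE (eq_bigr (fun r => (cut_off b (cut_at r y) : R) + (a (cut_at r y) : R))) => [|r _]; last first.
  exact: ffunE.
rewrite big_split /= [X in _ + X]big1 ?addr0 => [|r _]; last first.
  apply: (span_fvecP _ _ aK); apply: contra j_n => /lone_root_LC ->; by rewrite cardsT.
rewrite (bigID (off_LC^~ y)) /= [X in _ + X]big1 ?addr0 // => r.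
rewrite negbK => /LC1_cut_proper; rewrite yj => rj; exact: (IH _ rj _ erefl).
Qed.

(** By injectivity the left side has dimension rank J + |K|. The reduced maps span a supplement of
    the image of J, so rank J is at least |E| minus their number, and by [card_reduced] and
    [rank_dH_lab] this reaches the rank of the divergence. *)
Lemma dH_lab_decomp : (dH_lab @: (limg cut_off + Kspan) = limg dH_lab)%VS.
Proof.
set U := (_ + _)%VS.
have UK : (U :&: lker dH_lab = 0)%VS.
  apply/eqP; rewrite -subv0; apply/subvP => _ /memv_capP[/memv_addP[_ /memv_imgP[b _ ->] [a aK ->]]].
  by rewrite memv_ker => /eqP/(cut_off_lone_root_inj aK)[-> ->]; rewrite addr0 mem0v.
have JK : (limg cut_off :&: Kspan = 0)%VS.
  apply/eqP; rewrite -subv0; apply/subvP => _ /memv_capP[/memv_imgP[b _ ->] JbK].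
  have [||-> _] := @cut_off_lone_root_inj b (- cut_off b); last exact: mem0v.
    by rewrite rpredN.
  by rewrite subrr linear0.
apply/eqP; rewrite eqEdim limgS ?subvf //= (limg_dim_eq UK).
have := dimv_sum_cap (limg cut_off) Kspan.
rewrite JK dimv0 addn0 dim_fvec_span dim_cut_join card_lone_root -/U => ->.
have H1 := rank_dH_lab; have := dimv_sum_cap (limg join_off) <<[seq fvec y | y in reduced (V := V)]>>.
rewrite join_off_span dim_ffun dim_fvec_span card_reduced -[#|_|]H1.
by rewrite -/join_off -[#|[pred e | is_loopless e]|]/#|is_loopless (V := V)|; lia.
Qed.
End Labelled.

(** * From labelled forests to isomorphism classes *)

Section Averaging.
Variables (R : realType) (gT : finGroupType) (X Y : finType).
Variables (act : gT -> X -> X) (cl : X -> Y).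
Hypothesis act_comp : forall s t x, act s (act t x) = act (t * s)%g x.
Hypothesis clP : forall x x', cl x = cl x' <-> exists s, x' = act s x.
Hypothesis cl_surj : forall y, exists x, cl x = y.
Local Notation fvec := (fvec R).

Definition pre y : X := sval (cid (cl_surj y)).
Lemma cl_pre y : cl (pre y) = y. Proof. exact: svalP (cid (cl_surj y)). Qed.

Definition class_pi : 'Hom({ffun X -> R^o}, {ffun Y -> R^o}) := lin_ext (fun x => fvec (cl x)).
Definition avg : 'End({ffun X -> R^o}) :=
  lin_ext (fun x => (#|{: gT}|%:R^-1 : R) *: \sum_s fvec (act s x)).
(** The symmetrized lift of a class. It is a section of [class_pi], and composed the other way it
    gives [avg]: classes are identified with invariant labelled combinations. *)
Definition class_sec : 'Hom({ffun Y -> R^o}, {ffun X -> R^o}) :=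
  lin_ext (fun y => avg (fvec (pre y))).

Definition act_lin s : 'End({ffun X -> R^o}) := lin_ext (fun x => fvec (act s x)).

Lemma eq_lin_fvec (T : finType) (W : vectType R) (f g : 'Hom({ffun T -> R^o}, W)) :
  (forall t, f (fvec t) = g (fvec t)) -> forall a, f a = g a.
Proof.
by move=> fg a; rewrite lfun_fvec [RHS]lfun_fvec; apply: eq_bigr => t _; rewrite fg.
Qed.

Lemma avgE a : avg a = (#|{: gT}|%:R^-1 : R) *: \sum_s act_lin s a.
Proof.
rewrite [avg a]lfun_fvec; under [in RHS]eq_bigr => s _ do rewrite (lfun_fvec (act_lin s)).
rewrite exchange_big /= scaler_sumr; apply: eq_bigr => x _.
rewrite lin_ext_fvec -scaler_sumr !scalerA mulrC; congr (_ *: _).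
by apply: eq_bigr => s _; rewrite lin_ext_fvec.
Qed.

Lemma avg_act s x : avg (fvec (act s x)) = avg (fvec x).
Proof.
rewrite !lin_ext_fvec; congr (_ *: _); rewrite [RHS](reindex_inj (mulgI s)) /=.
by apply: eq_bigr => t _; rewrite act_comp.
Qed.

Lemma class_pi_avg a : class_pi (avg a) = class_pi a.
Proof.
rewrite -comp_lfunE; apply: eq_lin_fvec => x; rewrite comp_lfunE [avg _]lin_ext_fvec.
rewrite linearZ linear_sum /=.
rewrite (eq_bigr (fun=> class_pi (fvec x))) => [|s _]; last first.
  by rewrite !lin_ext_fvec; congr (Defs.fvec _ _); apply/esym/clP; exists s.
rewrite sumr_const -scaler_nat scalerA mulVf ?scale1r //.
by rewrite pnatr_eq0 -lt0n; apply/card_gt0P; exists 1%g.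
Qed.

Lemma class_piK b : class_pi (class_sec b) = b.
Proof.
rewrite -comp_lfunE -[RHS]id_lfunE; apply: eq_lin_fvec => y.
by rewrite comp_lfunE id_lfunE lin_ext_fvec class_pi_avg lin_ext_fvec cl_pre.
Qed.

Lemma class_sec_pi a : class_sec (class_pi a) = avg a.
Proof.
rewrite -comp_lfunE; apply: eq_lin_fvec => x.
rewrite comp_lfunE [class_pi _]lin_ext_fvec lin_ext_fvec.
have [s ->] : exists s, pre (cl x) = act s x by apply/clP; rewrite cl_pre.
exact: avg_act.
Qed.

Lemma class_pi_span (Q : pred Y) :
  (class_pi @: <<[seq fvec x | x in (fun x => Q (cl x))]>> = <<[seq fvec y | y in Q]>>)%VS.
Proof.
apply/eqP; rewrite eqEsubv; apply/andP; split.
  rewrite limg_span; apply/span_subvP => _ /mapP[_ /imageP[x xQ ->] ->].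
  by rewrite lin_ext_fvec; apply/memv_span/imageP; exists (cl x).
apply/span_subvP => _ /imageP[y yQ ->]; rewrite -(cl_pre y) -(lin_ext_fvec (fun x => fvec (cl x))).
by apply/memv_img/memv_span/imageP; exists (pre y) => //; rewrite unfold_in /= cl_pre.
Qed.

Lemma class_sec_span (Q : pred Y) b : b \in <<[seq fvec y | y in Q]>>%VS ->
  class_sec b \in <<[seq fvec x | x in (fun x => Q (cl x))]>>%VS.
Proof.
move=> bQ; apply: subvP (memv_img class_sec bQ); rewrite limg_span.
apply/span_subvP => _ /mapP[_ /imageP[y yQ ->] ->]; rewrite !lin_ext_fvec.
apply/rpredZ/rpred_sum => s _; apply/memv_span/imageP; exists (act s (pre y)) => //.
rewrite unfold_in /= (_ : cl (act s (pre y)) = y) // -[RHS]cl_pre.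
by apply/esym/clP; exists s.
Qed.
End Averaging.

Section Equivariant.
Variables (R : realType) (gT : finGroupType) (X Y X' Y' : finType).
Variables (act : gT -> X -> X) (cl : X -> Y) (act' : gT -> X' -> X') (cl' : X' -> Y').
Hypothesis act_comp : forall s t x, act s (act t x) = act (t * s)%g x.
Hypothesis clP : forall x x', cl x = cl x' <-> exists s, x' = act s x.
Hypothesis cl_surj : forall y, exists x, cl x = y.
Hypothesis act'_comp : forall s t x, act' s (act' t x) = act' (t * s)%g x.
Hypothesis cl'P : forall x x', cl' x = cl' x' <-> exists s, x' = act' s x.
Hypothesis cl'_surj : forall y, exists x, cl' x = y.
Local Notation fvec := (fvec R).
Variables (f : 'Hom({ffun X -> R^o}, {ffun X' -> R^o})).
Hypothesis f_equiv : forall s x, f (fvec (act s x)) = act_lin R act' s (f (fvec x)).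

Lemma equivariant_avg a : f (avg R act a) = avg R act' (f a).
Proof.
rewrite -!comp_lfunE; apply: eq_lin_fvec => x; rewrite !comp_lfunE lin_ext_fvec.
by rewrite linearZ linear_sum /= avgE; congr (_ *: _); apply: eq_bigr => s _.
Qed.

Lemma class_pi_act s a : class_pi R cl' (act_lin R act' s a) = class_pi R cl' a.
Proof.
rewrite -comp_lfunE; apply: eq_lin_fvec => x; rewrite comp_lfunE [act_lin _ _ _ _]lin_ext_fvec.
by rewrite !lin_ext_fvec; congr (Defs.fvec _ _); apply/esym/cl'P; exists s.
Qed.

Definition descend : 'Hom({ffun Y -> R^o}, {ffun Y' -> R^o}) :=
  lin_ext (fun y => class_pi R cl' (f (fvec (pre cl_surj y)))).
Lemma descendE a : descend (class_pi R cl a) = class_pi R cl' (f a).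
Proof.
rewrite -!comp_lfunE; apply: eq_lin_fvec => x; rewrite !comp_lfunE [class_pi _ _ _]lin_ext_fvec.
rewrite lin_ext_fvec; have [s ->] : exists s, pre cl_surj (cl x) = act s x.
  by apply/clP; rewrite cl_pre.
by rewrite f_equiv class_pi_act.
Qed.

Variable F : 'Hom({ffun Y -> R^o}, {ffun Y' -> R^o}).
Hypothesis F_f : forall a, F (class_pi R cl a) = class_pi R cl' (f a).

(** An equivariant map commutes with averaging, hence with the symmetrized lifts; kernels on classes
    can thus be examined on labelled forests. *)
Lemma equivariant_sec b : f (class_sec R act cl_surj b) = class_sec R act' cl'_surj (F b).
Proof.
rewrite -[b in RHS](class_piK clP cl_surj) F_f (class_sec_pi act'_comp cl'P).
rewrite -equivariant_avg; congr (f _).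
by rewrite -(class_sec_pi act_comp clP cl_surj) (class_piK clP).
Qed.
End Equivariant.

Section Unlabelled.
Variables (R : realType) (N : nat).
Local Notation V := 'I_N.
Local Notation E := {ffun V -> V}.
Local Notation fvec := (fvec R).
Local Notation rooted := (rooted V).
Local Open Scope quotient_scope.
Implicit Types (e y : E) (x : rooted) (s : 'S_N).

Fact forest0_subproof e : @lforest_axiom 0 0 N [ffun v => Some (e v)]
  (ffun0 (card_ord 0) : {ffun 'I_0 -> V}) (ffun0 (card_ord 0) : {ffun 'I_0 -> V}).
Proof.
apply/and3P; split; [by apply/injectiveP => -[]| |by apply/injectiveP => -[]].
by apply/forallP => v; rewrite ffunE /= eqbF_neg; apply/codomP => -[[]].
Qed.
Definition forest0 e : lforest 0 0 N := @LForest 0 0 N (_, _, _) (forest0_subproof e).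

Fact forest1_subproof x : @lforest_axiom 1 0 N [ffun v => if v == rt1 x then None else Some (en1 x v)]
  [ffun=> rt1 x] (ffun0 (card_ord 0) : {ffun 'I_0 -> V}).
Proof.
apply/and3P; split; [by apply/injectiveP => i j _; rewrite (ord1 i) (ord1 j)| |by apply/injectiveP => -[]].
apply/forallP => v; rewrite ffunE; case: (eqVneq v (rt1 x)) => [->|vr] /=.
  by rewrite eqb_id; apply/codomP; exists ord0; rewrite ffunE.
by rewrite eqbF_neg; apply/codomP => -[i]; rewrite ffunE => E1; rewrite E1 eqxx in vr.
Qed.
Definition forest1 x : lforest 1 0 N := @LForest 1 0 N (_, _, _) (forest1_subproof x).

Definition cl0 e : aforest 0 0 N := \pi_(aforest 0 0 N) (forest0 e).
Definition cl1 x : aforest 1 0 N := \pi_(aforest 1 0 N) (forest1 x).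

Definition act0 s e : E := [ffun v => s (e (s^-1%g v))].
Fact act1_subproof s x : (s (rt1 x), act0 s (en1 x)).2 (s (rt1 x), act0 s (en1 x)).1 ==
  (s (rt1 x), act0 s (en1 x)).1.
Proof. by rewrite /= ffunE permK en1_root. Qed.
Definition act1 s x : rooted := exist _ (s (rt1 x), act0 s (en1 x)) (act1_subproof s x).

Lemma act0_comp s t e : act0 s (act0 t e) = act0 (t * s)%g e.
Proof. by apply/ffunP => v; rewrite !ffunE permM invMg permM. Qed.
Lemma act1_comp s t x : act1 s (act1 t x) = act1 (t * s)%g x.
Proof. by apply: val_inj; rewrite /= /rt1 /= -act0_comp permM. Qed.

Lemma rooted_eq x x' : rt1 x = rt1 x' -> en1 x = en1 x' -> x = x'.
Proof. by case: x x' => [[r e] er] [[r' e'] er'] E1 E2; apply/val_inj/(congr2 pair E1 E2). Qed.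

Lemma cl0P e e' : cl0 e = cl0 e' <-> exists s, e' = act0 s e.
Proof.
rewrite pi_iso; split=> [/existsP[s /iso_byP[A _ _]]|[s ->]].
  exists s; apply/ffunP => v; rewrite ffunE; have := A (s^-1%g v).
  by rewrite permKV /out /= !ffunE => -[].
apply/existsP; exists s; apply/iso_byP; split=> [v|[]//|[]//].
by rewrite /out /= !ffunE permK.
Qed.

Lemma cl1P x x' : cl1 x = cl1 x' <-> exists s, x' = act1 s x.
Proof.
rewrite pi_iso; split=> [/existsP[s /iso_byP[A B _]]|[s ->]].
  have rE : rt1 x' = s (rt1 x) by have := B ord0; rewrite /rt /= !ffunE.
  exists s; apply: rooted_eq => //; apply/ffunP => v; rewrite /= [RHS]ffunE.
  have := A (s^-1%g v); rewrite permKV /out /= !ffunE rE.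
  rewrite -{1}(permKV s v) (inj_eq perm_inj); case: eqP => [vr _|_ []//].
  by rewrite vr en1_root -rE -[v](permKV s) vr -rE en1_root.
apply/existsP; exists s; apply/iso_byP; split=> [v|i|[]//].
  rewrite /out /= !ffunE /rt1 /= (inj_eq perm_inj) -/(rt1 x); case: eqP => //= _.
  by rewrite permK.
by rewrite /rt /= !ffunE.
Qed.

Lemma cl0_surj g : exists e, cl0 e = g.
Proof.
have outS v : exists u, out (repr g) v = Some u.
  case E: (out (repr g) v) => [u|]; first by exists u.
  have /codomP[[]//] : v \in codom (rt (repr g)) by rewrite mem_rt E.
have [f fE] := fin_all_exists outS.
exists (finfun f); rewrite -[g]reprK; congr (\pi_(aforest 0 0 N) _).
by apply: lforestP => [v|[]//|[]//]; rewrite fE /out /= !ffunE.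
Qed.

Lemma cl1_surj g : exists x, cl1 x = g.
Proof.
set y := repr g; set r := rt y ord0.
have outE v : (out y v == None) = (v == r).
  rewrite -mem_rt; apply/codomP/eqP => [[i ->]|->]; last by exists ord0.
  by rewrite (ord1 i).
pose e : E := [ffun v => odflt r (out y v)].
have er : (r, e).2 (r, e).1 == (r, e).1 by rewrite /= ffunE (eqP (_ : out y r == None)) // outE.
exists (exist _ (r, e) er); rewrite -[g]reprK; congr (\pi_(aforest 1 0 N) _).
apply: lforestP => [v|i|[]//].
  rewrite /out /= ffunE -outE -/y; case E1: (out y v) => [u|] //=.
  by rewrite /en1 /= ffunE E1.
by rewrite /rt /= ffunE (ord1 i).
Qed.

Lemma link_act s x u : link (act1 s x) (s u) = act0 s (link x u).
Proof.
apply/ffunP => v; rewrite !updE /rt1 /en1 /= !ffunE -/(rt1 x) -/(en1 x).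
by rewrite -{1}(permKV s v) (inj_eq perm_inj); case: eqP.
Qed.
Lemma cut_act s r y : cut_at (s r) (act0 s y) = act1 s (cut_at r y).
Proof.
apply: rooted_eq => //; apply/ffunP => v; rewrite /en1 /= !ffunE.
by rewrite -{1}(permKV s v) (inj_eq perm_inj); case: eqP => // ->.
Qed.

Lemma LC_act s y v : (s v \in LC (act0 s y)) = (v \in LC y).
Proof.
have it n w : iter n (act0 s y) (s w) = s (iter n y w).
  by elim: n => //= n ->; rewrite ffunE permK.
apply/LCP/LCP => -[n H]; exists n; move: H; rewrite it ffunE permK; first by move/perm_inj.
by move->.
Qed.

Section Op.
Variable w : V -> E -> bool.
Hypothesis w_act : forall s r y, w (s r) (act0 s y) = w r y.

Lemma join_op_equiv s x : join_op R w (fvec (act1 s x)) = act_lin R act0 s (join_op R w (fvec x)).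
Proof.
rewrite !lin_ext_fvec linear_sum [LHS](reindex_inj (@perm_inj _ s)).
have rE : rt1 (act1 s x) = s (rt1 x) by [].
apply: eq_big => [u|u _]; rewrite link_act; first by rewrite rE w_act.
exact/esym/lin_ext_fvec.
Qed.
Lemma cut_op_equiv s y : cut_op R w (fvec (act0 s y)) = act_lin R act1 s (cut_op R w (fvec y)).
Proof.
rewrite !lin_ext_fvec linear_sum [LHS](reindex_inj (@perm_inj _ s)).
apply: eq_big => [r|r _]; first by rewrite w_act.
by rewrite cut_act; apply/esym/lin_ext_fvec.
Qed.
End Op.

Lemma dH_link x : dH R N (fvec (cl1 x)) = \sum_u fvec (cl0 (link x u)).
Proof.
rewrite lin_ext_fvec; have /existsP[s /iso_byP[A B _]] : iso (forest1 x) (repr (cl1 x)).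
  by apply/pi_iso; rewrite reprK.
rewrite [LHS](reindex_inj (@perm_inj _ s)); apply: eq_bigr => u _; congr (Defs.fvec _ _).
apply/esym/pi_iso/existsP; exists s; apply/iso_byP; split=> [v|[]//|[]//].
have -> : out (add_edge (repr (cl1 x)) (s u)) (s v) =
    if s v == rt (repr (cl1 x)) ord0 then Some (s u) else out (repr (cl1 x)) (s v).
  by rewrite -[LHS]/(add_edge_out (repr (cl1 x)) (s u) (s v)) ffunE.
have rE : rt (forest1 x) ord0 = rt1 x by rewrite /rt /= ffunE.
have oE : out (forest1 x) v = if v == rt1 x then None else Some (en1 x v).
  by rewrite /out /= ffunE.
have lE : out (forest0 (link x u)) v = Some (if v == rt1 x then u else en1 x v).
  by rewrite /out /= ffunE updE.
by rewrite lE B rE A oE (inj_eq perm_inj); case: eqP.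
Qed.

Local Notation pi0 := (class_pi R cl0).
Local Notation pi1 := (class_pi R cl1).
Local Notation sec0 := (class_sec R act0 cl0_surj).
Local Notation sec1 := (class_sec R act1 cl1_surj).
Local Notation dH := (dH R N).
Local Notation dH_lab := (dH_lab R V).
Local Notation join_off := (join_off R V).
Local Notation cut_off := (cut_off R V).

Lemma dH_lab_equiv s x : dH_lab (fvec (act1 s x)) = act_lin R act0 s (dH_lab (fvec x)).
Proof. exact: join_op_equiv. Qed.
Lemma off_LC_act s r y : off_LC (s r) (act0 s y) = off_LC r y.
Proof. by rewrite /off_LC LC_act. Qed.
Lemma join_off_equiv s x : join_off (fvec (act1 s x)) = act_lin R act0 s (join_off (fvec x)).
Proof. exact: (join_op_equiv off_LC_act). Qed.
Lemma cut_off_equiv s y : cut_off (fvec (act0 s y)) = act_lin R act1 s (cut_off (fvec y)).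
Proof. exact: (cut_op_equiv off_LC_act). Qed.

(* The edges added by [join_off_cls] leave a node that does not reach a loop. *)
Definition join_off_cls : 'Hom(fspan R 1 0 N, fspan R 0 0 N) := descend cl0 cl1_surj join_off.

Lemma dH_pi a : dH (pi1 a) = pi0 (dH_lab a).
Proof.
rewrite -!comp_lfunE; apply: eq_lin_fvec => x; rewrite !comp_lfunE [pi1 _]lin_ext_fvec dH_link.
by rewrite [dH_lab _]lin_ext_fvec linear_sum; apply: eq_bigr => u _; apply/esym/lin_ext_fvec.
Qed.
Lemma join_off_cls_pi a : join_off_cls (pi1 a) = pi0 (join_off a).
Proof. exact: (descendE cl1P cl1_surj cl0P join_off_equiv). Qed.

Lemma dH_lab_sec b : dH_lab (sec1 b) = sec0 (dH b).
Proof. exact: (equivariant_sec act1_comp cl1P _ act0_comp cl0P _ dH_lab_equiv dH_pi). Qed.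
Lemma join_off_sec b : join_off (sec1 b) = sec0 (join_off_cls b).
Proof. exact: (equivariant_sec act1_comp cl1P _ act0_comp cl0P _ join_off_equiv join_off_cls_pi). Qed.

Lemma pi0_full : (pi0 @: fullv = fullv)%VS.
Proof.
apply/eqP; rewrite eqEsubv subvf; apply/subvP => b _.
by rewrite -(class_piK cl0P cl0_surj b) memv_img ?memvf.
Qed.
Lemma pi1_full : (pi1 @: fullv = fullv)%VS.
Proof.
apply/eqP; rewrite eqEsubv subvf; apply/subvP => b _.
by rewrite -(class_piK cl1P cl1_surj b) memv_img ?memvf.
Qed.

Lemma cl0_loop e : ahas_loop (cl0 e) = ~~ is_loopless e.
Proof.
rewrite ahas_loop_pi negb_forall; apply: eq_existsb => v.
by rewrite /out /= ffunE negbK.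
Qed.

Local Notation unlooped := (fun g : aforest 0 0 N => ~~ ahas_loop g).
Lemma unloopedE : (fun e => unlooped (cl0 e)) =1 is_loopless (V := V).
Proof. by move=> e; rewrite cl0_loop negbK. Qed.

Lemma limg_dH : (limg dH = pi0 @: limg dH_lab)%VS.
Proof.
rewrite -pi1_full -!limg_comp; congr (_ @: _)%VS; apply/lfunP => a.
by rewrite !comp_lfunE dH_pi.
Qed.

Lemma dH_loopless : (limg dH :&: <<[seq fvec g | g in unlooped]>> = 0)%VS.
Proof.
apply/eqP; rewrite -subv0; apply/subvP => _ /memv_capP[/memv_imgP[b _ ->]].
move=> /(class_sec_span cl0P cl0_surj); rewrite -dH_lab_sec (eq_image unloopedE (fun _ => erefl)) => H.
have := memv_cap (dH_lab (sec1 b)) (limg dH_lab) <<[seq fvec y | y in is_loopless (V := V)]>>%VS.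
rewrite dH_lab_loopless H memv_img ?memvf // memv0 dH_lab_sec => /eqP H0.
by rewrite -(class_piK cl0P cl0_surj (dH b)) H0 linear0 mem0v.
Qed.

Lemma dH_span : (limg dH + <<[seq fvec g | g in unlooped]>> = fullv)%VS.
Proof.
rewrite limg_dH -(class_pi_span R cl0_surj) (eq_image unloopedE (fun _ => erefl)).
by rewrite -limgD dH_lab_span pi0_full.
Qed.

Lemma rank_dH : \dim (limg dH) = #|@ahas_loop 0 0 N|.
Proof.
have := dimv_sum_cap (limg dH) <<[seq fvec g | g in unlooped]>>%VS.
rewrite dH_loopless dH_span dimv0 addn0 dim_ffun dim_fvec_span.
rewrite -(cardC (@ahas_loop 0 0 N)) => /eqP; rewrite eqn_add2r => /eqP/esym.
by [].
Qed.

Variable K : pred (aforest 1 0 N).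
Hypothesis KE : forall x, K (cl1 x) = lone_root x.
Local Notation Kun := <<[seq fvec g | g in K]>>%VS.
Local Notation U := (pi1 @: limg cut_off)%VS.

Lemma sec_U v : v \in U -> exists b, sec1 v = cut_off b.
Proof.
case/memv_imgP => _ /memv_imgP[b _ ->] ->; exists (avg R act0 b).
by rewrite (class_sec_pi act1_comp cl1P) (equivariant_avg cut_off_equiv).
Qed.

Lemma sec_Kun a : a \in Kun -> sec1 a \in <<[seq fvec x | x in lone_root (V := V)]>>%VS.
Proof. by move=> /(class_sec_span cl1P cl1_surj); rewrite (eq_image KE (fun _ => erefl)). Qed.

Lemma sec1_eq0 v : sec1 v = 0 -> v = 0.
Proof. by move=> v0; rewrite -(class_piK cl1P cl1_surj v) v0 linear0. Qed.

(** [class_pi] carries the labelled decomposition down to classes, and [class_sec] lifts kernel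
    elements to labelled ones, where injectivity is known. J is injective on the same space [U] for
    the same reason, so [U] has the rank of J. *)
Lemma rank_dH_join_off_cls : \dim (limg dH) = (\dim (limg join_off_cls) + #|K|)%N.
Proof.
have E1 : (dH @: (U + Kun) = limg dH)%VS.
  rewrite -(class_pi_span R cl1_surj) (eq_image KE (fun _ => erefl)) -limgD.
  rewrite limg_dH -(dH_lab_decomp R V) -!limg_comp; congr (_ @: _)%VS.
  by apply/lfunP => a; rewrite !comp_lfunE dH_pi.
have inj u a : u \in U -> a \in Kun -> dH (u + a) = 0 -> u = 0 /\ a = 0.
  move=> /sec_U[b ub] /sec_Kun aK H.
  have : dH_lab (cut_off b + sec1 a) = 0 by rewrite -ub -linearD dH_lab_sec H linear0.
  by case/(cut_off_lone_root_inj aK); rewrite -ub => /sec1_eq0 -> /sec1_eq0 ->.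
have k0 : ((U + Kun) :&: lker dH = 0)%VS.
  apply/eqP; rewrite -subv0; apply/subvP => _ /memv_capP[/memv_addP[u uU [a aK ->]]].
  by rewrite memv_ker => /eqP/(inj _ _ uU aK)[-> ->]; rewrite addr0 mem0v.
have UK : (U :&: Kun = 0)%VS.
  apply/eqP; rewrite -subv0; apply/subvP => u /memv_capP[uU uK].
  have [||-> _] := inj u (- u) uU; last exact: mem0v.
    by rewrite rpredN.
  by rewrite subrr linear0.
have JU : (U :&: lker join_off_cls = 0)%VS.
  apply/eqP; rewrite -subv0; apply/subvP => u /memv_capP[/sec_U[b ub]].
  rewrite memv_ker => /eqP u0; have : join_off (cut_off b) = 0 by rewrite -ub join_off_sec u0 linear0.
  by move=> /join_cut_eq0; rewrite -/(cut_off) -ub => /sec1_eq0 ->; rewrite mem0v.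
have JE : (join_off_cls @: U = limg join_off_cls)%VS.
  rewrite -pi1_full -!limg_comp.
  have -> : (join_off_cls \o pi1 = pi0 \o join_off)%VF by apply/lfunP => a; rewrite !comp_lfunE join_off_cls_pi.
  by rewrite !limg_comp limg_join_cut.
rewrite -E1 (limg_dim_eq k0) -JE (limg_dim_eq JU) -(dim_fvec_span R K).
by have := dimv_sum_cap U Kun; rewrite UK dimv0 addn0.
Qed.
End Unlabelled.

Section ClassPredicates.
Local Open Scope quotient_scope.

Lemma to_stru_iso k p N (x y : lforest k p N) s : iso_by s x y ->
  to_stru y = smap s s^-1%g (to_stru x).
Proof.
move=> /iso_byP[A B C]; rewrite /to_stru /smap /=; congr (_, _, _).
- by apply/ffunP => v; rewrite ffunE -A permKV.
- by apply/ffunP => i; rewrite ffunE B.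
- by apply: eq_from_tnth => j; rewrite [RHS]tnth_map !tnth_mktuple C.
Qed.

Lemma natural_cls k p N (C : sclass k p) (x : lforest k p N) : natural C ->
  C _ (to_stru (repr (\pi_(aforest k p N) x))) = C _ (to_stru x).
Proof.
move=> Cn; have /existsP[s xs] : iso (repr (\pi_(aforest k p N) x)) x by apply/pi_iso; rewrite reprK.
rewrite (to_stru_iso xs); apply/idP/idP; first exact: Cn (permK s) (permKV s) _.
by move/(Cn _ _ _ _ (permKV s) (permK s)); rewrite smapK //; exact: permK.
Qed.

Definition class_pred k p N (C : sclass k p) : pred (aforest k p N) := fun g => C _ (to_stru (repr g)).

Lemma card_class_pred k p N (C : sclass k p) : (k <= 1)%N -> natural C ->
    (forall y : stru k p 'I_N, C _ y -> exists x : lforest k p N, y = to_stru x) ->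
  fcoef (cnt C) N = #|class_pred (N := N) C|%:R.
Proof. by move=> k1 Cn; apply: cnt_card => // x; apply: natural_cls. Qed.

End ClassPredicates.

Lemma cl_lone_root_nat : natural cl_lone_root.
Proof.
move=> V V' f g fK gK x /asboolP[h1 h2 h3]; apply/asboolP; split.
- exact: smap_forest.
- move=> v; rewrite smap_edE ffunE; have := h2 (g v).
  by case: (x.1.1 _) => //= w H [/(can_inj fK) E]; apply: H; rewrite E.
- move=> v vc; have [|w vw ww] := h3 (g v).
    by move=> E; apply: vc; rewrite ffunE -E gK.
  by exists (f w); rewrite ?smap_rchE ?fK // smap_ed // ww.
Qed.

Section Looped.
Variable N : nat.
Local Notation V := 'I_N.

Definition looped : pred (aforest 0 0 N) := class_pred cl_looped.
Definition isolated : pred (aforest 1 0 N) := class_pred cl_lone_root.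

Lemma rch_forest0 (e : {ffun V -> V}) v w :
  rch (to_stru (forest0 e)).1.1 v w <-> exists n, iter n e v = w.
Proof.
have it n : iter n (obind (to_stru (forest0 e)).1.1) (Some v) = Some (iter n e v).
  by elim: n => //= n ->; rewrite /= /out /= ffunE.
by split=> -[n]; rewrite ?it => H; exists n; [case: H|rewrite it H].
Qed.

Lemma looped_cl e : looped (cl0 e) = (LC e == setT).
Proof.
rewrite /looped /class_pred natural_cls; last exact: cl_looped_nat.
apply/asboolP/eqP => [H|LE v].
  apply/setP => v; rewrite [RHS]inE; have [w /rch_forest0[n <-]] := H v.
  by rewrite /= /out /= ffunE => -[ew]; apply/LCP; exists n.
have /LCP[n nE] : v \in LC e by rewrite LE inE.
exists (iter n e v); first by apply/rch_forest0; exists n.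
by rewrite /= /out /= ffunE nE.
Qed.

Lemma rch_forest1 (x : rooted V) v w : v <> rt1 x -> w <> rt1 x ->
  rch (to_stru (forest1 x)).1.1 v w <-> exists n, iter n (en1 x) v = w.
Proof.
move=> vr wr; split=> [|[n]].
  move=> vw; move: v vw vr; apply: rch_ind => [|u u' uE u'w IH ur]; first by exists 0%N.
  move: uE; rewrite /= /out /= ffunE; case: eqP => // _ [uE].
  have [|n nE] := IH; last by exists n.+1; rewrite iterSr uE.
  move=> u'r; apply: wr; rewrite -(@rch_root _ _ _ _ _ u'w) // u'r /= /out /= ffunE eqxx.
  by [].
elim: n v vr => [|n IH] v vr; first by move=> /= <-; apply: rch_refl.
rewrite iterSr => H; apply: (@rch_trans _ _ _ (en1 x v)).
  by apply: rch_step; rewrite /= /out /= ffunE; case: eqP.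
apply: IH => // E; apply: wr; rewrite -H E.
by elim: n {H} => //= n ->; apply: en1_root.
Qed.

Lemma isolated_cl (x : rooted V) : isolated (cl1 x) = lone_root x.
Proof.
rewrite /isolated /class_pred natural_cls; last exact: cl_lone_root_nat.
have oE v : (to_stru (forest1 x)).1.1 v = if v == rt1 x then None else Some (en1 x v).
  by rewrite /= /out /= ffunE.
have cE : (to_stru (forest1 x)).1.2 ord0 = rt1 x by rewrite /= /rt /= ffunE.
apply/asboolP/idP => [[_ h2 h3]|xK].
  have ne v : v != rt1 x -> en1 x v != rt1 x.
    move=> vr; apply/eqP => E; apply: (h2 v); rewrite oE cE (negbTE vr) E.
    by [].
  apply/andP; split.
    apply/insideP => v; rewrite !inE; have [->|/ne //] := eqVneq v (rt1 x).
    by rewrite en1_root eqxx.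
  apply/eqP/setP => v; rewrite [RHS]inE; have [->|/eqP vr] := eqVneq v (rt1 x).
    by apply: LC_loop; apply: en1_root.
  have [|w vw] := h3 v; first by rewrite cE.
  rewrite oE; case: eqP => // /eqP/eqP wr [ww].
  by have /rch_forest1[//|//|n nE] := vw; apply/LCP; exists n; rewrite nE.
split.
- apply/forest1E => v; rewrite oE cE; case: eqP => [->|//]; by split.
- move=> v; rewrite oE cE; case: eqP => // vr [E]; apply: vr; exact: (lone_root_pred xK E).
- move=> v; rewrite cE => vr; case/andP: (xK) => _ /eqP LE.
  have /LCP[n nE] : v \in LC (en1 x) by rewrite LE inE.
  have wr : iter n (en1 x) v <> rt1 x.
    by elim: n {nE} => //= n IH /(lone_root_pred xK).
  exists (iter n (en1 x) v); first by apply/rch_forest1 => //; exists n.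
  by rewrite oE; case: eqP => // _; rewrite nE.
Qed.
End Looped.

(** * Splitting off the components with a loop *)

Lemma perm_between (V : finType) (A B : {set V}) : #|A| = #|B| ->
  exists s : {perm V}, forall v, (s v \in B) = (v \in A).
Proof.
move=> AB; pose l (C : {set V}) := enum C ++ enum (~: C).
have lu C : uniq (l C).
  rewrite cat_uniq !enum_uniq andbT /=; apply/hasPn => v; rewrite !mem_enum inE.
  by case: (v \in C).
have lm C v : v \in l C by rewrite mem_cat !mem_enum inE orbN.
have ls C : size (l C) = #|V| by rewrite size_cat -!cardE cardsC.
pose f v := nth v (l B) (index v (l A)).
have ix v : (index v (l A) < size (l B))%N by rewrite ls -(ls A) index_mem.
have fI : injective f.
  move=> u v /eqP; rewrite /f (set_nth_default u v) // nth_uniq // => /eqP E.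
  by rewrite -(nth_index u (lm A u)) E nth_index.
exists (perm fI) => v; rewrite permE /f nth_cat -cardE -AB.
have iA : index v (l A) = if v \in A then index v (enum A) else (#|A| + index v (enum (~: A)))%N.
  by rewrite /l index_cat mem_enum -cardE.
rewrite iA; case vA: (v \in A).
  have H : (index v (enum A) < #|A|)%N by rewrite cardE index_mem mem_enum vA.
  have : nth v (enum B) (index v (enum A)) \in enum B by rewrite mem_nth // -cardE -AB.
  by rewrite H mem_enum => ->.
rewrite ltnNge leq_addr /= addKn; apply/negbTE.
suff : nth v (enum (~: B)) (index v (enum (~: A))) \in enum (~: B) by rewrite mem_enum inE.
rewrite mem_nth // -cardE; have := cardsC A; have := cardsC B => <-; rewrite AB => /addnI <-.
by rewrite cardE index_mem mem_enum inE vA.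
Qed.

Section Glue.
Variables (N i : nat).
Hypothesis iN : (i <= N)%N.
Local Notation j := (N - i)%N.

Fact junction_exists : exists2 b : 'I_i + 'I_j -> 'I_N, True & bijective b.
Proof.
have : #|{: 'I_i + 'I_j}| = #|'I_N| by rewrite card_sum !card_ord subnKC.
by case/card_bij=> f [g [fK gK]]; exists f => //; exists g.
Qed.
Definition jn : 'I_i + 'I_j -> 'I_N := s2val (cid2 junction_exists).
Lemma jn_bij : bijective jn. Proof. exact: s2valP' (cid2 junction_exists). Qed.
Fact jninv_exists : exists c, cancel jn c /\ cancel c jn.
Proof. by case: jn_bij => c; exists c. Qed.
Definition jninv := sval (cid jninv_exists).
Lemma jnK : cancel jn jninv. Proof. by case: (svalP (cid jninv_exists)). Qed.
Lemma jninvK : cancel jninv jn. Proof. by case: (svalP (cid jninv_exists)). Qed.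

Implicit Types (h : {ffun 'I_i -> 'I_i}) (y : {ffun 'I_j -> 'I_j}) (x : rooted 'I_j).

Definition glue0 h y : {ffun 'I_N -> 'I_N} := [ffun v => match jninv v with
  | inl a => jn (inl (h a)) | inr c => jn (inr (y c)) end].
Lemma glue0l h y a : glue0 h y (jn (inl a)) = jn (inl (h a)).
Proof. by rewrite ffunE jnK. Qed.
Lemma glue0r h y c : glue0 h y (jn (inr c)) = jn (inr (y c)).
Proof. by rewrite ffunE jnK. Qed.
Lemma jn_ind (P : 'I_N -> Prop) :
  (forall a, P (jn (inl a))) -> (forall c, P (jn (inr c))) -> forall v, P v.
Proof. by move=> Pl Pr v; rewrite -(jninvK v); case: (jninv v). Qed.

Fact glue1_subproof h x : (jn (inr (rt1 x)), glue0 h (en1 x)).2 (jn (inr (rt1 x)), glue0 h (en1 x)).1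
  == (jn (inr (rt1 x)), glue0 h (en1 x)).1.
Proof. by rewrite /= glue0r en1_root. Qed.
Definition glue1 h x : rooted 'I_N := exist _ (_, _) (glue1_subproof h x).

Lemma rt_glue1 h x : rt1 (glue1 h x) = jn (inr (rt1 x)). Proof. by []. Qed.
Lemma en_glue1 h x : en1 (glue1 h x) = glue0 h (en1 x). Proof. by []. Qed.

Definition jn_perm (s : 'S_i) (t : 'S_j) v := match jninv v with
  | inl a => jn (inl (s a)) | inr c => jn (inr (t c)) end.
Fact jn_perm_inj s t : injective (jn_perm s t).
Proof.
have jI := can_inj jnK.
by move=> u v; elim/jn_ind: u => a; elim/jn_ind: v => c; rewrite /jn_perm !jnK => /jI // [] /perm_inj ->.
Qed.

Lemma glue0_act s t h y : exists r, glue0 (act0 s h) (act0 t y) = act0 r (glue0 h y).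
Proof.
exists (perm (@jn_perm_inj s t)); set r := perm _.
have rl a : r (jn (inl a)) = jn (inl (s a)) by rewrite permE /jn_perm jnK.
have rr a : r (jn (inr a)) = jn (inr (t a)) by rewrite permE /jn_perm jnK.
apply/ffunP => v; elim/jn_ind: v => a; rewrite [RHS]ffunE.
  rewrite -(permKV s a); move: (s^-1%g a) => {}a.
  by rewrite [LHS]glue0l [act0 _ _ _]ffunE (permK s) -!rl (permK r) glue0l.
rewrite -(permKV t a); move: (t^-1%g a : 'I_j) => {}a.
by rewrite [LHS]glue0r [act0 _ _ _]ffunE (permK t) -!rr (permK r) glue0r.
Qed.

Lemma cl0_glue h y h' y' : cl0 h = cl0 h' -> cl0 y = cl0 y' -> cl0 (glue0 h y) = cl0 (glue0 h' y').
Proof.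
move=> /cl0P[s ->] /cl0P[t ->]; have [r E] := glue0_act s t h y.
by apply/cl0P; exists r.
Qed.

Lemma glue0_iterl h y n a : iter n (glue0 h y) (jn (inl a)) = jn (inl (iter n h a)).
Proof. by elim: n => //= n ->; rewrite glue0l. Qed.
Lemma glue0_iterr h y n a : iter n (glue0 h y) (jn (inr a)) = jn (inr (iter n y a)).
Proof. by elim: n => //= n ->; rewrite glue0r. Qed.
Lemma LC_gluel h y a : (jn (inl a) \in LC (glue0 h y)) = (a \in LC h).
Proof.
apply/LCP/LCP => -[n H]; exists n; move: H; rewrite glue0_iterl glue0l; last by move->.
by move/(can_inj jnK) => [].
Qed.
Lemma LC_gluer h y a : (jn (inr a) \in LC (glue0 h y)) = (a \in LC y).
Proof.
apply/LCP/LCP => -[n H]; exists n; move: H; rewrite glue0_iterr glue0r; last by move->.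
by move/(can_inj jnK) => [].
Qed.

Lemma link_glue1 h x u : link (glue1 h x) (jn (inr u)) = glue0 h (link x u).
Proof.
apply/ffunP => v; rewrite updE rt_glue1 en_glue1; elim/jn_ind: v => c.
  by rewrite !glue0l (inj_eq (can_inj jnK)).
rewrite !glue0r updE (inj_eq (can_inj jnK)) -[inr c == _]/(c == rt1 x).
by case: eqP.
Qed.
(** An edge from the root into the looped part makes the root lead to a loop, so J discards it. *)
Lemma link_gluel h x u : LC h = setT -> rt1 (glue1 h x) \in LC (link (glue1 h x) (jn (inl u))).
Proof.
move=> hL; rewrite -LC_step link_root; have /LCP[n nE] : u \in LC h by rewrite hL inE.
have E w : link (glue1 h x) (jn (inl u)) (jn (inl w)) = jn (inl (h w)).
  by rewrite updE rt_glue1 en_glue1 (inj_eq (can_inj jnK)) glue0l.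
have it m : iter m (link (glue1 h x) (jn (inl u))) (jn (inl u)) = jn (inl (iter m h u)).
  by elim: m => //= m ->; rewrite E.
by apply/LCP; exists n; rewrite it E nE.
Qed.

Lemma glue0_exists (e : {ffun 'I_N -> 'I_N}) (A : {set 'I_N}) : #|A| = i -> splits e A ->
  exists s h y, [/\ e = act0 s (glue0 h y), forall a, s (jn (inl a)) \in A
    & forall a, s (jn (inr a)) \notin A].
Proof.
move=> Ai /splits_setP eA; pose B := [set jn (inl a) | a : 'I_i].
have jI := can_inj jnK.
have Bi : #|B| = #|A| by rewrite card_imset ?card_ord // => a a' /jI[].
have inl_B a : jn (inl a) \in B by apply: imset_f.
have inr_B a : jn (inr a) \notin B by apply/imsetP => -[a' _ /jI].
have [s sA] := perm_between Bi.
have [e' e'E] : exists e', e' = act0 s^-1%g e by exists (act0 s^-1%g e).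
have e'B v : (e' v \in B) = (v \in B) by rewrite e'E ffunE invgK -sA permKV eA sA.
exists s, [ffun a => if jninv (e' (jn (inl a))) is inl a' then a' else a],
  [ffun a => if jninv (e' (jn (inr a))) is inr a' then a' else a]; split=> [|a|a]; rewrite ?sA //.
have -> : e = act0 s e' by rewrite e'E act0_comp mulVg; apply/ffunP => v; rewrite ffunE invg1 !perm1.
congr act0; apply/ffunP; apply: jn_ind => a; rewrite ?glue0l ?glue0r ffunE.
  have := e'B (jn (inl a)); rewrite inl_B; move: (e' _).
  by apply: jn_ind => c; rewrite jnK // (negbTE (inr_B c)).
have := e'B (jn (inr a)); rewrite (negbTE (inr_B a)); move: (e' _).
by apply: jn_ind => c; rewrite jnK // inl_B.
Qed.
End Glue.

Section Decompose.
Variable N : nat.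
Implicit Types (e : {ffun 'I_N -> 'I_N}) (x : rooted 'I_N).

Lemma cl0_decompose e : exists (i : 'I_N.+1) h y, [/\ cl0 e = cl0 (glue0 (leq_ord i) h y),
  LC h = setT & is_loopless y].
Proof.
have ci : (#|LC e| < N.+1)%N by rewrite ltnS -[X in (_ <= X)%N]card_ord max_card.
exists (Ordinal ci); have := leq_ord (Ordinal ci); rewrite /= => iN.
have [|s [h [y [E sl sr]]]] := @glue0_exists _ _ (leq_ord (Ordinal ci)) e (LC e) erefl.
  by apply/splits_setP => v; apply: LC_step.
exists h, y; split.
- by apply/esym/cl0P; exists s.
- apply/setP => a; rewrite [RHS]inE -(LC_gluel (leq_ord (Ordinal ci)) h y) -(LC_act s) -E.
  exact: sl.
- rewrite LC_loopless; apply/eqP/setP => a; rewrite [RHS]inE.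
  rewrite -(LC_gluer (leq_ord (Ordinal ci)) h y) -(LC_act s) -E; exact/negbTE/sr.
Qed.

(** The left part consists of the nodes leading to a loop other than that of the root, so that the
    rest comes from a loop-free forest with one root. *)
Lemma cl1_decompose x : exists (i : 'I_N.+1) h (x' : rooted 'I_(N - i)),
  [/\ cl1 x = cl1 (glue1 (leq_ord i) h x'), LC h = setT & forall v, en1 x' v = v -> v = rt1 x'].
Proof.
set A := LC1 x; have ci : (#|A| < N.+1)%N by rewrite ltnS -[X in (_ <= X)%N]card_ord max_card.
exists (Ordinal ci); set iN := leq_ord (Ordinal ci).
have rA : rt1 x \notin A := LC1_root x.
have [|s [h [y [E sl sr]]]] := @glue0_exists _ _ iN (en1 x) A erefl.
  apply/splits_setP => v; have [->|] := eqVneq v (rt1 x); last exact: LC1_step.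
  by rewrite en1_root.
have [r rE] : exists r, s (jn iN (inr r)) = rt1 x.
  rewrite -(permKV s (rt1 x)); move: (s^-1%g (rt1 x)) (permKV s (rt1 x)).
  move=> w; elim/(@jn_ind _ _ iN): w => a aE; last by exists a.
  by have := sl a; rewrite aE (negbTE rA).
have en v : en1 x (s v) = s (glue0 iN h y v) by rewrite E ffunE permK.
have yr : (r, y).2 (r, y).1 == (r, y).1.
  have := en1_root x; rewrite -rE en => /perm_inj; rewrite glue0r.
  by move/(can_inj (jnK iN)) => [] /= ->.
exists h, (exist _ (r, y) yr); split.
- apply/esym/cl1P; exists s; apply: rooted_eq; first exact/esym/rE.
  exact: E.
- apply/setP => a; rewrite [RHS]inE; have /LC1P[n [nE _]] := sl a.
  apply/LCP; exists n; move: nE; have it m : iter m (en1 x) (s (jn iN (inl a))) = s (jn iN (inl (iter m h a))).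
    by elim: m => //= m ->; rewrite en glue0l.
  by rewrite it en glue0l => /perm_inj/(can_inj (jnK iN))[].
- move=> v vv; apply/eqP; apply: contraT => vr.
  have := sr v; case/negP; apply/LC1P; exists 0%N; split.
    by rewrite /= en glue0r; congr (s (jn iN (inr _))).
  by rewrite /= -rE => /perm_inj/(can_inj (jnK iN))[] E1; rewrite E1 eqxx in vr.
Qed.
End Decompose.

Lemma cnt_cl_pointM (f : fps rat) N : fcoef (cnt cl_point * f) N.+1 = fcoef f N.
Proof.
rewrite /= (bigD1 (inord 1)) //= big1 ?addr0 => [|i /eqP i1].
  by rewrite -[_ / _]/(fcoef (cnt cl_point) _) cnt_cl_point inordK // eqxx mul1r subSS subn0.
rewrite -[X in X * _]/(fcoef (cnt cl_point) i) cnt_cl_point; case: eqP => [E|]; last by rewrite mul0r.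
by case: i1; apply: val_inj; rewrite /= inordK.
Qed.
Lemma cnt_cl_pointM_inj (f g : fps rat) : cnt cl_point * f = cnt cl_point * g -> f = g.
Proof. by move=> E; apply: fpsP => N; rewrite -[LHS]cnt_cl_pointM E; apply: cnt_cl_pointM. Qed.

(** Both sides times [z] agree, by [z b0 = t b0~] at [u = 0] and [t = z * looped], and [z] cancels.
    It counts the splitting into components with and without a loop. *)
Lemma cnt_looped : cnt (@cl_forest false 0 0) = cnt cl_looped * cnt (@cl_forest true 0 0).
Proof.
apply: cnt_cl_pointM_inj; rewrite /= -cnt_cl_lone_loop cnt_gather cnt_cl_loop -cnt_cl_lone_looped_T cnt_cl_lone_looped.
by rewrite mulrA.
Qed.

Lemma lin_ext_fvec_coef (R : realType) (T U : finType) (F : T -> U) (a : {ffun T -> R^o}) u :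
  (lin_ext (fun t => fvec R (F t)) a u : R) = \sum_t (a t : R) * (u == F t)%:R.
Proof. by rewrite lin_ext_coef; apply: eq_bigr => t _; rewrite fvecE. Qed.

(** * The rank of J as a convolution *)

Section Rank.
Variables (R : realType) (N : nat).
Local Notation fvec := (fvec R).
Local Notation unlooped := (fun g => ~~ ahas_loop g).
Local Notation loopless_span j := <<[seq fvec y | y : aforest 0 0 j in unlooped]>>%VS.

Definition core : finType := {i : 'I_N.+1 & aforest 0 0 i}.
Implicit Types (p q : core).
Local Notation rest p := (aforest 0 0 (N - tag p)).

Definition attach p (y : rest p) : aforest 0 0 N :=
  cl0 (glue0 (leq_ord (tag p)) (pre (@cl0_surj (tag p)) (tagged p)) (pre (@cl0_surj (N - tag p)) y)).

Lemma attach_cl (i : 'I_N.+1) h y :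
  @attach (Tagged (fun i : 'I_N.+1 => aforest 0 0 i) (cl0 h : aforest 0 0 i)) (cl0 y) = cl0 (glue0 (leq_ord i) h y).
Proof. by apply: cl0_glue; rewrite cl_pre. Qed.

Local Notation dec := ({p : core & rest p} : finType).
Definition decP : pred dec := fun d => looped (tagged (tag d)) && ~~ ahas_loop (tagged d).

Lemma attach_surj g : exists2 d, decP d & attach (tagged d) = g.
Proof.
have [e <-] := cl0_surj g; have [i [h [y [E hL yl]]]] := cl0_decompose e.
pose p : core := Tagged (fun i : 'I_N.+1 => aforest 0 0 i) (cl0 h : aforest 0 0 i).
exists (Tagged (fun p : core => rest p) (cl0 y : rest p)); last by rewrite /= attach_cl.
by rewrite /decP /= looped_cl hL eqxx cl0_loop negbK.
Qed.

Lemma card_unlooped k j : (k <= 1)%N ->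
  fcoef (cnt (@cl_forest true k 0)) j = #|[pred g : aforest k 0 j | ~~ ahas_loop g]|%:R.
Proof.
move=> k1; apply: cnt_card => // [x|y /asboolP/is_forestW/stru_forest]; last exact.
exact: (cl_forest_cls true).
Qed.
Lemma card_forests k j : (k <= 1)%N -> fcoef (cnt (@cl_forest false k 0)) j = #|{: aforest k 0 j}|%:R.
Proof.
move=> k1; apply: cnt_card => // [x|y /asboolP/is_forestW/stru_forest]; last exact.
by rewrite -cl_forest_cls.
Qed.
Lemma card_looped j : fcoef (cnt cl_looped) j = #|@looped j|%:R.
Proof.
apply: card_class_pred => [//||y /asboolP H]; first exact: cl_looped_nat.
apply: stru_forest => //; split=> [[]//|v|//]; split=> [vN|[[]//]].
by have [w /(rch_root vN) <-] := H v; rewrite vN.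
Qed.

Lemma sum_core (F : nat -> nat) : (\sum_(p : core | looped (tagged p)) F (tag p) =
  \sum_(i < N.+1) #|@looped i| * F i)%N.
Proof.
rewrite -(@sig_big_dep _ _ _ _ (fun i : 'I_N.+1 => aforest 0 0 i : finType) xpredT (fun i => @looped i)
  (fun i _ => F i)) /=.
by apply: eq_bigr => i _; rewrite sum_nat_const.
Qed.

Lemma card_decP : #|decP| = #|{: aforest 0 0 N}|.
Proof.
transitivity (\sum_(p : core | looped (tagged p)) #|[pred g : rest p | ~~ ahas_loop g]|)%N.
  rewrite -sum1_card -(@sig_big_dep _ _ _ _ (fun p : core => rest p : finType)
    (fun p => looped (tagged p)) (fun p g => ~~ ahas_loop g) (fun _ _ => 1%N)) /=.
  by apply: eq_bigr => p _; rewrite sum1_card.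
rewrite (sum_core (fun i => #|[pred g : aforest 0 0 (N - i) | ~~ ahas_loop g]|)).
apply/eqP; rewrite -(eqr_nat rat) natr_sum -(@card_forests 0 N) // cnt_looped /=.
by apply/eqP/eq_bigr => i _; rewrite natrM -card_looped -(@card_unlooped 0 (N - i)).
Qed.

(** A surjection between finite sets of equal size, the equality being the count [cnt_looped];
    uniqueness of the decomposition follows without comparing isomorphisms. *)
Lemma attach_inj : {in decP &, injective (fun d : dec => attach (tagged d))}.
Proof.
apply/image_injP; rewrite card_decP; apply/eqP/eq_card => g; rewrite [RHS]inE.
by have [d dP <-] := attach_surj g; apply/imageP; exists d.
Qed.

Lemma attach_inj_r p (y z : rest p) : looped (tagged p) -> ~~ ahas_loop y -> ~~ ahas_loop z ->
  attach y = attach z -> y = z.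
Proof.
move=> pL yl zl E.
have := @attach_inj (Tagged (fun p : core => rest p) y) (Tagged (fun p : core => rest p) z).
rewrite !unfold_in /decP /= pL yl zl => /(_ isT isT E) /eqP.
by rewrite eq_Tagged => /eqP.
Qed.
Lemma attach_inj_l p q (y : rest p) (z : rest q) : looped (tagged p) -> looped (tagged q) ->
  ~~ ahas_loop y -> ~~ ahas_loop z -> attach y = attach z -> p = q.
Proof.
move=> pL qL yl zl E.
have := @attach_inj (Tagged (fun p : core => rest p) y) (Tagged (fun p : core => rest p) z).
by rewrite !unfold_in /decP /= pL qL yl zl => /(_ isT isT E) /(congr1 tag).
Qed.

Definition attach_lin p : 'Hom(fspan R 0 0 (N - tag p), fspan R 0 0 N) :=
  lin_ext (fun y => fvec (attach y)).

Lemma attach_lin_same p b (y : rest p) : looped (tagged p) -> ~~ ahas_loop y ->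
  b \in loopless_span (N - tag p) -> (attach_lin p b (attach y) : R) = b y.
Proof.
move=> pL yl /span_fvecP bl; rewrite [LHS]lin_ext_fvec_coef (bigD1 y) //= eqxx mulr1.
rewrite [X in _ + X]big1 ?addr0 // => z zy.
have [zl|zl] := boolP (ahas_loop z); first by rewrite bl ?mul0r //= negbK.
case: eqP => [/(attach_inj_r pL yl zl) E|_]; last by rewrite mulr0.
by rewrite E eqxx in zy.
Qed.
Lemma attach_lin_diff p q b (y : rest p) : looped (tagged p) -> looped (tagged q) -> q != p ->
  ~~ ahas_loop y -> b \in loopless_span (N - tag q) -> (attach_lin q b (attach y) : R) = 0.
Proof.
move=> pL qL qp yl /span_fvecP bl; rewrite [LHS]lin_ext_fvec_coef big1 // => z _.
have [zl|zl] := boolP (ahas_loop z); first by rewrite bl ?mul0r //= negbK.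
case: eqP => [/(attach_inj_l pL qL yl zl) E|_]; last by rewrite mulr0.
by rewrite E eqxx in qp.
Qed.

(** The image of the loop-free divergence, whose dimension is the rank needed for s~. *)
Definition bounded j : {vspace fspan R 0 0 j} :=
  <<[seq (kill_loops R 0 0 j \o dH R j)%VF (fvec g) | g : aforest 1 0 j in unlooped]>>%VS.

Lemma kill_loopless j (a : fspan R 0 0 j) : kill_loops R 0 0 j a \in loopless_span j.
Proof.
rewrite lin_extE; apply: rpred_sum => g _; apply: rpredZ; case: ifP => gl; first exact: mem0v.
by apply/memv_span/imageP; exists g => //; rewrite unfold_in /= gl.
Qed.
Lemma bounded_sub j : (bounded j <= loopless_span j)%VS.
Proof. by apply/span_subvP => _ /imageP[g _ ->]; rewrite comp_lfunE kill_loopless. Qed.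

Lemma join_off_cls_fvec j (x : rooted 'I_j) :
  join_off_cls R j (fvec (cl1 x)) = \sum_(u | rt1 x \notin LC (link x u)) fvec (cl0 (link x u)).
Proof.
have -> : fvec (cl1 x) = class_pi R (@cl1 j) (fvec x) by rewrite [RHS]lin_ext_fvec.
rewrite join_off_cls_pi [join_off _ _ _]lin_ext_fvec linear_sum; apply: eq_bigr => u _.
exact: lin_ext_fvec.
Qed.

(** Edges into the looped part are discarded by [link_gluel]. In the other part the root is the only
    loop, so an added edge keeps the root away from loops exactly when the result is loopless: there
    J is the loop-free divergence. *)
Lemma join_off_cls_attach (i : 'I_N.+1) h (x : rooted 'I_(N - i))
    (p := Tagged (fun i : 'I_N.+1 => aforest 0 0 i) (cl0 h : aforest 0 0 i)) :
    LC h = setT -> (forall v, en1 x v = v -> v = rt1 x) ->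
  join_off_cls R N (fvec (cl1 (glue1 (leq_ord i) h x))) =
  attach_lin p ((kill_loops R 0 0 (N - i) \o dH R (N - i))%VF (fvec (cl1 x))).
Proof.
move=> hL xl; rewrite join_off_cls_fvec comp_lfunE dH_link.
have lk u : (rt1 x \notin LC (link x u)) = is_loopless (link x u).
  apply/idP/idP => [ux|].
    apply/forallP => v; apply/eqP => vv; move: (vv); rewrite updE; case: eqP => [E _|vr /xl //].
    by move: ux; rewrite LC_loop // -E.
  by rewrite LC_loopless => /eqP ->; rewrite inE.
rewrite (reindex (@jn N i (leq_ord i))) /=; last first.
  by apply: onW_bij; apply: jn_bij.
rewrite big_sumType /= big_pred0 ?add0r => [|a]; last first.
  by apply/negbTE; rewrite negbK link_gluel.
rewrite !linear_sum big_mkcond; apply: eq_bigr => u _.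
rewrite link_glue1 rt_glue1 LC_gluer lk /= [kill_loops _ _ _ _ _]lin_ext_fvec cl0_loop.
case: (is_loopless _) => /=; last by rewrite linear0.
by rewrite [RHS]lin_ext_fvec attach_cl.
Qed.

Lemma limg_join_off_cls : limg (join_off_cls R N) =
  (\sum_(p : core | looped (tagged p)) (attach_lin p @: bounded (N - tag p)))%VS.
Proof.
apply/eqP; rewrite eqEsubv; apply/andP; split.
  apply/subvP => _ /memv_imgP[a _ ->]; rewrite lfun_fvec; apply: rpred_sum => g _; apply: rpredZ.
  have [x <-] := cl1_surj g; have [i [h [x' [-> hL xl]]]] := cl1_decompose x.
  rewrite join_off_cls_attach //; pose p : core := Tagged (fun i : 'I_N.+1 => aforest 0 0 i) (cl0 h : aforest 0 0 i).
  apply: (subvP (sumv_sup p _ (subvv _))); first by rewrite /= looped_cl hL.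
  apply/memv_img/memv_span/imageP; exists (cl1 x') => //.
  rewrite unfold_in ahas_loop_pi; apply/existsP => -[v]; rewrite /out /= ffunE.
  by case: (eqVneq v (rt1 x')) => // vr /eqP[/xl E]; rewrite E eqxx in vr.
apply/subv_sumP => -[i g] /= gL; rewrite limg_span; apply/span_subvP => _ /mapP[_ /imageP[f fl ->] ->].
have [h hE] := cl0_surj g; subst g; have [x xE] := cl1_surj f; subst f.
have hL : LC h = setT by apply/eqP; rewrite -looped_cl.
rewrite -join_off_cls_attach ?memv_img ?memvf // => v vv; apply/eqP; apply: contraT => vr.
case/negP: fl; rewrite ahas_loop_pi; apply/existsP; exists v.
by rewrite /out /= ffunE (negbTE vr) vv.
Qed.

Lemma rank_join_off_cls : \dim (limg (join_off_cls R N)) =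
  (\sum_(i < N.+1) #|@looped i| * \dim (bounded (N - i)))%N.
Proof.
have dirP : directv (\sum_(p : core | looped (tagged p)) (attach_lin p @: bounded (N - tag p)))%VS.
  apply/directv_sum_independent => us usP us0 p pL.
  have usE q : exists b, looped (tagged q) -> us q = attach_lin q b /\ b \in loopless_span (N - tag q).
    have [qL|] := boolP (looped (tagged q)); last by exists 0.
    have /memv_imgP[b bB bE] := usP q qL; exists b => _; split=> //.
    exact: subvP (@bounded_sub _) _ bB.
  have [b bP] : {b : forall q, fspan R 0 0 (N - tag q) | forall q, looped (tagged q) ->
      us q = attach_lin q (b q) /\ b q \in loopless_span (N - tag q)}.
    exists (fun q => sval (cid (usE q))) => q; exact: svalP (cid (usE q)).
  have [-> bpl] := bP p pL; suff -> : b p = 0 by rewrite linear0.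
  apply/ffunP => y; rewrite [RHS]ffunE; have [yl|yl] := boolP (ahas_loop y).
    by have /span_fvecP -> := bpl; rewrite //= negbK.
  (* The coefficient at [attach y] sees only the summand of [p], since [attach] is injective on
     loop-free remainders. *)
  have : ((\sum_(q | looped (tagged q)) us q) (attach y) : R) = 0 by rewrite us0 ffunE.
  rewrite sum_ffunE (bigD1 p) //= big1 ?addr0 => [|q /andP[qL qp]].
    by have [-> _] := bP p pL; rewrite attach_lin_same.
  by have [-> bql] := bP q qL; apply: attach_lin_diff.
rewrite limg_join_off_cls (directvP dirP) /= -(sum_core (fun i => \dim (bounded (N - i)))).
apply: eq_bigr => p pL; apply: limg_dim_eq; apply/eqP; rewrite -subv0; apply/subvP => b.
case/memv_capP => /(subvP (@bounded_sub _)) bl; rewrite memv_ker memv0 => /eqP b0.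
apply/eqP/ffunP => y; rewrite [RHS]ffunE; have [yl|yl] := boolP (ahas_loop y).
  by have /span_fvecP -> := bl; rewrite //= negbK.
by rewrite -(attach_lin_same pL yl bl) b0 ffunE.
Qed.
End Rank.

(** * Generating functions *)

Section Slices.
Implicit Types A B : uz_series.

Definition slice k A : fps rat := Fps (fun N => (fcoef (fcoef A N) k)%:~R).

Lemma slice_inj A B : (forall k, slice k A = slice k B) -> A = B.
Proof.
move=> H; apply: fpsP => N; apply: fpsP => k; apply/eqP; rewrite -(eqr_int rat); apply/eqP.
by have /(congr1 (fun f => fcoef f N)) := H k.
Qed.
Lemma sliceD k A B : slice k (A + B) = slice k A + slice k B.
Proof. by apply: fpsP => N; rewrite /= rmorphD. Qed.
Lemma sliceN k A : slice k (- A) = - slice k A.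
Proof. by apply: fpsP => N; rewrite /= rmorphN. Qed.

(** Series constant in u, such as t, z and a: multiplying by them acts separately on each power of
    u. *)
Definition u_free A := forall N, exists n : nat, fcoef A N = n%:R.

Lemma fcoef_natr (T : comNzRingType) n k : fcoef (n%:R : fps T) k = if k is 0 then n%:R else 0.
Proof.
elim: n => [|n IH]; first by case: k.
by rewrite -addn1 natrD /= IH; case: k {IH} => [|k] /=; rewrite ?natrD ?addr0.
Qed.

Lemma fcoef_sum (T : comNzRingType) (I : Type) (r : seq I) (F : I -> fps T) k :
  fcoef (\sum_(i <- r) F i) k = \sum_(i <- r) fcoef (F i) k.
Proof. by elim/big_rec2: _ => //= i x y _ <-. Qed.

Lemma fcoefMn (T : comNzRingType) (f : fps T) n k : fcoef (f *+ n) k = fcoef f k *+ n.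
Proof. by elim: n => // n IH; rewrite !mulrSr /= IH. Qed.

Lemma slice_free k A : u_free A -> slice k.+1 A = 0.
Proof. by move=> AF; apply: fpsP => N /=; have [n ->] := AF N; rewrite fcoef_natr. Qed.

Lemma sliceM k A B : u_free A -> slice k (A * B) = slice 0 A * slice k B.
Proof.
move=> AF; apply: fpsP => N; rewrite /= fcoef_sum rmorph_sum; apply: eq_bigr => i _.
have [n ->] := AF i; rewrite fcoef_natr mulr_natl fcoefMn rmorphMn /=.
by rewrite [n%:R%:~R]rmorph_nat mulr_natl.
Qed.

Lemma slice_uX k B : slice k (uX * B) = if k is k'.+1 then slice k' B else 0.
Proof.
apply: fpsP => N; rewrite /= fcoef_sum (bigD1 ord0) //= [X in _ + X]big1 ?addr0 => [|i i0]; last first.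
  by case: i i0 => -[] //= i iN _; rewrite big1 // => j _; rewrite mul0r.
rewrite subn0; case: k => [|k]; first by rewrite big_ord1 mul0r.
rewrite (bigD1 (inord 1)) //= inordK // mul1r subSS subn0 big1 ?addr0 // => i /eqP i1.
case: eqP => [E|]; last by rewrite mul0r.
by case: i1; apply: val_inj; rewrite /= inordK.
Qed.

Lemma gf_z_free c : u_free (gf_z c).
Proof. by move=> [|N]; [exists 0%N|exists (c N.+1)]. Qed.
Lemma one_free : u_free 1.
Proof. by move=> N; exists (N == 0)%N. Qed.
Lemma zX_free : u_free zX.
Proof. by move=> N; exists (N == 1)%N. Qed.

Lemma slice_gf_z c (f : fps rat) : fcoef f 0 = 0 -> (forall N, fcoef f N = (c N)%:R) ->
  slice 0 (gf_z c) = f.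
Proof.
move=> f0 fc; apply: fpsP => -[|N]; rewrite ?f0 ?fc //=.
by rewrite fcoef_natr rmorph_nat.
Qed.
Lemma slice_gf_uz c k (f : fps rat) : fcoef f 0 = 0 -> (forall N, fcoef f N = (c k N)%:R) ->
  slice k (gf_uz c) = f.
Proof. by move=> f0 fc; apply: fpsP => -[|N]; rewrite ?f0 ?fc //= rmorph_nat. Qed.
Lemma slice_1gf_uz c k (f : fps rat) : fcoef f 0 = (k == 0)%:R -> (forall N, fcoef f N = (c k N)%:R) ->
  slice k (1 + gf_uz c) = f.
Proof.
move=> f0 fc; apply: fpsP => -[|N]; rewrite ?f0 ?fc /=.
  by rewrite addr0; case: k {f0 fc}.
by rewrite add0r rmorph_nat.
Qed.
Lemma slice_zX : slice 0 zX = cnt cl_point.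
Proof. by apply: fpsP => N; rewrite cnt_cl_point /= fcoef_natr; case: (N == 1). Qed.
Lemma slice_one : slice 0 1 = 1.
Proof. by apply: fpsP => N /=; rewrite fcoef_natr; case: N. Qed.
End Slices.

Section EmptyForest.
Variable R : realType.

Lemma no_forest k p : (0 < k + p)%N -> #|{: aforest k p 0}| = 0%N.
Proof.
move=> kp; apply: eq_card0 => g; case: k p kp g => [[//|p]|k p] _ g.
  by case: (cov (repr g) ord0).
by case: (rt (repr g) ord0).
Qed.
Lemma dim_empty k p (U : {vspace fspan R k p 0}) : (0 < k + p)%N -> \dim U = 0%N.
Proof.
move=> /no_forest E; have := dimvS (subvf U); rewrite dim_ffun E leqn0.
exact: eqP.
Qed.
End EmptyForest.

Section Dimensions.
Variable R : realType.

Lemma Omega_full k N : (k <= 1)%N -> Omega R k 0 N = fullv.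
Proof.
move=> k1; apply/eqP; rewrite eqEsubv subvf; apply/subvP => a _.
by rewrite -(wedge_id a k1 (leqnSn 0)) memv_img ?memvf.
Qed.

Lemma dim_loop_span N : \dim (loop_span R 0 0 N) = \dim (limg (dH R N)).
Proof. by rewrite rank_dH dim_fvec_span. Qed.

Lemma dim_Psi N : (\dim (Psi R N) + \dim (loop_span R 0 0 N) = #|{: aforest 1 0 N}|)%N.
Proof.
by rewrite dim_loop_span /Psi Omega_full // capvC limg_ker_dim dim_ffun.
Qed.

Lemma dim_Psi_df N : (\dim (Psi_df R N) + \dim (bounded R N) = \dim (Omega_df R 1 0 N))%N.
Proof.
rewrite /Psi_df capvC -[RHS](limg_ker_dim (kill_loops R 0 0 N \o dH R N)%VF); congr (_ + \dim _)%N.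
rewrite limg_span -map_comp; congr (<<_>>%VS); apply/eq_in_map => g _ /=.
by rewrite wedge_id.
Qed.

Lemma card_isolated N : fcoef (cnt cl_tree) N = #|@isolated N|%:R.
Proof.
rewrite -cnt_cl_lone_root; apply: card_class_pred => [//||y /asboolP[yF _ _]]; first exact: cl_lone_root_nat.
exact: stru_forest.
Qed.

Definition bounded_series : fps rat := Fps (fun N => (\dim (bounded R N))%:R).
Definition loop_series : fps rat := Fps (fun N => (\dim (loop_span R 0 0 N))%:R).

(** Both sides are the rank of the divergence: J contributes the convolution and K the term t. *)
Lemma loop_seriesE : loop_series = cnt cl_looped * bounded_series + cnt cl_tree.
Proof.
apply: fpsP => N; rewrite [LHS]/= dim_loop_span (rank_dH_join_off_cls R (@isolated_cl N)) rank_join_off_cls natrD.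
rewrite -card_isolated natr_sum; congr (_ + _); apply: eq_bigr => i _.
by rewrite natrM -card_looped.
Qed.

Lemma bounded_seriesE : cnt cl_tree * bounded_series = cnt cl_point * (loop_series - cnt cl_tree).
Proof. by rewrite loop_seriesE addrK -cnt_cl_lone_looped_T cnt_cl_lone_looped mulrA. Qed.
End Dimensions.

Section SlicesOfSeries.
Variable R : realType.

Lemma forest0_eq (g h : aforest 0 0 0) : g = h.
Proof.
rewrite -[g]reprK -[h]reprK; congr (\pi_(aforest 0 0 0) _)%qT.
by apply: lforestP => -[].
Qed.

Lemma cnt_forest0 k : fcoef (cnt (@cl_forest false k 0)) 0 = (k == 0)%:R.
Proof.
case: k => [|k]; last by rewrite -(dim_Omega R) // dim_empty.
rewrite card_forests //; congr _%:R; apply: (@eq_card1 _ (cl0 (ffun0 (card_ord 0)))) => g.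
by rewrite inE; apply/esym/eqP/forest0_eq.
Qed.
Lemma cnt_forest_df0 k : fcoef (cnt (@cl_forest true k 0)) 0 = (k == 0)%:R.
Proof.
case: k => [|k]; last by rewrite -(dim_Omega_df R) // dim_empty.
rewrite card_unlooped //; congr _%:R; apply: (@eq_card1 _ (cl0 (ffun0 (card_ord 0)))) => g.
rewrite inE [X in _ = X](introT eqP (forest0_eq _ _)).
by apply/existsP => -[[]].
Qed.
Lemma cnt_tree0 : fcoef (cnt cl_tree) 0 = 0.
Proof.
have E : #|@isolated 0| = 0%N.
  by apply/eqP; rewrite -leqn0; have := max_card (@isolated 0); rewrite no_forest.
by rewrite card_isolated E.
Qed.

Lemma slice_b0 k : slice k (b0_gf R) = cnt (@cl_forest false k 0).
Proof. by apply: slice_1gf_uz => [|N]; rewrite ?cnt_forest0 // dim_Omega. Qed.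
Lemma slice_b0_df k : slice k (b0_df_gf R) = cnt (@cl_forest true k 0).
Proof. by apply: slice_1gf_uz => [|N]; rewrite ?cnt_forest_df0 // dim_Omega_df. Qed.
Lemma slice_b1_df k : slice k (b1_df_gf R) = cnt (@cl_forest true k 1).
Proof. by apply: slice_gf_uz => [|N]; rewrite -(dim_Omega_df R) // dim_empty // addn1. Qed.
Lemma slice_t : slice 0 t_gf = cnt cl_tree.
Proof.
apply: slice_gf_z => [|N]; first exact: cnt_tree0.
by rewrite num_treesE cnt_cl_tree1.
Qed.
Lemma slice_a : slice 0 (a_gf R) = cnt (@cl_forest false 0 0).
Proof.
apply: fpsP => -[|N]; first by rewrite cnt_forest0 /= addr0.
by rewrite -(dim_Omega R) //= add0r fcoef_natr rmorph_nat.
Qed.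
Lemma slice_aring : slice 0 (aring_gf R) = loop_series R.
Proof.
apply: slice_gf_z => [|//]; rewrite /= dim_fvec_span (_ : #|_| = 0%N) //; apply: eq_card0 => g.
by apply/existsP => -[[]].
Qed.
Lemma slice_c1 : slice 0 (c1_gf R) = cnt (cl_bare false).
Proof. by apply: slice_gf_z => [|N]; rewrite -(dim_calI1 R) // dim_empty. Qed.
Lemma slice_c1_df : slice 0 (c1_df_gf R) = cnt (cl_bare true).
Proof. by apply: slice_gf_z => [|N]; rewrite -(dim_calI1_df R) // dim_empty. Qed.
Lemma slice_s : slice 0 (s_gf R) = cnt (@cl_forest false 1 0) - loop_series R.
Proof.
have sE N : fcoef (cnt (@cl_forest false 1 0) - loop_series R) N = (\dim (Psi R N))%:R.
  by rewrite /= -[_ / _]/(fcoef (cnt _) N) card_forests // -(dim_Psi R) natrD addrK.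
by apply: slice_gf_z => // ; rewrite sE dim_empty.
Qed.
Lemma slice_s_df : slice 0 (s_df_gf R) = cnt (@cl_forest true 1 0) - bounded_series R.
Proof.
have sE N : fcoef (cnt (@cl_forest true 1 0) - bounded_series R) N = (\dim (Psi_df R N))%:R.
  by rewrite /= -[_ / _]/(fcoef (cnt _) N) -(dim_Omega_df R) // -(dim_Psi_df R) natrD addrK.
by apply: slice_gf_z => // ; rewrite sE dim_empty.
Qed.
End SlicesOfSeries.

(** * Identities between the counts *)

Section CountIdentities.
Local Notation z := (cnt cl_point).
Local Notation t := (cnt cl_tree).
Local Notation t' := (cnt cl_mark_tree).

Lemma cnt_transfer k : t * cnt (@cl_forest true k 0) = z * cnt (@cl_forest false k 0).
Proof. by rewrite -cnt_cl_loop -cnt_gather cnt_cl_lone_loop. Qed.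

Lemma cnt_one_sub_tree : 1 - t != 0.
Proof.
apply/eqP => /(congr1 (fun f => fcoef f 0)) /eqP.
rewrite -[X in X == _]/(1 - fcoef t 0) cnt_tree0 subr0 oner_eq0.
by [].
Qed.

Lemma cnt_marked_tree : (1 - t) * t' = t.
Proof. by rewrite mulrBl mul1r {1}cl_mark_tree_cut addrK. Qed.

(** The recursion [cnt_marked] has right side involving t'; a second factor [1 - t] removes it
    through [(1 - t) t' = t]. The conditional is the coefficient of [u b0], zero at k = 0. *)
Lemma cnt_marked_df k : (1 - t) ^+ 2 * cnt (@cl_forest true k 1) =
  z * (t * cnt (@cl_forest false k 0) +
       (1 - t) * (if k is k'.+1 then cnt (@cl_forest false k' 0) else 0)).
Proof.
have E : (1 - t) * cnt (@cl_forest true k 1) = cnt (@cl_root true k) + t' * (z * cnt (@cl_forest false k 0)).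
  by rewrite mulrBl mul1r {1}cnt_marked cnt_cl_tree_mark1 -cnt_transfer; ring.
rewrite expr2 -mulrA E mulrDr [_ * (t' * _)]mulrA cnt_marked_tree mulrDr addrC.
congr (_ + _); first by rewrite mulrCA.
case: k {E} => [|k]; first by rewrite cnt_root0 !mulr0.
by rewrite cnt_rootS cnt_cl_loop cnt_transfer mulrCA.
Qed.

(** Without roots, [1 - t] times the count of marked forests is [t' b0] if loops are allowed and
    [t t' b0~] otherwise, and [t b0~ = z b0]. *)
Lemma cnt_marked_transfer : cnt (@cl_forest true 0 1) = z * cnt (@cl_forest false 0 1).
Proof.
apply: (mulfI (cnt_one_sub_tree)).
have E : (1 - t) * cnt (@cl_forest false 0 1) = t' * cnt (@cl_forest false 0 0).
  by rewrite mulrBl mul1r {1}cnt_marked cnt_root0 cnt_cl_tree_mark0; ring.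
rewrite [RHS]mulrCA E [RHS]mulrCA -cnt_transfer mulrBl mul1r {1}cnt_marked cnt_root0 cnt_cl_tree_mark1.
ring.
Qed.
End CountIdentities.

Lemma tree_gf_neq0 : t_gf != 0.
Proof.
apply/eqP => /(congr1 (slice 0)); rewrite slice_t => /(congr1 (fun f => fcoef f 1)).
(* By [t = z * looped], the coefficient of z in t is the number of looped forests on no node, and
   the empty forest is one. *)
rewrite -cnt_cl_lone_looped_T cnt_cl_lone_looped cnt_cl_pointM card_looped => /eqP.
rewrite -[X in _ == X]/0 pnatr_eq0 => /eqP/card0_eq/(_ (cl0 (ffun0 (card_ord 0)))).
rewrite -[_ \in _]/(looped _) looped_cl (_ : LC _ == setT) //.
by apply/eqP/setP => -[].
Qed.

Lemma one_sub_tree_gf_neq0 : 1 - t_gf != 0.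
Proof.
apply/eqP => /(congr1 (slice 0)); rewrite sliceD sliceN slice_one slice_t => E.
by have := cnt_one_sub_tree; rewrite E; apply/negP; rewrite negbK; apply/eqP/fpsP => N.
Qed.

Lemma eq_div_sqr (K : fieldType) (t u z b c : K) : 1 - t != 0 ->
  (1 - t) * ((1 - t) * c) = z * (t * b + u * b - t * (u * b)) ->
  c = z * b * ((t + u - u * t) / (1 - t) ^+ 2).
Proof.
move=> t1 E; apply: (mulfI t1); apply: (mulfI t1); rewrite E; field.
exact: t1.
Qed.

Lemma eq_add_div (K : fieldType) (t z s c : K) : t != 0 ->
  t * c = z * t + z * s -> c = z + z * s / t.
Proof. by move=> t0 E; apply: (mulfI t0); rewrite E; field. Qed.

Theorem theorem4p4 (R : realType) :
  [/\ (b0_df_gf R)%:F = zX%:F * (b0_gf R)%:F / t_gf%:F,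
      (b1_df_gf R)%:F
        = zX%:F * (b0_gf R)%:F
          * ((t_gf%:F + uX%:F - uX%:F * t_gf%:F) / (1 - t_gf%:F) ^+ 2),
      c1_df_gf R = zX * c1_gf R,
      (s_df_gf R)%:F = zX%:F + zX%:F * (s_gf R)%:F / t_gf%:F
    & zX%:F + zX%:F * (s_gf R)%:F / t_gf%:F
        = zX%:F
          + zX%:F * ((a_gf R)%:F * t_gf%:F - (aring_gf R)%:F) / t_gf%:F].
Proof.
have tF := @gf_z_free num_trees; have zF := zX_free.
have t0 : t_gf%:F != 0 by rewrite tofrac_eq0 tree_gf_neq0.
have t1 : 1 - t_gf%:F != 0 by rewrite -tofrac1 -tofracB tofrac_eq0 one_sub_tree_gf_neq0.
have tM k B : slice k (t_gf * B) = cnt cl_tree * slice k B by rewrite sliceM // slice_t.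
have zM k B : slice k (zX * B) = cnt cl_point * slice k B by rewrite sliceM // slice_zX.
have P1 : t_gf * b0_df_gf R = zX * b0_gf R.
  apply: slice_inj => k; rewrite tM zM slice_b0 slice_b0_df.
  exact: cnt_transfer.
have P2 : (1 - t_gf) * ((1 - t_gf) * b1_df_gf R) =
    zX * (t_gf * b0_gf R + uX * b0_gf R - t_gf * (uX * b0_gf R)).
  apply: slice_inj => k; rewrite !(mulrBl, mul1r, mulrBr) !(slice_b0, slice_b1_df, tM, zM, slice_uX, sliceN, sliceD).
  have := cnt_marked_df k; case: k => [|k]; rewrite ?slice_b0; set m := cnt (@cl_forest true _ 1) => E.
    transitivity ((1 - cnt cl_tree) ^+ 2 * m); [ring|rewrite E; ring].
  transitivity ((1 - cnt cl_tree) ^+ 2 * m); [ring|rewrite E; ring].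
have P3 : c1_df_gf R = zX * c1_gf R.
  apply: slice_inj => -[|k]; rewrite zM; last first.
    by rewrite !slice_free ?mulr0 //; apply: gf_z_free.
  by rewrite slice_c1 slice_c1_df !cnt_cl_bare !cnt_cl_cut_bare cnt_marked_transfer.
(* The coefficient of u in b0 is [t a], as a root and its tree split off from a forest without
   roots; the rank of the divergence is the coefficient of [aring]. *)
have P5 : s_gf R = t_gf * a_gf R - aring_gf R.
  apply: slice_inj => -[|k]; rewrite sliceD sliceN tM.
    by rewrite slice_s slice_aring slice_a cnt_cl_forest1 cnt_cl_loop.
  rewrite !sliceD !slice_free ?mulr0 ?subr0 ?addr0 ?mulr0 //; try exact: gf_z_free; exact: one_free.
(* Let b be the coefficient of u in b0. Then [t * s~] is [z b - z (aring - t)] and s is [b - aring]: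
   the term [z t], hence the summand z of s~, comes from K. *)
have P4 : t_gf * s_df_gf R = zX * t_gf + zX * s_gf R.
  apply: slice_inj => -[|k]; rewrite sliceD tM !zM.
    rewrite slice_t slice_s slice_s_df mulrBr cnt_transfer bounded_seriesE; ring.
  by rewrite !slice_free ?mulr0 ?addr0 //; apply: gf_z_free.
split=> //.
- have := congr1 (@tofrac _) P1; rewrite !tofracM => E.
  by apply: (mulfI t0); rewrite E [RHS]mulrC divfK.
- have := congr1 (@tofrac _) P2; rewrite !(tofracM, tofracD, tofracN, tofrac1).
  exact: eq_div_sqr.
- have := congr1 (@tofrac _) P4; rewrite !(tofracM, tofracD).
  exact: eq_add_div.
- by rewrite P5 tofracB tofracM [X in _ = _ + _ * (X - _) / _]mulrC.
Qed.
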